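(* Let $M$ be a smooth Riemannian manifold of dimension $d$, $\psi:M\to M$ a $C^1$ map, and $\Lambda\subset M$ a repeller of $\psi$. Then $$\overline{\dim}_B\Lambda\le\dim_{S^*}\Lambda,$$ where $\overline{\dim}_B$ is the upper box-counting dimension and $\dim_{S^*}\Lambda$ is the singularity dimension of $\Lambda$ with respect to $\psi$.
   Context: Repeller: a (non-empty) compact set $\Lambda\subset M$ with $\psi(\Lambda)=\Lambda$ is a repeller of $\psi$ (and $\psi$ is expanding on $\Lambda$) if (a) there is $\lambda>1$ such that $\|(D_z\psi)v\|\ge\lambda\|v\|$ for all $z\in\Lambda$, $v\in T_zM$ (with respect to a Riemannian metric on $M$); and (b) there is an open neighbourhood $V$ of $\Lambda$ such that $\Lambda=\{z\in V:\psi^n(z)\in V\text{ for all }n\ge0\}$. Singular value function: for a linear map $T$ between $d$-dimensional inner product spaces let $\alpha_1(T)\ge\cdots\ge\alpha_d(T)$ be the singular values; for $s\ge0$ set $\phi^s(T)=\alpha_1(T)\cdots\alpha_k(T)\alpha_{k+1}(T)^{s-k}$ with $k=[s]$ (integer part) if $0\le s\le d$ (for $s=d$ this is $\alpha_1(T)\cdots\alpha_d(T)$), and $\phi^s(T)=|\det(T)|^{s/d}=(\alpha_1(T)\cdots\alpha_d(T))^{s/d}$ if $s>d$. Pressure: for a continuous map $T$ of a compact metric space $(X,d)$ and a sub-additive potential $\mathcal{G}=\{g_n\}_{n\ge1}$ (continuous functions $g_n:X\to\mathbb{R}$ with $g_{m+n}(x)\le g_n(x)+g_m(T^nx)$), put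 $d_n(x,y)=\max_{0\le i\le n-1}d(T^ix,T^iy)$, call $E$ $(n,\varepsilon)$-separated if $d_n(x,y)>\varepsilon$ for distinct $x,y\in E$, let $P_n(X,T,\mathcal{G},\varepsilon)=\sup\{\sum_{x\in E}\exp(g_n(x)):E\subset X\ (n,\varepsilon)\text{-separated}\}$ and $P(X,T,\mathcal{G})=\lim_{\varepsilon\to0}\limsup_{n\to\infty}\frac1n\log P_n(X,T,\mathcal{G},\varepsilon)$. Singularity dimension: $\dim_{S^*}\Lambda$ is the unique $s$ with $P(\Lambda,\psi,\mathcal{G}^s)=0$, where $\mathcal{G}^s=\{g_n^s\}_{n\ge1}$ is the sub-additive potential on $\Lambda$ given by $g_n^s(z)=\log\phi^s((D_z\psi^n)^{-1})$, $z\in\Lambda$. *)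

(* Defs.v *)
From HB Require Import structures.
From mathcomp Require Import all_boot all_order all_algebra.
From mathcomp Require Import all_classical all_reals all_analysis.

Set Implicit Arguments.
Unset Strict Implicit.
Unset Printing Implicit Defensive.

Import Order.TTheory GRing.Theory Num.Theory.
Import numFieldNormedType.Exports.

Local Open Scope classical_set_scope.
Local Open Scope ring_scope.

(* f is of class C^k on the set U; only used for U open and V of finite
   dimension, where directional derivatives give the usual notion. *)
Fixpoint class_C (R : realType) (V W : normedModType R) (k : nat)
    (U : set V) (f : V -> W) : Prop :=
  match k with
  | 0 => forall x, U x -> {for x, continuous f}
  | k'.+1 => (forall x, U x -> differentiable f x) /\
             (forall v : V, class_C k' U (fun x => 'D_v f x))
  end.

(* The maps of a chart are total functions; chart_map is meaningful only on
   chart_dom, and chart_inv only on the image of chart_dom. *)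
Record chart (R : realType) (d : nat) (M : topologicalType) := Chart {
  chart_dom : set M;
  chart_map :> M -> 'rV[R]_d;
  chart_inv : 'rV[R]_d -> M;
  chart_dom_open : open chart_dom;
  chart_cod_open : open (chart_map @` chart_dom);
  chart_mapK : forall z, chart_dom z -> chart_inv (chart_map z) = z;
  chart_map_continuous : forall z, chart_dom z -> {for z, continuous chart_map};
  chart_inv_continuous : forall u, (chart_map @` chart_dom) u ->
    {for u, continuous chart_inv}
}.

(* The preferred chart at z serves to identify the tangent space T_z M with
   row vectors; linear maps T_z M -> T_w M are then d x d matrices acting on
   row vectors from the right. *)
Record smooth_atlas (R : realType) (d : nat) (M : topologicalType) :=
  SmoothAtlas {
  atlas_index : Type;
  atlas_chart :> atlas_index -> chart R d M;
  chart_at : M -> atlas_index;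
  chart_at_dom : forall z, chart_dom (atlas_chart (chart_at z)) z;
  transition_smooth : forall (i j : atlas_index) (k : nat),
    class_C k
      (atlas_chart i @` (chart_dom (atlas_chart i) `&`
                         chart_dom (atlas_chart j)))
      (atlas_chart j \o chart_inv (atlas_chart i))
}.

Definition is_C1_map (R : realType) (d : nat) (M : topologicalType)
    (A : smooth_atlas R d M) (f : M -> M) : Prop :=
  continuous f /\
  forall i j : atlas_index A,
    class_C 1 (A i @` (chart_dom (A i) `&` f @^-1` chart_dom (A j)))
      (A j \o f \o chart_inv (A i)).

(* D_z f : T_z M -> T_(f z) M *)
Definition tangent_map (R : realType) (d : nat) (M : topologicalType)
    (A : smooth_atlas R d M) (f : M -> M) (z : M) : 'M[R]_d :=
  'J (A (chart_at A (f z)) \o f \o chart_inv (A (chart_at A z)))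
    (A (chart_at A z) z).

(* A Riemannian metric is given by its Gram matrices in the charts. *)
Record riemannian_metric (R : realType) (d : nat) (M : topologicalType)
    (A : smooth_atlas R d M) := RiemannianMetric {
  metric_mx :> atlas_index A -> 'rV[R]_d -> 'M[R]_d;
  metric_sym : forall i z, chart_dom (A i) z ->
    (metric_mx i (A i z))^T = metric_mx i (A i z);
  metric_posdef : forall i z, chart_dom (A i) z -> forall v : 'rV[R]_d,
    v != 0 -> 0 < (v *m metric_mx i (A i z) *m v^T) 0 0;
  metric_smooth : forall i k, class_C k (A i @` chart_dom (A i)) (metric_mx i);
  metric_transition : forall i j z,
    chart_dom (A i) z -> chart_dom (A j) z ->
    let J := 'J (A j \o chart_inv (A i)) (A i z) in
    metric_mx i (A i z) = J *m metric_mx j (A j z) *m J^T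
}.

Definition gram_at (R : realType) (d : nat) (M : topologicalType)
    (A : smooth_atlas R d M) (g : riemannian_metric A) (z : M) : 'M[R]_d :=
  g (chart_at A z) (A (chart_at A z) z).

Definition tangent_norm (R : realType) (d : nat) (M : topologicalType)
    (A : smooth_atlas R d M) (g : riemannian_metric A) (z : M)
    (v : 'rV[R]_d) : R :=
  Num.sqrt ((v *m gram_at g z *m v^T) 0 0).

Definition is_C1_curve (R : realType) (d : nat) (M : topologicalType)
    (A : smooth_atlas R d M) (c : R -> M) : Prop :=
  exists O : set R, [/\ open O, `[0, 1] `<=` O,
    (forall t, O t -> {for t, continuous c}) &
    (forall i : atlas_index A,
       class_C 1 (O `&` c @^-1` chart_dom (A i)) (A i \o c))].

Definition velocity (R : realType) (d : nat) (M : topologicalType)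
    (A : smooth_atlas R d M) (c : R -> M) (t : R) : 'rV[R]_d :=
  'D_1 (A (chart_at A (c t)) \o c) t.

Definition curve_length (R : realType) (d : nat) (M : topologicalType)
    (A : smooth_atlas R d M) (g : riemannian_metric A) (c : R -> M) : \bar R :=
  (\int[@lebesgue_measure R]_(t in `[0%R, 1%R])
     (tangent_norm g (c t) (velocity A c t))%:E)%E.

(* Infimum of the lengths of piecewise C^1 curves from x to y, presented as
   chains c 0, ..., c n of C^1 curves, each parametrized by [0, 1]. The value
   is +oo when x and y lie in different components of M. *)
Definition riemannian_dist (R : realType) (d : nat) (M : topologicalType)
    (A : smooth_atlas R d M) (g : riemannian_metric A) (x y : M) : \bar R :=
  ereal_inf [set L | exists (n : nat) (c : nat -> R -> M),
    [/\ forall i, (i <= n)%N -> is_C1_curve A (c i),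
        c 0%N 0 = x, c n 1 = y,
        forall i, (i < n)%N -> c i 1 = c i.+1 0 &
        L = (\sum_(i < n.+1) curve_length g (c i))%E]].

Definition is_repeller (R : realType) (d : nat) (M : topologicalType)
    (A : smooth_atlas R d M) (psi : M -> M) (Lam : set M) : Prop :=
  [/\ compact Lam, Lam !=set0, psi @` Lam = Lam,
      (exists (h : riemannian_metric A) (lam : R), 1 < lam /\
         forall z (v : 'rV[R]_d), Lam z ->
           lam * tangent_norm h z v
             <= tangent_norm h (psi z) (v *m tangent_map A psi z)) &
      (exists V : set M, [/\ open V, Lam `<=` V &
         Lam = [set z | V z /\ forall n : nat, V (iter n psi z)]])].

(* Adjoint of v |-> v *m T from (R^d, G) to (R^d, H), where G and H are Gram
   matrices: (v *m T) *m H *m w^T = v *m G *m (w *m adjoint_mx G H T)^T. *)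
Definition adjoint_mx (R : realType) (d : nat) (G H T : 'M[R]_d) : 'M[R]_d :=
  H *m T^T *m invmx G.

(* Square roots of the eigenvalues, counted with multiplicity, of T^* T. *)
Definition is_singular_values (R : realType) (d : nat) (G H T : 'M[R]_d)
    (a : seq R) : Prop :=
  [/\ size a = d, sorted >=%R a, all (>= 0) a &
      char_poly (T *m adjoint_mx G H T) = \prod_(x <- a) ('X - (x ^+ 2)%:P)].

Definition singular_values (R : realType) (d : nat) (G H T : 'M[R]_d) : seq R :=
  xget [::] [set a | is_singular_values G H T a].

(* For s = d the last factor of the first branch is a`_d `^ 0 = 1. *)
Definition singular_value_function (R : realType) (d : nat) (G H : 'M[R]_d)
    (s : R) (T : 'M[R]_d) : R :=
  let a := singular_values G H T in
  let k := Num.truncn s in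
  if s <= d%:R then (\prod_(i < k) a`_i) * a`_k `^ (s - k%:R)
  else (\prod_(i < d) a`_i) `^ (s / d%:R).

Section Pressure.
Context (R : realType) (X : topologicalType).
Implicit Types (dist : X -> X -> \bar R) (f : X -> X) (g : nat -> X -> R).
Local Open Scope ereal_scope.

Definition bowen_dist dist f (n : nat) (x y : X) : \bar R :=
  \big[maxe/0]_(i < n) dist (iter i f x) (iter i f y).

Definition separated dist f (n : nat) (eps : R) (E : set X) : Prop :=
  forall x y, E x -> E y -> x <> y -> eps%:E < bowen_dist dist f n x y.

Definition pressure_sum (K : set X) dist f g (eps : R) (n : nat) : \bar R :=
  ereal_sup [set \esum_(x in E) (expR (g n x))%:E |
    E in [set E | E `<=` K /\ separated dist f n eps E]].

(* Pressure of the restriction of f to the invariant set K. *)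
Definition pressure (K : set X) dist f g : \bar R :=
  lim (limn_esup (fun n : nat =>
         (n%:R^-1)%:E * lne (pressure_sum K dist f g eps n))
       @[eps --> (0%R : R)^'+]).

End Pressure.

Section BoxDimension.
Context (R : realType) (X : topologicalType).
Implicit Types (dist : X -> X -> \bar R) (K : set X).
Local Open Scope ereal_scope.

(* Smallest number of sets of diameter at most delta that cover K. *)
Definition covering_number dist K (delta : R) : \bar R :=
  ereal_inf [set (n%:R)%:E | n in [set n : nat | exists U : 'I_n -> set X,
    K `<=` \bigcup_i U i /\
    forall i x y, U i x -> U i y -> dist x y <= delta%:E]].

Definition upper_box_dim dist K : \bar R :=
  limf_esup (fun delta : R =>
      lne (covering_number dist K delta) * ((- ln delta)^-1)%:E)
    ((0%R : R)^'+).

End BoxDimension.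

(* The inverse of D_z psi^n maps T_(psi^n z) M to T_z M. *)
Definition singular_potential (R : realType) (d : nat) (M : topologicalType)
    (A : smooth_atlas R d M) (g : riemannian_metric A) (psi : M -> M) (s : R)
    (n : nat) (z : M) : R :=
  ln (singular_value_function (gram_at g (iter n psi z)) (gram_at g z) s
        (invmx (tangent_map A (iter n psi) z))).

(* For d = 0 every s >= 0 is a zero of the pressure; xget then returns 0. *)
Definition singularity_dim (R : realType) (d : nat) (M : topologicalType)
    (A : smooth_atlas R d M) (g : riemannian_metric A) (psi : M -> M)
    (Lam : set M) : R :=
  xget 0 [set s : R | unique (fun t : R => 0 <= t /\
    pressure Lam (riemannian_dist g) psi (singular_potential g psi t) = 0%E) s].

(* Main.v *)
Require Import Defs.
From mathcomp Require Import all_boot all_order all_algebra.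
From mathcomp Require Import perm.
From mathcomp Require Import all_classical all_reals all_analysis.
From mathcomp Require Import ring lra.

Set Implicit Arguments.
Unset Strict Implicit.
Unset Printing Implicit Defensive.

Import Order.TTheory GRing.Theory Num.Theory.
Import numFieldNormedType.Exports.

Local Open Scope classical_set_scope.
Local Open Scope ring_scope.

(* Let s be such that the pressure P(s) of the potential g^s is negative, and fix
   a large m. Near a point z of Lam the map psi^m is close to its derivative, so a
   set whose image under psi^m has diameter r lies in an ellipsoid with semi-axes
   r a_j, where the a_j are the singular values of the inverse of D_z psi^m. With
   k = min([s], d - 1), the ellipsoid is covered by about
   nu(z) = prod_(j < k) a_j / a_k sets of diameter r a_k, and nu(z) a_k^s <= phi^s. Group the points z by the values of
   (log a_k, log nu) up to an error eta m, which makes a number of classes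
   independent of m, and take a maximal (m, eps)-separated set E of a finite net
   within each class. Expansion makes psi^m injective on each cell of points that
   are (m, eps)-close to a point of E, so the numbers N(delta) of sets of diameter
   delta needed to cover Lam satisfy
     N(delta) <= sum_(x in E) n_x N(delta / b_x)  with  sum_(x in E) n_x b_x^s <= 1,
   because the last sum is at most e^(O(eta m)) times the pressure sum of order m,
   which decays like e^(m P(s)). Induction on the scale then gives
   N(delta) <= K delta^(-s). *)

(** * Gram norms and singular values *)

(** Since [psi] is only C^1, no distortion bound uniform in m compares the derivatives of psi^m at
    two points whose orbits stay close for m steps; the classes replace such a bound. The logarithms
    that they discretize are themselves of order m, so intervals of length eta m are needed in a
    number that depends on eta only. This number and all other constants are then beaten by the
    exponential decay in m. The neighbourhoods on which psi^m resembles its derivative are chosen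
    after m is fixed, so their size may depend on m.

    Nothing relates the preferred charts of nearby points, so entries of derivative matrices cannot
    be compared between points. Local uniformity is instead expressed by tangent norms or by
    Lipschitz constants for the Riemannian distance, which agrees with the norm of a fixed chart up
    to a factor 2 near its centre.

    That exponents above the singularity dimension have negative pressure comes from writing log
    phi^s as a combination of the log a_j with nonnegative coefficients of sum s, monotone in s: the
    pressure then decreases in s at a rate between two positive constants. *)

Section Bilinear.
Context {R : realType}.
Implicit Types n : nat.

Definition bil n (G : 'M[R]_n) (u v : 'rV[R]_n) : R := (u *m G *m v^T) 0 0.

Definition posdef n (G : 'M[R]_n) :=
  G^T = G /\ forall v : 'rV[R]_n, v != 0 -> 0 < bil G v v.

Definition nrm n (G : 'M[R]_n) (v : 'rV[R]_n) : R := Num.sqrt (bil G v v).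

Lemma bilDl n (G : 'M[R]_n) u v w : bil G (u + v) w = bil G u w + bil G v w.
Proof. by rewrite /bil !mulmxDl mxE. Qed.

Lemma bilDr n (G : 'M[R]_n) u v w : bil G w (u + v) = bil G w u + bil G w v.
Proof. by rewrite /bil linearD /= mulmxDr mxE. Qed.

Lemma bilZl n (G : 'M[R]_n) a u v : bil G (a *: u) v = a * bil G u v.
Proof. by rewrite /bil -!scalemxAl mxE. Qed.

Lemma bilZr n (G : 'M[R]_n) a u v : bil G u (a *: v) = a * bil G u v.
Proof. by rewrite /bil linearZ /= -scalemxAr mxE. Qed.

Lemma bil0l n (G : 'M[R]_n) v : bil G 0 v = 0.
Proof. by rewrite /bil !mul0mx mxE. Qed.

Lemma bilNl n (G : 'M[R]_n) u v : bil G (- u) v = - bil G u v.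
Proof. by rewrite -scaleN1r bilZl mulN1r. Qed.

Lemma bilNr n (G : 'M[R]_n) u v : bil G u (- v) = - bil G u v.
Proof. by rewrite -scaleN1r bilZr mulN1r. Qed.

Lemma bil_suml n (G : 'M[R]_n) (I : finType) (F : I -> 'rV[R]_n) v :
  bil G (\sum_i F i) v = \sum_i bil G (F i) v.
Proof. by rewrite /bil !mulmx_suml summxE. Qed.

Lemma bilC n (G : 'M[R]_n) u v : G^T = G -> bil G u v = bil G v u.
Proof.
move=> Gs; rewrite /bil.
have -> : v *m G *m u^T = (u *m G *m v^T)^T by rewrite !trmx_mul trmxK Gs mulmxA.
by rewrite [RHS]mxE.
Qed.

Lemma bil_mulmx n m (G : 'M[R]_n) (T : 'M[R]_(m, n)) u v :
  bil G (u *m T) (v *m T) = bil (T *m G *m T^T) u v.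
Proof. by rewrite /bil trmx_mul !mulmxA. Qed.

Lemma bilE n (G : 'M[R]_n) u v :
  bil G u v = \sum_j (\sum_i u 0 i * G i j) * v 0 j.
Proof. by rewrite /bil mxE; apply: eq_bigr => j _; rewrite !mxE. Qed.

Lemma nrm_ge0 n (G : 'M[R]_n) v : 0 <= nrm G v.
Proof. exact: sqrtr_ge0. Qed.

Lemma bil_ge0 n (G : 'M[R]_n) v : posdef G -> 0 <= bil G v v.
Proof.
move=> [_ Gp]; have [->|v0] := eqVneq v 0; first by rewrite bil0l.
exact: ltW (Gp _ v0).
Qed.

Lemma nrm_sqr n (G : 'M[R]_n) v : posdef G -> nrm G v ^+ 2 = bil G v v.
Proof. by move=> Gp; rewrite sqr_sqrtr// bil_ge0. Qed.

Lemma nrm0 n (G : 'M[R]_n) : nrm G 0 = 0.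
Proof. by rewrite /nrm bil0l sqrtr0. Qed.

Lemma nrm_gt0 n (G : 'M[R]_n) v : posdef G -> v != 0 -> 0 < nrm G v.
Proof. by move=> [_ Gp] v0; rewrite sqrtr_gt0 Gp. Qed.

Lemma nrmZ n (G : 'M[R]_n) a v : nrm G (a *: v) = `|a| * nrm G v.
Proof.
by rewrite /nrm bilZl bilZr mulrA -expr2 sqrtrM ?sqr_ge0// sqrtr_sqr.
Qed.

Lemma nrmN n (G : 'M[R]_n) v : nrm G (- v) = nrm G v.
Proof. by rewrite /nrm bilNl bilNr opprK. Qed.

Lemma nrm_distC n (G : 'M[R]_n) u v : nrm G (u - v) = nrm G (v - u).
Proof. by rewrite -nrmN opprB. Qed.

Lemma nrm_mulmx n m (G : 'M[R]_n) (T : 'M[R]_(m, n)) v :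
  nrm G (v *m T) = nrm (T *m G *m T^T) v.
Proof. by rewrite /nrm bil_mulmx. Qed.

(** Positivity of the form at [nrm G v *: u - nrm G u *: v] reads 0 <= 2ab(ab - c), with a, b the
    two norms and c the value [bil G u v]. Cancelling 2ab requires both vectors to be nonzero. *)
Lemma bil_CS n (G : 'M[R]_n) u v : posdef G -> bil G u v <= nrm G u * nrm G v.
Proof.
move=> Gp; have [->|v0] := eqVneq v 0.
  by rewrite nrm0 mulr0 bilC ?bil0l//; case: Gp.
have q0 := nrm_gt0 Gp v0.
have := bil_ge0 (nrm G v *: u - nrm G u *: v) Gp.
rewrite bilDl !bilDr !(bilNl, bilNr) !(bilZl, bilZr) -!nrm_sqr //.
rewrite (bilC v u) ?(proj1 Gp)// => h.
have [->|u0] := eqVneq u 0; first by rewrite nrm0 mul0r bil0l.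
have p0 := nrm_gt0 Gp u0.
set a := nrm G u in h p0 *; set b := nrm G v in h q0 *; set c := bil G u v in h *.
have : 0 <= 2 * (a * b) * (a * b - c).
  by apply: le_trans h _; rewrite le_eqVlt; apply/orP; left; apply/eqP; ring.
by rewrite pmulr_rge0 ?subr_ge0// !mulr_gt0.
Qed.

Lemma nrmD n (G : 'M[R]_n) u v : posdef G -> nrm G (u + v) <= nrm G u + nrm G v.
Proof.
move=> Gp; rewrite -(@ler_pXn2r _ 2)// ?nnegrE ?addr_ge0 ?nrm_ge0//.
rewrite nrm_sqr// bilDl !bilDr (bilC v u) ?(proj1 Gp)// -!nrm_sqr//.
have := bil_CS u v Gp; rewrite sqrrD; lra.
Qed.

Lemma nrm_sum n (G : 'M[R]_n) (I : finType) (F : I -> 'rV[R]_n) : posdef G ->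
  nrm G (\sum_i F i) <= \sum_i nrm G (F i).
Proof.
move=> Gp; elim/big_ind2 : _ => [|x x' y y' h1 h2|//]; first by rewrite nrm0.
by apply: le_trans (nrmD _ _ Gp) _; exact: lerD.
Qed.

Lemma posdef_mulmx n m (G : 'M[R]_n) (B : 'M[R]_(m, n)) :
  posdef G -> row_free B -> posdef (B *m G *m B^T).
Proof.
move=> [Gs Gp] Bf; split; first by rewrite !trmx_mul trmxK Gs mulmxA.
move=> v v0; rewrite -bil_mulmx; apply: Gp; apply: contraNneq v0 => vB.
by have /row_free_inj := Bf; move=> /(_ _ v 0); rewrite mul0mx vB => ->.
Qed.

End Bilinear.

Section NormEquiv.
Context {R : realType}.

Lemma coord_le_norm m n (A : 'M[R]_(m, n)) i j : `|A i j| <= `|A|.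
Proof.
by rewrite [`|A|]mx_normrE; apply: (le_bigmax _ _ (i, j)).
Qed.

Lemma mx_norm_le m n (A : 'M[R]_(m, n)) r :
  0 <= r -> (forall i j, `|A i j| <= r) -> `|A| <= r.
Proof.
by move=> r0 h; rewrite [`|A|]mx_normrE; apply/bigmax_leP; split => // -[].
Qed.

Lemma sum_le_const n (F : 'I_n -> R) c : (forall i, F i <= c) ->
  \sum_i F i <= n%:R * c.
Proof.
move=> Fc; rewrite mulr_natl -[in leRHS](card_ord n) -sumr_const.
exact: ler_sum.
Qed.

Lemma bil_continuous n (G : 'M[R]_n) : continuous (fun v : 'rV[R]_n => bil G v v).
Proof.
rewrite (_ : (fun _ => _) = (fun v : 'rV[R]_n =>
    \sum_j (\sum_i v 0 i * G i j) * v 0 j)); last first.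
  by apply/funext => w; rewrite bilE.
have cc i : continuous (fun v : 'rV[R]_n => v 0 i) by exact: coord_continuous.
have cin j : continuous (fun v : 'rV[R]_n => \sum_i v 0 i * G i j).
  apply: continuous_big => [|i _]; first exact: add_continuous.
  by move=> x; apply: continuousM; [exact: cc|exact: cst_continuous].
apply: continuous_big => [|j _]; first exact: add_continuous.
by move=> w; apply: continuousM; [exact: cin|exact: cc].
Qed.

Lemma bil_le_norm n (G : 'M[R]_n) u v :
  `|bil G u v| <= n%:R ^+ 2 * `|G| * (`|u| * `|v|).
Proof.
rewrite bilE; apply: le_trans (ler_norm_sum _ _ _) _.
rewrite expr2 -!mulrA; apply: sum_le_const => j.
rewrite normrM !mulrA; apply: ler_pM => //; last exact: coord_le_norm.
apply: le_trans (ler_norm_sum _ _ _) _; rewrite -mulrA; apply: sum_le_const => i.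
by rewrite normrM mulrC; apply: ler_pM => //; exact: coord_le_norm.
Qed.

Lemma nrm_le_norm n (G : 'M[R]_n) : exists2 C, 0 < C & forall v, nrm G v <= C * `|v|.
Proof.
exists (Num.sqrt (n%:R ^+ 2 * `|G|) + 1) => [|v].
  by rewrite ltr_wpDl ?sqrtr_ge0.
apply: (@le_trans _ _ (Num.sqrt (n%:R ^+ 2 * `|G|) * `|v|)); last first.
  by rewrite ler_wpM2r// lerDl.
rewrite -[X in _ * X](@ger0_norm _ `|v|)// -sqrtr_sqr -sqrtrM ?mulr_ge0 ?sqr_ge0//.
rewrite ler_wsqrtr// expr2.
by apply: le_trans (bil_le_norm G v v); exact: ler_norm.
Qed.

Lemma norm_sphere_compact n : compact [set v : 'rV[R]_n | `|v| = 1].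
Proof.
apply: bounded_closed_compact; first by exists 1; split => // x x1 v /= ->; exact: ltW.
apply: (@preimage_closed _ _ (fun v : 'rV[R]_n => `|v|) [set 1]) => //.
  by move=> v _; exact: norm_continuous.
Qed.

(** The constant is the minimum of the form on the unit sphere of the sup norm, which is compact.
    The sphere is empty for n = 0, whence the case distinction. *)
Lemma norm_le_bil n (G : 'M[R]_n) : posdef G ->
  exists2 c, 0 < c & forall v, c * `|v| ^+ 2 <= bil G v v.
Proof.
move=> Gp; have [[u u1]|nu] := pselect ([set v : 'rV[R]_n | `|v| = 1] !=set0).
- have [w w1 wmin] : exists2 w, w \in [set v : 'rV[R]_n | `|v| = 1] &
      forall t, t \in [set v : 'rV[R]_n | `|v| = 1] -> bil G w w <= bil G t t.
    apply: compact_EVT_min; [by exists u|exact: norm_sphere_compact|].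
    by apply: continuous_subspaceT; exact: bil_continuous.
  exists (bil G w w).
    apply: (proj2 Gp); rewrite -normr_eq0.
    by move: w1; rewrite inE /= => ->; rewrite oner_eq0.
  move=> v; have [->|v0] := eqVneq v 0; first by rewrite normr0 expr0n mulr0 bil0l.
  have nv0 : 0 < `|v| by rewrite normr_gt0.
  have := wmin (`|v|^-1 *: v); rewrite inE /= normrZ normfV normr_id mulVf ?gt_eqF//.
  move=> /(_ erefl); rewrite bilZl bilZr mulrA -expr2 exprVn.
  by rewrite ler_pdivlMl ?exprn_gt0// mulrC.
- exists 1 => // v; have [->|v0] := eqVneq v 0.
    by rewrite normr0 expr0n mulr0 bil0l.
  case: nu; exists (`|v|^-1 *: v) => /=.
  by rewrite normrZ normfV normr_id mulVf// normr_eq0.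
Qed.

Lemma norm_le_nrm n (G : 'M[R]_n) : posdef G ->
  exists2 C, 0 < C & forall v, `|v| <= C * nrm G v.
Proof.
move=> Gp; have [c c0 h] := norm_le_bil Gp.
have s0 : 0 < Num.sqrt c by rewrite sqrtr_gt0.
exists (Num.sqrt c)^-1; first by rewrite invr_gt0.
move=> v; rewrite ler_pdivlMl//.
rewrite -[X in _ * X]ger0_norm// -sqrtr_sqr -sqrtrM ?(ltW c0)//.
by rewrite ler_wsqrtr.
Qed.

(** The radius [e] keeps the form of [H - G] below half of the lower bound c |v|^2 for the form of
    [G]. The two forms then agree up to a factor 2, within the 4 that the norms allow. *)
Lemma nrm_near n (G : 'M[R]_n) : posdef G -> exists2 e, 0 < e &
  forall H : 'M[R]_n, `|H - G| < e ->
  forall v, nrm H v <= 2 * nrm G v /\ nrm G v <= 2 * nrm H v.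
Proof.
move=> Gp; have [c c0 hc] := norm_le_bil Gp.
pose e := c / (2 * (n%:R ^+ 2 + 1)).
have n0 : 0 < n%:R ^+ 2 + 1 :> R by rewrite ltr_wpDl// sqr_ge0.
exists e => [|H He v]; first by rewrite divr_gt0// mulr_gt0.
have Hv : `|bil H v v - bil G v v| <= c / 2 * `|v| ^+ 2.
  have -> : bil H v v - bil G v v = bil (H - G) v v.
    by rewrite /bil mulmxBr mulmxBl !mxE.
  apply: le_trans (bil_le_norm _ _ _) _; rewrite -expr2 ler_wpM2r ?sqr_ge0//.
  apply: (@le_trans _ _ ((n%:R ^+ 2 + 1) * e)).
    by apply: ler_pM; rewrite ?sqr_ge0 ?lerDl// ltW.
  by rewrite le_eqVlt; apply/orP; left; apply/eqP; rewrite /e; field; rewrite gt_eqF.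
have Gv := hc v; move: Hv; rewrite ler_norml => /andP[h1 h2].
have g0 := bil_ge0 v Gp.
have sq (a b : R) : a <= 4 * b -> Num.sqrt a <= 2 * Num.sqrt b.
  move=> ab; apply: le_trans (ler_wsqrtr ab) _.
  rewrite sqrtrM// (_ : 4 = 2 ^+ 2 :> R) ?sqrtr_sqr ?ger0_norm//.
  by rewrite expr2; lra.
by split; apply: sq; lra.
Qed.

End NormEquiv.

(** * Simultaneous diagonalization and singular values *)

Section SimultaneousDiagonalization.
Context {R : realType}.

(** Cauchy-Schwarz for a semidefinite form: its value at (q + 1) v - b w, with b = Q(v, w) and q =
    Q(w, w), is -b^2 (q + 2), which forces b = 0. *)
Lemma psd_null n (Q : 'M[R]_n) v : Q^T = Q -> (forall w, 0 <= bil Q w w) ->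
  bil Q v v = 0 -> v *m Q = 0.
Proof.
move=> Qs Q0 vv; have b0 w : bil Q v w = 0.
  set b := bil Q v w; have q0 := Q0 w; set q := bil Q w w in q0.
  have q1 : 0 < q + 1 by rewrite ltr_wpDl.
  have := Q0 ((q + 1) *: v - b *: w).
  rewrite bilDl !bilDr !(bilNl, bilNr) !(bilZl, bilZr) vv (bilC w v)// -/b -/q.
  rewrite !mulr0 add0r => h.
  have {}h : b ^+ 2 * (q + 2) <= 0.
    by rewrite -oppr_ge0; apply: le_trans h _; rewrite le_eqVlt; apply/orP; left;
      apply/eqP; ring.
  apply/eqP; rewrite -sqrf_eq0 eq_le sqr_ge0 andbT.
  by move: h; rewrite pmulr_lle0// ltr_wpDl.
apply/rowP => j; have := b0 (delta_mx 0 j).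
by rewrite /bil trmx_delta -colE !mxE.
Qed.

(** Let [v] maximize the form of [S] on the unit sphere of [G] and [mu] be the maximum. Then
    [mu *: G - S] is semidefinite and vanishes at [v], so [v] lies in its kernel. *)
Lemma pencil_eigenvector n (G S : 'M[R]_n.+1) : posdef G -> S^T = S ->
  exists v mu, bil G v v = 1 /\ v *m S = mu *: (v *m G).
Proof.
move=> Gp Ss; pose K := [set v : 'rV[R]_n.+1 | bil G v v = 1].
have norml v : v != 0 -> bil G ((nrm G v)^-1 *: v) ((nrm G v)^-1 *: v) = 1.
  move=> v0; rewrite bilZl bilZr -nrm_sqr// expr2 mulKf ?mulVf// gt_eqF//;
  exact: nrm_gt0.
have Kn : K !=set0.
  exists ((nrm G (const_mx 1))^-1 *: const_mx 1); apply: norml.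
  by apply/eqP => /rowP/(_ 0)/eqP; rewrite !mxE oner_eq0.
have Kc : compact K.
  apply: bounded_closed_compact.
    have [C C0 hC] := norm_le_nrm Gp.
    exists C; split => [|x Cx v Kv /=]; first exact: num_real.
    apply: le_trans (hC v) _; rewrite /nrm Kv sqrtr1 mulr1; exact: ltW.
  apply: (@preimage_closed _ _ (fun v : 'rV[R]_n.+1 => bil G v v) [set 1]) => //.
  by move=> v _; exact: bil_continuous.
have [v vK vmax] : exists2 v, v \in K & forall t, t \in K -> bil S t t <= bil S v v.
  apply: compact_EVT_max => //.
  by apply: continuous_subspaceT; exact: bil_continuous.
move: vK; rewrite inE /K /= => v1.
exists v, (bil S v v); split => //.
pose Q := bil S v v *: G - S.
have QE w : bil Q w w = bil S v v * bil G w w - bil S w w.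
  by rewrite /Q /bil mulmxBr mulmxBl -scalemxAr -scalemxAl !mxE.
have : v *m Q = 0.
  apply: psd_null => [|w|]; last by rewrite QE v1 mulr1 subrr.
    by rewrite /Q linearB /= linearZ /= Ss (proj1 Gp).
  rewrite QE; have [->|w0] := eqVneq w 0; first by rewrite !bil0l mulr0 subrr.
  have nw := nrm_gt0 Gp w0.
  have := vmax ((nrm G w)^-1 *: w); rewrite inE => /(_ (norml _ w0)).
  rewrite bilZl bilZr mulrA -expr2 exprVn ler_pdivrMl ?exprn_gt0// nrm_sqr//.
  by rewrite subr_ge0 mulrC.
by rewrite mulmxBr -scalemxAr => /eqP; rewrite subr_eq0 => /eqP ->.
Qed.

Lemma hyperplane_basis n (u : 'cV[R]_n.+1) : u != 0 ->
  exists2 B : 'M[R]_(n, n.+1), row_free B & B *m u = 0.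
Proof.
move=> u0; have ru : \rank u = 1%N.
  by apply/eqP; rewrite eqn_leq rank_leq_col lt0n mxrank_eq0.
have rk : \rank (kermx u) = n by rewrite mxrank_ker ru subn1.
have : exists2 B : 'M[R]_(\rank (kermx u), n.+1), row_free B & B *m u = 0.
  exists (row_base (kermx u)); first exact: row_base_free.
  by apply/eqP; rewrite -sub_kermx eq_row_base.
by rewrite rk.
Qed.

(** Induction on the dimension: an eigenvector [v] of the pencil is split off, and both forms are
    restricted to the hyperplane orthogonal to [v] for [G]. This hyperplane is also orthogonal to
    [v] for [S], because v S is a multiple of v G. *)
Lemma simultaneous_diag n (G S : 'M[R]_n) : posdef G -> S^T = S ->
  exists (P : 'M[R]_n) (D : 'rV[R]_n),
    P *m G *m P^T = 1%:M /\ P *m S *m P^T = diag_mx D.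
Proof.
elim: n G S => [|n IH] G S Gp Ss.
  by exists 0, 0; split; apply/matrixP => -[].
have [v [mu [v1 vS]]] := pencil_eigenvector Gp Ss.
have v0 : v != 0.
  by apply: contra_eq_neq v1 => ->; rewrite bil0l eq_sym oner_eq0.
have [|B Bf Bu] := @hyperplane_basis n (v *m G)^T.
  apply: contra_eq_neq v1 => /(congr1 trmx); rewrite trmxK trmx0 /bil => ->.
  by rewrite mul0mx mxE eq_sym oner_eq0.
have [|P [D [PG PS]]] := IH (B *m G *m B^T) (B *m S *m B^T) (posdef_mulmx Gp Bf).
  by rewrite !trmx_mul trmxK Ss mulmxA.
have vGB : v *m G *m B^T = 0.
  by apply: (@trmx_inj R); rewrite trmx_mul trmxK Bu trmx0.
have BGv : B *m G *m v^T = 0.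
  by rewrite -[RHS]Bu trmx_mul (proj1 Gp) mulmxA.
have SvB : B *m S *m v^T = 0.
  apply: (@trmx_inj R); rewrite !trmx_mul trmxK Ss mulmxA vS -scalemxAl.
  by rewrite vGB scaler0 trmx0.
pose V := col_mx v (P *m B).
have key (Q : 'M[R]_n.+1) : V *m Q *m V^T =
    block_mx (v *m Q *m v^T) (v *m Q *m B^T *m P^T)
      (P *m (B *m Q *m v^T)) (P *m (B *m Q *m B^T) *m P^T).
  by rewrite /V mul_col_mx tr_col_mx mul_col_row trmx_mul !mulmxA.
have vv : v *m G *m v^T = 1%:M by rewrite [LHS]mx11_scalar -/(bil G v v) v1.
exists V, (row_mx (const_mx mu : 'rV_1) D); split; (etransitivity; first exact: key).
  rewrite vGB BGv PG mul0mx mulmx0 vv; exact: esym (scalar_mx_block 1 n 1).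
rewrite SvB PS mulmx0 vS -!scalemxAl vGB mul0mx scaler0 vv.
apply: (@etrans _ _ (block_mx (diag_mx (const_mx mu : 'rV_1)) 0 0 (diag_mx D))).
  by congr block_mx; apply/matrixP => i j; rewrite !ord1 !mxE eqxx mulr1.
exact: esym (diag_mx_row (const_mx mu : 'rV_1) D).
Qed.

Lemma char_poly_similar n (A P Q : 'M[R]_n) : P *m Q = 1%:M ->
  char_poly (P *m A *m Q) = char_poly A.
Proof.
move=> PQ; rewrite /char_poly.
have -> : char_poly_mx (P *m A *m Q) =
    map_mx polyC P *m char_poly_mx A *m map_mx polyC Q.
  rewrite /char_poly_mx mulmxBr mulmxBl !map_mxM/=; congr (_ - _).
  by rewrite scalar_mxC -mulmxA -map_mxM /= PQ map_mx1 mulmx1.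
by rewrite !det_mulmx mulrAC -det_mulmx -map_mxM PQ map_mx1 det1 mul1r.
Qed.

(** Turns the definition through a characteristic polynomial into geometry: an orthonormal basis
    whose images have the singular values as lengths. Diagonalizing [G] and [T *m H *m T^T] together
    by [P] conjugates T T^* to a diagonal matrix, so singular values exist and [xget] returns
    them. *)
Lemma singular_valuesP n (G H T : 'M[R]_n) (a := singular_values G H T) :
  posdef G -> posdef H ->
  [/\ size a = n, sorted >=%R a, all (>= 0) a &
    exists e : 'I_n -> 'rV[R]_n,
      [/\ forall i j, bil G (e i) (e j) = (i == j)%:R,
          forall i, nrm H (e i *m T) = a`_i &
          forall v, v = \sum_i bil G v (e i) *: e i]].
Proof.
move=> Gp Hp; pose S := T *m H *m T^T.
have [|P [D [PG PS]]] := simultaneous_diag (S := S) Gp.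
  by rewrite /S !trmx_mul trmxK (proj1 Hp) mulmxA.
have rE (Q : 'M[R]_n) i j : (P *m Q *m P^T) i j = bil Q (row i P) (row j P).
  by rewrite /bil -row_mul !mxE; apply: eq_bigr => k _; rewrite !mxE.
have DE i : D 0 i = bil H (row i P *m T) (row i P *m T).
  by rewrite bil_mulmx -rE PS mxE eqxx.
have D0 i : 0 <= D 0 i by rewrite DE bil_ge0.
pose t := [tuple Num.sqrt (D 0 i) | i < n].
have Gu : P *m (G *m P^T) = 1%:M by rewrite mulmxA.
have Pu : P \in unitmx by have [] := mulmx1_unit Gu.
have Gunit : G \in unitmx.
  have [_] := mulmx1_unit Gu; rewrite unitmx_mul unitmx_tr => /andP[]//.
have chE : char_poly (T *m adjoint_mx G H T) = \prod_(i < n) ('X - (D 0 i)%:P).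
  rewrite /adjoint_mx !mulmxA -/S -(char_poly_similar _ Gu).
  have -> : P *m (S *m invmx G) *m (G *m P^T) = P *m S *m P^T.
    by rewrite !mulmxA mulmxKV.
  rewrite PS char_poly_trig ?diag_mx_is_trig//.
  by apply: eq_bigr => i _; rewrite mxE eqxx.
have tE : \prod_(x <- t) ('X - (x ^+ 2)%:P) = \prod_(i < n) ('X - (D 0 i)%:P).
  by rewrite big_map big_enum /=; apply: eq_bigr => i _; rewrite sqr_sqrtr.
have [sa oa pa ca] : is_singular_values G H T a.
  apply: (@xgetPex _ [::] [set a | is_singular_values G H T a]).
  exists (sort >=%R t); split.
  - by rewrite size_sort size_tuple.
  - by apply: sort_sorted => x y; exact: (le_total y x).
  - rewrite all_sort; apply/allP => x /mapP[i _ ->]; exact: sqrtr_ge0.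
  - by rewrite chE -tE; apply: perm_big; rewrite perm_sym perm_sort.
split => //.
(* The polynomial determines the squares up to order, and nonnegativity recovers the values. The
   permutation [p] obtained from this puts the rows of [P] in decreasing order. *)
have pt : perm_eq a t.
  have pe : perm_eq [seq x ^+ 2 | x <- a] [seq x ^+ 2 | x <- t].
    by apply: prod_XsubC_eq; rewrite [LHS]big_map -ca chE -tE [RHS]big_map.
  have := perm_map Num.sqrt pe.
  have id_sq (s : seq R) : all (>= 0) s -> map Num.sqrt [seq x ^+ 2 | x <- s] = s.
    move=> /allP s0; rewrite -map_comp -[RHS]map_id; apply/eq_in_map => x /s0 x0 /=.
    by rewrite sqrtr_sqr ger0_norm.
  rewrite !id_sq //; apply/allP => x /mapP[i _ ->]; exact: sqrtr_ge0.
have sa' : size a == n by rewrite sa.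
have /tuple_permP[p pE] : perm_eq (Tuple sa') t by [].
exists (fun i => row (p i) P); split.
- by move=> i j; rewrite -rE PG mxE (inj_eq perm_inj).
- move=> i; have -> : a`_i = tnth (Tuple sa') i by rewrite (tnth_nth 0).
  move: pE => /= pE; rewrite (tnth_nth 0) /= pE (nth_map i) ?size_enum_ord//.
  by rewrite nth_ord_enum !tnth_map tnth_ord_tuple DE.
- move=> v; have [x vE] : exists x : 'rV[R]_n, v = \sum_i x 0 i *: row i P.
    by exists (v *m invmx P); rewrite -mulmx_sum_row mulmxKV.
  have xE i : bil G v (row i P) = x 0 i.
    rewrite {1}vE bil_suml (bigD1 i)//= big1 ?addr0 => [|j ji].
      by rewrite bilZl -rE PG mxE eqxx mulr1.
    by rewrite bilZl -rE PG mxE (negPf ji) mulr0.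
  rewrite {1}vE (reindex_inj (@perm_inj _ p)) /=.
  by apply: eq_bigr => i _; rewrite xE.
Qed.

End SimultaneousDiagonalization.

(** * Curves in charts *)

Lemma line_is_diff (R : realType) d (u w : 'rV[R]_d) (t : R) :
  is_diff t (fun s => u + s *: w) (fun s => s *: w).
Proof.
have h1 : is_diff t (fun s : R => s *: w) (fun s => s *: w).
  apply: DiffDef; first exact: differentiableZl.
  by rewrite diffZl//; apply/funext => s /=; rewrite diff_val.
have h2 : is_diff t (fun s : R => u) (fun s => 0) by exact: is_diff_cst.
have [h3 h4] := @is_diffD _ _ _ _ _ _ _ _ h2 h1.
apply: DiffDef; first exact: h3.
rewrite [LHS]h4; apply/funext => s.
by rewrite /GRing.add /= add0r.
Qed.

Section RealAnalysis.
Context {R : realType}.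

Lemma nrm_continuous (T : topologicalType) d (G : T -> 'M[R]_d) (w : T -> 'rV[R]_d) t :
  {for t, continuous G} -> {for t, continuous w} ->
  {for t, continuous (fun s => nrm (G s) (w s))}.
Proof.
move=> cG cw; apply: (@continuous_comp _ _ _ (fun s => bil (G s) (w s) (w s)) Num.sqrt);
  last exact: sqrt_continuous.
have cwi i : {for t, continuous (fun s => w s 0 i)}.
  by apply: (@continuous_comp _ _ _ w (fun v : 'rV[R]_d => v 0 i)) => //; exact: coord_continuous.
have cGi i j : {for t, continuous (fun s => G s i j)}.
  by apply: (@continuous_comp _ _ _ G (fun v : 'M[R]_d => v i j)) => //; exact: coord_continuous.
rewrite /prop_for /continuous_at bilE (_ : (fun s => bil _ _ _) = fun s =>
    \sum_j (\sum_i w s 0 i * G s i j) * w s 0 j); last first.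
  by apply/funext => s; rewrite bilE.
apply: cvg_big => [|j _]; first exact: add_continuous.
apply: cvgM; last exact: cwi.
apply: cvg_big => [|i _]; first exact: add_continuous.
by apply: cvgM; [exact: cwi|exact: cGi].
Qed.

Lemma is_derive_bil d (G : 'M[R]_d) (w : 'rV[R]_d) (c : R -> 'rV[R]_d) (s : R) :
  differentiable c s ->
  is_derive s 1 (fun s => bil G (c s) w) (bil G ('D_1 c s) w).
Proof.
move=> dc; have dc1 : derivable c s 1 by exact: diff_derivable.
have h i : is_derive s 1 (fun t => c t 0 i) ('D_1 c s 0 i).
  rewrite derive_mx// mxE; apply: DeriveDef => //.
  by move/derivable_mxP : dc1; apply.
pose k i := (G *m w^T) i 0.
have bE u : bil G u w = \sum_i k i * u 0 i.
  by rewrite /bil -mulmxA mxE; apply: eq_bigr => i _; rewrite mulrC.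
rewrite bE (_ : (fun s => _) = \sum_(i < d) (k i \*: (fun t => c t 0 i))).
  by apply: is_derive_sum => i; exact: is_deriveZ.
by apply/funext => t; rewrite bE fct_sumE.
Qed.

(** The curve is projected on its own increment w. The fundamental theorem of calculus writes |w|^2
    as the integral of G(c', w), Cauchy-Schwarz bounds this by 2 |w| L, and |w| is cancelled. The
    function [sg] stands for the speed in a varying metric, compared with the constant metric
    [G]. *)
Lemma curve_increment d (G : 'M[R]_d) (c : R -> 'rV[R]_d) (sg : R -> R) (t L : R) :
  posdef G -> 0 <= t ->
  (forall s, 0 <= s <= t -> differentiable c s) ->
  (forall s, 0 <= s <= t -> {for s, continuous (fun s => 'D_1 c s)}) ->
  (forall s, 0 <= s <= t -> {for s, continuous sg}) ->
  (forall s, 0 <= s <= t -> nrm G ('D_1 c s) <= 2 * sg s) ->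
  (\int[@lebesgue_measure R]_(s in `[0%R, t]) (sg s)%:E <= L%:E)%E ->
  nrm G (c t - c 0) <= 2 * L.
Proof.
move=> Gp t0 dc cc csg bsg intL.
have sg0 s : 0 <= s <= t -> 0 <= sg s.
  by move=> /bsg /(le_trans (nrm_ge0 _ _)); rewrite pmulr_rge0.
have L0 : 0 <= L.
  rewrite -lee_fin; apply: le_trans intL; apply: integral_ge0 => s /=.
  by rewrite in_itv /= lee_fin => /sg0.
have [<-|] := eqVneq 0 t; first by rewrite subrr nrm0 mulr_ge0.
move=> tn0; have {tn0}t0 : 0 < t by rewrite lt_neqAle tn0 t0.
set w := c t - c 0; have [->|w0] := eqVneq w 0; first by rewrite nrm0 mulr_ge0.
have nw := nrm_gt0 Gp w0.
pose F s := bil G (c s) w; pose f s := bil G ('D_1 c s) w.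
have cF s : 0 <= s <= t -> {for s, continuous F}.
  move=> /dc ds; apply: differentiable_continuous; apply/derivable1_diffP.
  by have [] := is_derive_bil G w ds.
have cf s : 0 <= s <= t -> {for s, continuous f}.
  move=> /cc cs; rewrite /f; pose h := fun v : 'rV[R]_d => bil G v w.
  apply: (@continuous_comp _ _ _ (fun s => 'D_1 c s) h) => //.
  have -> : h = fun v => \sum_i v 0 i * (G *m w^T) i 0.
    by apply/funext => v; rewrite /h /bil -mulmxA mxE.
  apply: continuous_big => [|i _]; first exact: add_continuous.
  by move=> v; apply: continuousM; [exact: coord_continuous|exact: cst_continuous].
have wi (h : R -> R) : (forall s, 0 <= s <= t -> {for s, continuous h}) ->
    {within `[0, t], continuous h}.
  by move=> ch; apply: continuous_in_subspaceT => s; rewrite inE /= in_itv; exact: ch.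
have ftc : (\int[@lebesgue_measure R]_(s in `[0%R, t]) (f s)%:E = (F t)%:E - (F 0)%:E)%E.
  apply: continuous_FTC2 => //; first exact: wi.
    have [_ h1 h2] := (continuous_within_itvP F t0).1 (wi _ cF).
    split => // s /andP[s0 st]; apply: diff_derivable; apply/derivable1_diffP.
    have /dc ds : 0 <= s <= t by rewrite !ltW.
    by have [] := is_derive_bil G w ds.
  move=> s /andP[s0 st]; rewrite derive1E.
  have /dc ds : 0 <= s <= t by rewrite !ltW.
  by have [_ ->] := is_derive_bil G w ds.
have int_le : (\int[@lebesgue_measure R]_(s in `[0%R, t]) (f s)%:E <=
   \int[@lebesgue_measure R]_(s in `[0%R, t]) ((2 * nrm G w)%:E * (sg s)%:E))%E.
  apply: le_integral => //.
  - by apply: continuous_compact_integrable; [exact: segment_compact|exact: wi].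
  - apply: integrableZl => //.
    by apply: continuous_compact_integrable; [exact: segment_compact|exact: wi].
  - move=> s; rewrite inE /= in_itv /= => st; rewrite -EFinM lee_fin.
    apply: le_trans (bil_CS _ _ Gp) _; rewrite mulrAC ler_wpM2r ?nrm_ge0//.
    exact: bsg.
move: int_le; rewrite ftc ge0_integralZl_EFin//; last 2 first.
  - apply/measurable_realfun.measurable_EFinP.
    apply: measurable_realfun.subspace_continuous_measurable_fun => //; exact: wi.
  - by rewrite mulr_ge0// ltW.
move=> h; have : ((F t)%:E - (F 0)%:E <= (2 * nrm G w)%:E * L%:E)%E.
  by apply: le_trans h _; rewrite lee_wpmul2l// lee_fin mulr_ge0// ltW.
rewrite -EFinB -EFinM lee_fin /F -bilNl -bilDl -nrm_sqr// -/w expr2 mulrAC.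
by rewrite ler_pM2r.
Qed.

End RealAnalysis.

Section Charts.
Context {R : realType} {d : nat} {M : topologicalType}.

Lemma chart_image_open (f : chart R d M) (W : set M) : open W ->
  open (f @` (chart_dom f `&` W)).
Proof.
move=> oW; rewrite openE => _ [z [fz Wz] <-]; rewrite /interior.
have fzc : (f @` chart_dom f) (f z) by exists z.
have h1 : nbhs (f z) (f @` chart_dom f).
  by apply: open_nbhs_nbhs; split => //; exact: chart_cod_open.
have h2 : nbhs (f z) (chart_inv f @^-1` W).
  apply: (chart_inv_continuous fzc); rewrite chart_mapK//.
  exact: open_nbhs_nbhs.
apply: filterS2 h1 h2 => _ [y fy <-] /=; rewrite chart_mapK// => Wy.
by exists y.
Qed.

Lemma chart_invK (f : chart R d M) u : (f @` chart_dom f) u ->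
  chart_dom f (chart_inv f u) /\ f (chart_inv f u) = u.
Proof. by move=> [z fz <-]; rewrite chart_mapK. Qed.

Lemma chart_near (f : chart R d M) z (P : set 'rV[R]_d) : chart_dom f z ->
  nbhs (f z) P -> nbhs z [set y | chart_dom f y /\ P (f y)].
Proof.
move=> fz nP; have h1 : nbhs z (chart_dom f).
  by apply: open_nbhs_nbhs; split => //; exact: chart_dom_open.
have h2 := chart_map_continuous fz nP.
exact: filterS2 h1 h2.
Qed.

Variable A : smooth_atlas R d M.

Lemma is_C1_curveP (c : R -> M) t : is_C1_curve A c -> 0 <= t <= 1 ->
  {for t, continuous c} /\
  forall i, chart_dom (A i) (c t) -> exists O : set R,
    [/\ nbhs t O & forall s, O s -> [/\ chart_dom (A i) (c s), differentiable (A i \o c) s &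
      {for s, continuous (fun s => 'D_1 (A i \o c) s)}]].
Proof.
move=> [U [oO IO cc C1]] It; have Ot : U t by apply: IO; rewrite /= in_itv.
split; first exact: cc.
move=> i ci; exists (U `&` c @^-1` chart_dom (A i)).
have h : nbhs t (c @^-1` chart_dom (A i)).
  by apply: (cc t Ot); apply: open_nbhs_nbhs; split => //; exact: chart_dom_open.
split; first by apply: filterI => //; exact: open_nbhs_nbhs.
move=> s [Os cs]; have [h1 h2] := C1 i.
by split => //; [exact: h1|exact: (h2 1 s)].
Qed.

Lemma velocity_chart (c : R -> M) (t : R) i j : {for t, continuous c} ->
  chart_dom (A i) (c t) -> chart_dom (A j) (c t) -> differentiable (A i \o c) t ->
  'D_1 (A j \o c) t = 'D_1 (A i \o c) t *m 'J (A j \o chart_inv (A i)) (A i (c t)).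
Proof.
move=> cc ci cj dc; pose f := A j \o chart_inv (A i).
have df : differentiable f (A i (c t)).
  by have [h _] := transition_smooth i j 1; apply: h; exists (c t).
have ne : \near t, (A j \o c) t = (f \o (A i \o c)) t.
  have h : nbhs t (c @^-1` chart_dom (A i)).
    by apply: cc; apply: open_nbhs_nbhs; split => //; exact: chart_dom_open.
  by near=> s; rewrite /f /= chart_mapK//; near: s.
rewrite (near_eq_derive _ ne) deriveE; last exact: differentiable_comp.
by rewrite diff_comp//= -deriveE// -deriveE// deriveEjacobian.
Unshelve. all: by end_near. Qed.

Variable g : riemannian_metric A.

Lemma metric_posdefP i z : chart_dom (A i) z -> posdef (g i (A i z)).
Proof. by move=> iz; split; [exact: Defs.metric_sym|exact: metric_posdef]. Qed.

Lemma gram_posdef z : posdef (gram_at g z).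
Proof. by apply: metric_posdefP; exact: chart_at_dom. Qed.

Lemma tangent_normE z v : tangent_norm g z v = nrm (gram_at g z) v.
Proof. by []. Qed.

Definition speed (c : R -> M) (t : R) := tangent_norm g (c t) (velocity A c t).

Lemma speed_ge0 c t : 0 <= speed c t.
Proof. exact: nrm_ge0. Qed.

(** [velocity] is read in the preferred chart at [c t], which may jump with t. The transition law of
    the metric makes the norm independent of the chart, and this is what gives continuity of the
    speed. *)
Lemma speedE c t i : {for t, continuous c} -> chart_dom (A i) (c t) ->
  differentiable (A i \o c) t ->
  speed c t = nrm (g i (A i (c t))) ('D_1 (A i \o c) t).
Proof.
move=> cc ci dc; rewrite /speed tangent_normE /velocity.
have cj := chart_at_dom A (c t).
by rewrite (velocity_chart cc ci cj dc) nrm_mulmx -metric_transition.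
Qed.

Lemma metric_continuous i z : chart_dom (A i) z ->
  {for A i z, continuous (g i)}.
Proof. by move=> iz; apply: (metric_smooth g i 0); exists z. Qed.

Lemma speed_continuous c t : is_C1_curve A c -> 0 <= t <= 1 ->
  {for t, continuous (speed c)} .
Proof.
move=> C1 It; have [cc /(_ (chart_at A (c t)) (chart_at_dom _ _))] := is_C1_curveP C1 It.
set i := chart_at A (c t); move=> [U [Ot hO]].
pose s' s := nrm (g i (A i (c s))) ('D_1 (A i \o c) s).
have [ci di c'i] := hO t (nbhs_singleton Ot).
have cs' : {for t, continuous s'}.
  apply: nrm_continuous => //.
  apply: (@continuous_comp _ _ _ (A i \o c) (g i)).
    exact: differentiable_continuous.
  exact: metric_continuous.
have [V [oV IV cV _]] := C1.
have ne : {near t, s' =1 speed c}.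
  have h : nbhs t V by apply: open_nbhs_nbhs; split => //; apply: IV; rewrite /= in_itv.
  near=> s; have [ci' di' _] : [/\ chart_dom (A i) (c s), differentiable (A i \o c) s &
      {for s, continuous (fun s => 'D_1 (A i \o c) s)}] by apply: hO; near: s.
  by rewrite /s' -speedE//; apply: cV; near: s.
have ts : speed c t = s' t by rewrite (speedE _ ci).
rewrite /prop_for /continuous_at ts.
by apply: cvg_trans cs'; apply: near_eq_cvg.
Unshelve. all: by end_near. Qed.

Lemma curve_lengthE c : curve_length g c =
  (\int[@lebesgue_measure R]_(t in `[0%R, 1%R]) (speed c t)%:E)%E.
Proof. by []. Qed.

Lemma curve_length_ge0 c : (0 <= curve_length g c)%E.
Proof. by apply: integral_ge0 => t _; rewrite lee_fin speed_ge0. Qed.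

Lemma speed_measurable c : is_C1_curve A c ->
  measurable_fun (`[0, 1]%classic : set (measurableTypeR R)) (speed c : _ -> measurableTypeR R).
Proof.
move=> C1; apply: measurable_realfun.subspace_continuous_measurable_fun => //.
by apply: continuous_in_subspaceT => s; rewrite inE /= in_itv; exact: speed_continuous.
Qed.

Lemma curve_length_sub c t : is_C1_curve A c -> 0 <= t <= 1 ->
  (\int[@lebesgue_measure R]_(s in `[0%R, t]) (speed c s)%:E <= curve_length g c)%E.
Proof.
move=> C1 /andP[t0 t1]; rewrite curve_lengthE; apply: ge0_subset_integral => //.
- by apply/measurable_realfun.measurable_EFinP; exact: speed_measurable.
- by move=> s _; rewrite lee_fin speed_ge0.
- by apply: subset_itvl; rewrite bnd_simp.
Qed.

End Charts.

(** * The Riemannian distance in charts *)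

Section RiemannianDistance.
Context {R : realType} {d : nat} {M : topologicalType}.
Hypothesis M_hausdorff : hausdorff_space M.
Variables (A : smooth_atlas R d M) (g : riemannian_metric A).

Definition chart_of z : chart R d M := A (chart_at A z).

Definition chart_dist z x y := tangent_norm g z (chart_of z y - chart_of z x).

Definition chart_ball z r : set M :=
  [set x | chart_dom (chart_of z) x /\ chart_dist z z x < r].

(** Within this radius the ball lies in the image of the chart, and the metric there differs from
    the constant metric at [z] by a factor at most 2. All factors 2 between Riemannian and chart
    distances originate here. *)
Definition good_radius z r := 0 < r /\ forall u,
  tangent_norm g z (u - chart_of z z) < r ->
  (chart_of z @` chart_dom (chart_of z)) u /\
  forall v, tangent_norm g z v <= 2 * nrm (g (chart_at A z) u) v /\
            nrm (g (chart_at A z) u) v <= 2 * tangent_norm g z v.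

Lemma chart_of_dom z : chart_dom (chart_of z) z.
Proof. exact: chart_at_dom. Qed.

Lemma good_radius_le z r s : 0 < s -> s <= r -> good_radius z r -> good_radius z s.
Proof.
move=> s0 sr [r0 h]; split => // u us; apply: h; exact: lt_le_trans us sr.
Qed.

Lemma good_radius_exists z : exists r, good_radius z r.
Proof.
have Gp := gram_posdef g z; have zi := chart_of_dom z.
have [e e0 he] := nrm_near Gp.
have [C C0 hC] := norm_le_nrm Gp.
have n1 : nbhs (chart_of z z) (chart_of z @` chart_dom (chart_of z)).
  by apply: open_nbhs_nbhs; split; [exact: chart_cod_open|exists z].
have n2 : \forall u \near chart_of z z, `|g (chart_at A z) u - gram_at g z| < e.
  have := metric_continuous (g := g) zi; move/cvgr_dist_lt => /(_ _ e0).
  by apply: filterS => u; rewrite distrC.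
have [s /= s0 hs] := (nbhs_ballP _ _).1 (filterI n1 n2).
exists (s / C); split => [|u us]; first by rewrite divr_gt0.
have [|h1 h2] := hs u.
  rewrite -ball_normE /= distrC; apply: le_lt_trans (hC _) _.
  by move: us; rewrite tangent_normE ltr_pdivlMr// mulrC.
split => // v; have [h3 h4] := he _ h2 v; by rewrite !tangent_normE.
Qed.

Lemma shift_nrm_continuous z (w : 'rV[R]_d) :
  continuous (fun u : 'rV[R]_d => tangent_norm g z (u - w)).
Proof.
move=> u.
have h : {for u, continuous (fun v : 'rV[R]_d => nrm (gram_at g z) (v - w))}.
  apply: nrm_continuous; first exact: cst_continuous.
  by apply: continuousB; [exact: cvg_id|exact: cst_continuous].
exact: h.
Qed.

Lemma chart_ball_open z r : open (chart_ball z r).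
Proof.
rewrite openE => x [dx xr].
have : \forall u \near chart_of z x, tangent_norm g z (u - chart_of z z) < r.
  have c := @shift_nrm_continuous z (chart_of z z) (chart_of z x).
  by apply: (c [set t | t < r]); apply: lt_nbhsl.
exact: chart_near.
Qed.

Lemma chart_ball_center z r : 0 < r -> chart_ball z r z.
Proof.
by move=> r0; split; [exact: chart_of_dom|rewrite /chart_dist subrr tangent_normE nrm0].
Qed.

Lemma chart_ball_nbhs z r : 0 < r -> nbhs z (chart_ball z r).
Proof.
move=> r0; apply: open_nbhs_nbhs; split; first exact: chart_ball_open.
exact: chart_ball_center.
Qed.

Lemma chart_distC z x y : chart_dist z x y = chart_dist z y x.
Proof. by rewrite /chart_dist !tangent_normE nrm_distC. Qed.

Lemma chart_dist_ge0 z x y : 0 <= chart_dist z x y.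
Proof. exact: nrm_ge0. Qed.

Lemma chart_dist_triangle z x y w : chart_dist z x w <= chart_dist z x y + chart_dist z y w.
Proof.
rewrite /chart_dist !tangent_normE (_ : chart_of z w - chart_of z x =
  (chart_of z y - chart_of z x) + (chart_of z w - chart_of z y)).
  exact: nrmD (gram_posdef g z).
by rewrite [RHS]addrC addrA subrK.
Qed.

(* A curve of length [L] starting well inside the ball cannot leave it: up to
   its exit time it stays in a compact, hence closed, smaller ball. *)
Lemma short_curve z r c L : good_radius z r -> is_C1_curve A c ->
  (curve_length g c <= L%:E)%E -> chart_dom (chart_of z) (c 0) ->
  chart_dist z z (c 0) + 2 * L < r ->
  chart_ball z r (c 1) /\ chart_dist z (c 0) (c 1) <= 2 * L.
Proof.
move=> [r0 gr] C1 lenL c0 c0r.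
have Gp := gram_posdef g z.
have L0 : 0 <= L by rewrite -lee_fin; apply: le_trans lenL; exact: curve_length_ge0.
set ch := chart_of z in gr *.
have est t : 0 <= t <= 1 -> (forall s, 0 <= s <= t -> chart_ball z r (c s)) ->
    chart_dist z (c 0) (c t) <= 2 * L.
  move=> /andP[t0 t1] tr.
  have st1 s : 0 <= s <= t -> 0 <= s <= 1.
    by move=> /andP[-> st]; exact: le_trans st t1.
  have P s : 0 <= s <= t -> differentiable (ch \o c) s /\
      {for s, continuous (fun s => 'D_1 (ch \o c) s)}.
    move=> ss; have [_ /(_ (chart_at A z) (proj1 (tr _ ss)))[U [Us hU]]] :=
      is_C1_curveP C1 (st1 _ ss).
    by have [_ ? ?] := hU _ (nbhs_singleton Us).
  apply: (@curve_increment _ _ _ (ch \o c) (speed g c) t L Gp t0).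
  - by move=> s /P[].
  - by move=> s /P[].
  - by move=> s /st1; exact: speed_continuous.
  - move=> s ss; have [ds _] := P _ ss; have [dcs cs] := tr _ ss.
    have [cc _] := is_C1_curveP C1 (st1 _ ss).
    rewrite (speedE g cc dcs ds).
    by have [_ /(_ ('D_1 (ch \o c) s))[]] := gr _ cs.
  - by apply: le_trans lenL; apply: curve_length_sub => //; rewrite t0.
pose K := [set u | tangent_norm g z (u - ch z) <= chart_dist z z (c 0) + 2 * L].
have Kc : compact K.
  apply: bounded_closed_compact.
    have [C C0 hC] := norm_le_nrm Gp.
    exists (C * (chart_dist z z (c 0) + 2 * L) + `|ch z|).
    split => [|b Cb u Ku /=]; first exact: num_real.
    apply: le_trans (ltW Cb).
    rewrite -[u](subrK (ch z)); apply: le_trans (ler_normD _ _) _; rewrite lerD2r.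
    by apply: le_trans (hC _) _; rewrite ler_pM2l.
  apply: (@preimage_closed _ _ _ [set x | x <= chart_dist z z (c 0) + 2 * L]).
    by move=> u _; exact: shift_nrm_continuous.
  exact: closed_le.
have Kr u : K u -> (ch @` chart_dom ch) u /\ tangent_norm g z (u - ch z) < r.
  by move=> Ku; have ur := le_lt_trans Ku c0r; have [] := gr _ ur.
(* Here [M] has to be Hausdorff: otherwise the curve could keep its coordinates in [K] and still
   converge to a point outside the chart. *)
have K'c : closed (chart_inv ch @` K).
  apply: compact_closed => //; apply: continuous_compact => //.
  apply: continuous_in_subspaceT => u; rewrite inE => /Kr[? _].
  exact: chart_inv_continuous.
have K'r x : (chart_inv ch @` K) x -> chart_ball z r x.
  by move=> [u /Kr[/chart_invK[? e] h] <-]; split => //; rewrite /chart_dist -/ch e.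
pose S := [set t : R | 0 <= t <= 1 /\ forall s, 0 <= s <= t -> chart_ball z r (c s)].
have c0in : chart_ball z r (c 0).
  by split => //; apply: le_lt_trans c0r; rewrite lerDl mulr_ge0.
have S0 : S 0.
  split; first by rewrite lexx ler01.
  by move=> s; rewrite -eq_le => /eqP <-.
have inK t : S t -> (chart_inv ch @` K) (c t).
  move=> [t01 tr]; have [dt _] : chart_ball z r (c t).
    by apply: tr; rewrite lexx andbT; case/andP : t01.
  exists (ch (c t)); last by rewrite chart_mapK.
  apply: le_trans (chart_dist_triangle z z (c 0) (c t)) _; rewrite lerD2l; exact: est.
have hS : has_sup S.
  by split; [exists 0|exists 1 => t [/andP[]]].
pose tau := sup S.
have tau0 : 0 <= tau by apply: ub_le_sup => //; case: hS.
have tau1 : tau <= 1 by apply: ge_sup; [exists 0|move=> t [/andP[]]].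
have tau01 : 0 <= tau <= 1 by rewrite tau0.
have [ctau _] := is_C1_curveP C1 tau01.
have below s : 0 <= s -> s < tau -> S s.
  move=> s0 st; have [t [/andP[t0 t1] tr] tt] : exists2 t, S t & s < t.
    by apply: sup_gt => //; exists 0.
  split; first by rewrite s0 (le_trans (ltW tt) t1).
  by move=> u /andP[u0 us]; apply: tr; rewrite u0 (le_trans us (ltW tt)).
have Ktau : (chart_inv ch @` K) (c tau).
  have [<-|tau_neq0] := eqVneq 0 tau; first exact: inK.
  have tau_gt0 : 0 < tau by rewrite lt_neqAle tau_neq0.
  apply: K'c => W Wn; have /nbhs_ballP[e /= e0 he] := ctau _ Wn.
  pose m := Num.min tau e; have m0 : 0 < m by rewrite lt_min tau_gt0.
  have mt : m <= tau by rewrite ge_min lexx.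
  have me : m <= e by rewrite ge_min lexx orbT.
  exists (c (tau - m / 2)); split; first by apply/inK/below; lra.
  apply: he; rewrite /ball /= opprB addrCA subrr addr0 ger0_norm; lra.
have Stau : S tau.
  split=> [|s /andP[s0]]; first by rewrite tau0.
  rewrite le_eqVlt => /orP[/eqP ->|st]; first exact: K'r.
  by apply/K'r/inK/below.
have tauE : tau = 1.
  apply/eqP; rewrite eq_le tau1 leNgt; apply/negP => tau_lt1.
  have /nbhs_ballP[e /= e0 he] : \forall s \near tau, chart_ball z r (c s).
    apply: ctau; apply: open_nbhs_nbhs; split; first exact: chart_ball_open.
    exact: K'r.
  pose m := Num.min (1 - tau) e; have m0 : 0 < m by rewrite lt_min subr_gt0 tau_lt1.
  have mt : m <= 1 - tau by rewrite ge_min lexx.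
  have me : m <= e by rewrite ge_min lexx orbT.
  have : S (tau + m / 2).
    split=> [|s /andP[s0 st]]; first by apply/andP; split; lra.
    have [stau|stau] := leP s tau; first by apply: (proj2 Stau); rewrite s0.
    by apply: he; rewrite /ball /= ltr0_norm; lra.
  move=> /(ub_le_sup (proj2 hS)); rewrite -/tau; lra.
have /K'r btau := Ktau; have etau := est tau tau01 (proj2 Stau).
by rewrite tauE in btau etau.
Qed.

Lemma short_chain z r n (c : nat -> R -> M) L : good_radius z r ->
  (forall i, (i <= n)%N -> is_C1_curve A (c i)) ->
  (forall i, (i < n)%N -> c i 1 = c i.+1 0) ->
  (\sum_(i < n.+1) curve_length g (c i) <= L%:E)%E ->
  chart_dom (chart_of z) (c 0%N 0) -> chart_dist z z (c 0%N 0) + 2 * L < r ->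
  chart_ball z r (c n 1) /\ chart_dist z (c 0%N 0) (c n 1) <= 2 * L.
Proof.
move=> gr; elim: n L => [|n IH] L C1 cc.
  by rewrite big_ord1 => lenL d0; apply: short_curve => //; exact: C1.
rewrite big_ord_recr /= => lenL d0 c0r.
have s0 : (0 <= \sum_(i < n.+1) curve_length g (c i))%E.
  by apply: sume_ge0 => i _; exact: curve_length_ge0.
have l0 := curve_length_ge0 g (c n.+1).
case: (\sum_(i < n.+1) _)%E s0 lenL IH => [L1 s0 lenL IH| |//]; last first.
  by move=> _; rewrite addye ?gt_eqF// (lt_le_trans _ l0)// ltNy0.
have sc L2 := @short_curve z r (c n.+1) L2 gr (C1 _ (leqnn n.+1)).
case: (curve_length g (c n.+1)) lenL sc l0 => //.
move=> L2 lenL sc l0; rewrite -EFinD !lee_fin in lenL s0 l0.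
have [|i ni||//||h1 h2] := IH L1; rewrite ?lexx//.
- by move=> i ni; apply: C1; exact: leqW.
- by apply: cc; exact: ltnW.
- by apply: le_lt_trans c0r; rewrite lerD2l ler_pM2l//; lra.
have [||h3 h4] := sc L2 (lexx _); rewrite -?cc//.
- by case: h1.
- apply: le_lt_trans c0r.
  have := chart_dist_triangle z z (c 0%N 0) (c n 1); lra.
- split => //; apply: le_trans (chart_dist_triangle z _ (c n 1) _) _.
  by rewrite cc//; rewrite cc// in h2; lra.
Qed.

(** The infimum defining the distance need not be attained, so chains of length below s + e are
    used, with e a fraction of the slack left before radius r; then e tends to 0. *)
Lemma chart_dist_le_dist z r x y (s : R) : good_radius z r ->
  chart_dom (chart_of z) x -> chart_dist z z x + 2 * s < r ->
  (riemannian_dist g x y <= s%:E)%E ->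
  chart_ball z r y /\ chart_dist z x y <= 2 * s.
Proof.
move=> gr dx xr xys.
have key e : 0 < e -> chart_dist z z x + 2 * (s + e) < r ->
    chart_ball z r y /\ chart_dist z x y <= 2 * (s + e).
  move=> e0 xer; have : (riemannian_dist g x y < (s + e)%:E)%E.
    by apply: le_lt_trans xys _; rewrite lte_fin ltrDl.
  move=> /ereal_inf_lt[L [n [c [C1 c0 c1 cc LE]]] Ls].
  by rewrite -c0 -c1; apply: short_chain => //; rewrite ?c0// -LE ltW.
pose e0 := (r - (chart_dist z z x + 2 * s)) / 4.
have e00 : 0 < e0 by rewrite /e0; lra.
split; first by apply: (proj1 (key e0 e00 _)); rewrite /e0; lra.
apply/ler_addgt0Pr => e e_gt0; pose e1 := Num.min e0 (e / 2).
have e1e : e1 <= e / 2 by rewrite ge_min lexx orbT.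
have e1e0 : e1 <= e0 by rewrite ge_min lexx.
have e10 : 0 < e1 by rewrite lt_min e00/= divr_gt0.
have [|_] := key e1 e10; last by lra.
by move: e1e0; rewrite /e0; lra.
Qed.

(** The straight segment in the chart stays in the ball by convexity, and its Riemannian speed is at
    most twice its constant speed for the metric at [z]. *)
Lemma line_dist_le z r x y : good_radius z r -> chart_ball z r x -> chart_ball z r y ->
  (riemannian_dist g x y <= (2 * chart_dist z x y)%:E)%E.
Proof.
move=> [r0 gr] [dx xr] [dy yr]; set ch := chart_of z in gr dx dy *.
have Gp := gram_posdef g z.
pose w := ch y - ch x; pose ga := fun t : R => ch x + t *: w.
pose c := chart_inv ch \o ga.
have gac : continuous ga.
  by move=> t; apply: differentiable_continuous; have := line_is_diff (ch x) w t; case.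
(* [is_C1_curve] asks for regularity on an open set of times around [0, 1]. *)
pose U := [set t : R | tangent_norm g z (ga t - ch z) < r].
have oU : open U.
  apply: (@open_comp _ _ (fun t => tangent_norm g z (ga t - ch z)) [set s | s < r]).
    move=> t _; apply: (@continuous_comp _ _ _ ga (fun u => tangent_norm g z (u - ch z))).
      exact: gac.
    exact: shift_nrm_continuous.
  exact: open_lt.
have U01 t : 0 <= t <= 1 -> U t.
  move=> /andP[t0 t1]; rewrite /U /= tangent_normE.
  have -> : ga t - ch z = (1 - t) *: (ch x - ch z) + t *: (ch y - ch z).
    rewrite /ga /w; apply/rowP => j; rewrite !mxE; ring.
  apply: le_lt_trans (nrmD _ _ Gp) _; rewrite !nrmZ !ger0_norm ?subr_ge0//.
  have [->|tn0] := eqVneq t 0; first by rewrite subr0 mul1r mul0r addr0.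
  have tp : 0 < t by rewrite lt_neqAle eq_sym tn0.
  have := xr; rewrite /chart_dist tangent_normE -/ch => {}xr.
  have := yr; rewrite /chart_dist tangent_normE -/ch => {}yr.
  have h1 : (1 - t) * nrm (gram_at g z) (ch x - ch z) <= (1 - t) * r.
    by apply: ler_wpM2l; [rewrite subr_ge0|exact: ltW].
  have h2 : t * nrm (gram_at g z) (ch y - ch z) < t * r by rewrite ltr_pM2l.
  lra.
have Uc t : U t -> chart_dom ch (c t) /\ ch (c t) = ga t.
  by move=> /gr[/chart_invK].
have cc t : U t -> {for t, continuous c}.
  move=> Ut; apply: continuous_comp; first exact: gac.
  by apply: chart_inv_continuous; case: (gr _ Ut).
have C1 : is_C1_curve A c.
  exists U; split => //.
  move=> j; pose f := A j \o chart_inv ch.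
  have im t : (U `&` c @^-1` chart_dom (A j)) t ->
      (ch @` (chart_dom ch `&` chart_dom (A j))) (ga t).
    by move=> [/Uc[h1 h2] h3]; exists (c t).
  have [df cDf] := transition_smooth (chart_at A z) j 1.
  split => [t tU|v t tU].
    apply: (@differentiable_comp _ _ _ _ ga f); last exact: df (im _ tU).
    by have := line_is_diff (ch x) w t; case.
  have oV : open (U `&` c @^-1` chart_dom (A j)).
    rewrite openE => s [Us cs]; apply: filterI; first exact: open_nbhs_nbhs.
    by apply: (cc s Us); apply: open_nbhs_nbhs; split => //; exact: chart_dom_open.
  have DE s : (U `&` c @^-1` chart_dom (A j)) s ->
      'D_v (A j \o c) s = 'D_(v *: w) f (ga s).
    move=> sU; have [dg dgE] := line_is_diff (ch x) w s.
    have dfs := df _ (im _ sU).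
    have dfg : differentiable (f \o ga) s by exact: differentiable_comp.
    transitivity ('d (f \o ga) s v); first exact: (@deriveE _ _ _ (f \o ga) s v dfg).
    by rewrite diff_comp//= deriveE// dgE.
  rewrite /prop_for /continuous_at DE//.
  have : ('D_(v *: w) f \o ga) s @[s --> t] --> 'D_(v *: w) f (ga t).
    apply: (@continuous_comp _ _ _ ga ('D_(v *: w) f) t); first exact: gac.
    exact: cDf (im _ tU).
  apply: cvg_trans; apply: near_eq_cvg.
  have : nbhs t (U `&` c @^-1` chart_dom (A j)) by apply: open_nbhs_nbhs.
  by apply: filterS => s /DE ->.
apply: (@le_trans _ _ (curve_length g c)).
  apply: ereal_inf_lbound; exists 0%N, (fun=> c); split => //.
  - by rewrite /c /ga /= scale0r addr0 chart_mapK.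
  - by rewrite /c /ga /= scale1r addrC subrK chart_mapK.
  - by rewrite big_ord1.
have sp t : 0 <= t <= 1 -> speed g c t <= 2 * tangent_norm g z w.
  move=> t01; have Ut := U01 _ t01; have [dc ce] := Uc _ Ut.
  have [dga dgaE] := line_is_diff (ch x) w t.
  have ne : \near t, (ch \o c) t = ga t.
    have : nbhs t U by apply: open_nbhs_nbhs.
    by apply: filterS => s /Uc[].
  have De : 'D_1 (ch \o c) t = w.
    by rewrite (near_eq_derive _ ne) deriveE// dgaE scale1r.
  have dch : differentiable (ch \o c) t.
    apply/derivable1_diffP; apply: near_eq_derivable; last by apply/derivable1_diffP; exact: dga.
    by apply: filterS ne => s /= ->.
  rewrite (speedE g (cc _ Ut) dc dch) De ce.
  by have [_ /(_ w)[]] := gr _ Ut.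
rewrite curve_lengthE.
apply: (@le_trans _ _ (\int[@lebesgue_measure R]_(t in `[0%R, 1%R])
    (2 * tangent_norm g z w)%:E)%E).
  apply: ge0_le_integral => //.
  - by move=> t _; rewrite lee_fin speed_ge0.
  - by apply/measurable_realfun.measurable_EFinP; exact: speed_measurable.
rewrite [leLHS](@integral_cst _ _ _ lebesgue_measure `[0, 1]%classic (measurable_itv _) (2 * tangent_norm g z w)%:E).
have mu1 : lebesgue_measure (`[0, 1]%classic : set R) = 1%:E.
  by rewrite lebesgue_measure_itv /= lte_fin ltr01 oppr0 adde0.
by rewrite [X in (_ * X)%E](_ : _ = 1%:E)// mule1.
Qed.

End RiemannianDistance.

(** * Strict differentiability *)

Section StrictDifferentiability.
Context {R : realType}.

Lemma jacobian_row d (f : 'rV[R]_d -> 'rV[R]_d) p l k : differentiable f p ->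
  ('J f p) l k = ('D_(delta_mx 0 l) f p) 0 k.
Proof. by move=> df; rewrite deriveEjacobian// -rowE [RHS]mxE. Qed.

Lemma jacobian_near d (f : 'rV[R]_d -> 'rV[R]_d) (p q w : 'rV[R]_d) e :
  differentiable f p -> differentiable f q ->
  (forall l : 'I_d, `|'D_(delta_mx 0 l) f p - 'D_(delta_mx 0 l) f q| <= e) ->
  `|w *m ('J f q - 'J f p)| <= d%:R * (e * `|w|).
Proof.
move=> dp dq h; have JE l k : `|('J f q - 'J f p) l k| <= e.
  have := coord_le_norm ('D_(delta_mx 0 l) f p - 'D_(delta_mx 0 l) f q) 0 k.
  move/le_trans => /(_ _ (h l)); move: (jacobian_row l k dp) (jacobian_row l k dq).
  move: ('J f p) ('J f q) ('D_(delta_mx 0 l) f p) ('D_(delta_mx 0 l) f q).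
  by move=> Jp Jq Dp Dq jp jq; rewrite 4!mxE jp jq distrC.
move: ('J f q - 'J f p) JE => D JE.
have d0 : 0 <= d%:R * (e * `|w|).
  case: d {f p q dp dq h} w D JE => [|d] w D JE; first by rewrite mul0r.
  by rewrite mulr_ge0// mulr_ge0// (le_trans _ (JE 0 0)).
apply: mx_norm_le => // i k; rewrite mxE (ord1 i).
apply: le_trans (ler_norm_sum _ _ _) _; apply: sum_le_const => l.
by rewrite normrM mulrC; apply: ler_pM => //; exact: coord_le_norm.
Qed.

Lemma derivable_along_line d (f : 'rV[R]_d -> 'rV[R]_d) (u w : 'rV[R]_d) (t : R) k :
  differentiable f (u + t *: w) ->
  is_derive t 1 (fun s => f (u + s *: w) 0 k) ((w *m 'J f (u + t *: w)) 0 k).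
Proof.
move=> df; have [dl dlE] := line_is_diff u w t.
pose ga := fun s : R => u + s *: w.
have dfl : differentiable (f \o ga) t by exact: differentiable_comp.
have df1 : derivable (f \o ga) t 1 by exact: diff_derivable.
have -> : w *m 'J f (u + t *: w) = 'D_1 (f \o ga) t.
  rewrite (@deriveE _ _ _ (f \o ga) t 1 dfl) diff_comp//= dlE scale1r.
  by rewrite -deriveEjacobian// deriveE.
rewrite derive_mx// mxE; apply: DeriveDef => //.
by move/derivable_mxP : df1; apply.
Qed.

(** The mean value theorem is applied to each coordinate along the segment from v to u, where the
    partial derivatives are within [e] of those at [p]. The intermediate point depends on the
    coordinate, which is harmless for the sup norm. *)
Lemma strictly_differentiable d (U : set 'rV[R]_d) (f : 'rV[R]_d -> 'rV[R]_d) p eta :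
  open U -> U p -> class_C 1 U f -> 0 < eta ->
  exists2 r, 0 < r & forall u v, `|u - p| < r -> `|v - p| < r ->
    `|f u - f v - (u - v) *m 'J f p| <= eta * `|u - v|.
Proof.
move=> oU Up [df cD] eta0.
pose e := eta / (d%:R + 1).
have d1 : 0 < d%:R + 1 :> R by rewrite ltr_wpDl.
have e0 : 0 < e by rewrite divr_gt0.
have h1 : nbhs p U by apply: open_nbhs_nbhs.
have h2 : \forall u \near p, forall l : 'I_d,
    `|'D_(delta_mx 0 l) f p - 'D_(delta_mx 0 l) f u| < e.
  apply: (@filter_forall _ 'I_d (fun l u =>
    `|'D_(delta_mx 0 l) f p - 'D_(delta_mx 0 l) f u| < e) (nbhs p)) => l.
  by have /cvgr_dist_lt := cD (delta_mx 0 l) p Up; apply.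
have [r /= r0 hr] := (nbhs_ballP _ _).1 (filterI h1 h2).
exists r => // u v up vp.
pose w := u - v.
have seg t : 0 <= t <= 1 -> `|v + t *: w - p| < r.
  move=> /andP[t0 t1].
  have -> : v + t *: w - p = (1 - t) *: (v - p) + t *: (u - p).
    by rewrite /w; apply/rowP => j; rewrite !mxE; ring.
  apply: le_lt_trans (ler_normD _ _) _; rewrite !normrZ !ger0_norm ?subr_ge0//.
  have [->|tn0] := eqVneq t 0; first by rewrite subr0 mul1r mul0r addr0.
  have tp : 0 < t by rewrite lt_neqAle eq_sym tn0.
  have k1 : (1 - t) * `|v - p| <= (1 - t) * r.
    by apply: ler_wpM2l; [rewrite subr_ge0|exact: ltW].
  have k2 : t * `|u - p| < t * r by rewrite ltr_pM2l.
  lra.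
have inr t : 0 <= t <= 1 -> U (v + t *: w) /\ forall l : 'I_d,
    `|'D_(delta_mx 0 l) f p - 'D_(delta_mx 0 l) f (v + t *: w)| < e.
  by move=> t01; apply: hr; rewrite -ball_normE /= distrC; exact: seg.
apply: mx_norm_le => [|i k]; first by rewrite mulr_ge0// ltW.
rewrite (ord1 i).
pose h : R -> R := fun t => f (v + t *: w) 0 k.
have dh (t : R) : 0 <= t <= 1 -> is_derive t 1 h ((w *m 'J f (v + t *: w)) 0 k).
  by move=> /inr[Ut _]; apply: derivable_along_line; exact: df.
have [t t01 ht] : exists2 t, t \in `[0, 1]%R &
    h 1 - h 0 = ((w *m 'J f (v + t *: w)) 0 k) * (1 - 0).
  apply: (@MVT_segment R h (fun t => (w *m 'J f (v + t *: w)) 0 k)) => //.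
    by move=> t /andP[t0 t1]; apply: dh; rewrite !ltW.
  apply: continuous_in_subspaceT => t; rewrite inE /= in_itv /= => t01.
  by apply: differentiable_continuous; apply/derivable1_diffP; have [] := dh _ t01.
rewrite in_itv /= in t01; have [Ut Dt] := inr _ t01.
have [q qE] : exists q : 'rV[R]_d, q = v + t *: w by exists (v + t *: w).
rewrite -qE in ht Ut Dt.
have -> : (f u - f v - (u - v) *m 'J f p) 0 k = (w *m ('J f q - 'J f p)) 0 k.
  move: ht; rewrite subr0 mulr1 /h scale0r addr0 scale1r.
  rewrite (_ : v + w = u); last by rewrite /w addrC subrK.
  rewrite mulmxBr => ht; rewrite [LHS]mxE [RHS]mxE; congr (_ + _).
  by rewrite -ht mxE [X in _ + X]mxE.
apply: le_trans (coord_le_norm _ _ _) _.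
apply: le_trans (jacobian_near w (df _ Up) (df _ Ut) (fun l => ltW (Dt l))) _.
rewrite mulrA ler_wpM2r// /e mulrCA -{2}(mulr1 eta) ler_pM2l//.
by rewrite ler_pdivrMr// mul1r lerDl.
Qed.

Lemma jacobian_unique d (f : 'rV[R]_d -> 'rV[R]_d) p (T : 'M[R]_d) :
  (forall eta, 0 < eta -> \forall u \near p, `|f u - f p - (u - p) *m T| <= eta * `|u - p|) ->
  'J f p = T.
Proof.
move=> h; pose L : {linear 'rV[R]_d -> 'rV[R]_d} := mulmxr T.
have cL (u : 'rV[R]_d) : {for u, continuous (fun v : 'rV[R]_d => v *m T)}.
  apply/(@cvgrPdist_le _ _ _ (nbhs u)) => e e0.
  have [C C0 hC] : exists2 C, 0 < C & forall v : 'rV[R]_d, `|v *m T| <= C * `|v|.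
    exists (d%:R * `|T| + 1) => [|v]; first by rewrite ltr_wpDl// mulr_ge0.
    apply: mx_norm_le => [|i j].
      by rewrite mulr_ge0// addr_ge0// mulr_ge0.
    rewrite mxE; apply: le_trans (ler_norm_sum _ _ _) _.
    apply: (@le_trans _ _ (d%:R * (`|T| * `|v|))).
      apply: sum_le_const => k; rewrite normrM mulrC.
      by apply: ler_pM => //; exact: coord_le_norm.
    by rewrite mulrA ler_wpM2r// lerDl.
  have eC : 0 < e / C by rewrite divr_gt0.
  have /cvgrPdist_le/(_ _ eC) := @cvg_id _ (nbhs u).
  apply: filterS => v uv; rewrite -mulmxBl; apply: le_trans (hC _) _.
  by rewrite mulrC -ler_pdivlMr.
have dE : 'd f p = L :> ('rV[R]_d -> 'rV[R]_d).
  apply: diff_unique => //; apply/eqaddoP => eps eps0.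
  have := h _ eps0; rewrite (near_shift 0 p) subr0; apply: filterS => x /=.
  by rewrite addrK opprD addrA.
by apply/matrixP => i j; rewrite /jacobian dE mxE /= -rowE mxE.
Qed.

End StrictDifferentiability.

(** * Strict differentiability on the manifold and the chain rule for iterates *)

Section TangentMaps.
Context {R : realType} {d : nat} {M : topologicalType}.
Variables (A : smooth_atlas R d M) (g : riemannian_metric A).

Definition chart_diff z x y : 'rV[R]_d := chart_of A z y - chart_of A z x.

(* Strict differentiability at [z], read in the preferred charts at [z] and
   [F z]; unlike differentiability it compares two points near [z]. *)
Definition strict_diff (F : M -> M) z (T : 'M[R]_d) := forall eta, 0 < eta ->
  exists2 U, nbhs z U & forall x y, U x -> U y ->
    [/\ chart_dom (chart_of A z) x, chart_dom (chart_of A (F z)) (F x) &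
    tangent_norm g (F z) (chart_diff (F z) (F x) (F y) - chart_diff z x y *m T)
      <= eta * chart_dist g z x y].

Lemma chart_distE z x y : chart_dist g z x y = nrm (gram_at g z) (chart_diff z x y).
Proof. by []. Qed.

Lemma mulmx_bounded z w (T : 'M[R]_d) : exists2 C, 0 < C &
  forall v, tangent_norm g w (v *m T) <= C * tangent_norm g z v.
Proof.
have [C1 C10 h1] := norm_le_nrm (gram_posdef g z).
have [C2 C20 h2] := nrm_le_norm (T *m gram_at g w *m T^T).
exists (C2 * C1) => [|v]; first exact: mulr_gt0.
rewrite !tangent_normE nrm_mulmx; apply: le_trans (h2 v) _.
by rewrite -mulrA ler_pM2l.
Qed.

Lemma strict_diff_bound F z T : strict_diff F z T -> exists2 C, 0 < C &
  exists2 U, nbhs z U & forall x y, U x -> U y ->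
    chart_dist g (F z) (F x) (F y) <= C * chart_dist g z x y.
Proof.
move=> FT; have [C C0 hC] := mulmx_bounded z (F z) T.
have [U nU hU] := FT 1 ltr01.
exists (1 + C); first by rewrite addr_gt0.
exists U => // x y Ux Uy; have [_ _] := hU x y Ux Uy.
rewrite mul1r mulrDl mul1r => h.
rewrite chart_distE -(subrK (chart_diff z x y *m T) (chart_diff (F z) _ _)).
apply: le_trans (nrmD _ _ (gram_posdef g _)) _; apply: lerD => //.
exact: hC.
Qed.

Lemma strict_diff_id z : strict_diff id z 1%:M.
Proof.
move=> eta eta0; exists (chart_dom (chart_of A z)).
  apply: open_nbhs_nbhs; split; first exact: chart_dom_open.
  exact: chart_of_dom.
move=> x y Ux Uy; split => //; rewrite mulmx1 subrr tangent_normE nrm0.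
by rewrite mulr_ge0 ?nrm_ge0// ltW.
Qed.

(** The error is that of [G] at the image points plus the error of [F] pushed forward by [T]. Each
    is given half of [eta], using a local Lipschitz constant [C] of [F] and a norm bound [D] of
    [T]. *)
Lemma strict_diff_comp F G z S T : {for z, continuous F} ->
  strict_diff F z S -> strict_diff G (F z) T -> strict_diff (G \o F) z (S *m T).
Proof.
move=> cF FS GT eta eta0.
have [C C0 [U0 nU0 hU0]] := strict_diff_bound FS.
have [D D0 hD] := mulmx_bounded (F z) (G (F z)) T.
have e1 : 0 < eta / (2 * C) by rewrite divr_gt0// mulr_gt0.
have e2 : 0 < eta / (2 * D) by rewrite divr_gt0// mulr_gt0.
have [U1 nU1 hU1] := GT _ e1.
have [U2 nU2 hU2] := FS _ e2.
exists ((U0 `&` U2) `&` F @^-1` U1).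
  by apply: filterI; [exact: filterI|exact: cF].
move=> x y [[U0x U2x] U1x] [[U0y U2y] U1y].
have [h1 _ h2] := hU2 _ _ U2x U2y.
have [_ h3 h4] := hU1 _ _ U1x U1y.
split => //=; rewrite mulmxA.
set a := chart_diff _ _ _; set b := chart_diff (F z) (F x) (F y) in h2 h4.
have aux (p q r : 'rV[R]_d) : p - r *m S *m T = (p - q *m T) + (q - r *m S) *m T.
  by rewrite mulmxBl addrA subrK.
rewrite (aux a b (chart_diff z x y)).
apply: le_trans (nrmD _ _ (gram_posdef g _)) _.
rewrite (_ : eta = eta / 2 + eta / 2) ?mulrDl; last by field.
apply: lerD.
  apply: le_trans h4 _.
  apply: (@le_trans _ _ (eta / (2 * C) * (C * chart_dist g z x y))).
    by rewrite ler_pM2l//; exact: hU0.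
  by rewrite le_eqVlt; apply/orP; left; apply/eqP; field; rewrite gt_eqF.
apply: le_trans (hD _) _.
apply: (@le_trans _ _ (D * (eta / (2 * D) * chart_dist g z x y))).
  by rewrite ler_pM2l.
by rewrite le_eqVlt; apply/orP; left; apply/eqP; field; rewrite gt_eqF.
Qed.

Lemma strict_diff_C1 F z : is_C1_map A F -> strict_diff F z (tangent_map A F z).
Proof.
move=> [cF C1] eta eta0; pose i := chart_at A z; pose j := chart_at A (F z).
have oD : open (F @^-1` chart_dom (A j)).
  by apply: open_comp => [x _|]; [exact: cF|exact: chart_dom_open].
have zD : (F @^-1` chart_dom (A j)) z by exact: chart_at_dom.
have oU := chart_image_open (f := A i) oD.
have Up : (A i @` (chart_dom (A i) `&` F @^-1` chart_dom (A j))) (A i z).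
  by exists z => //; split => //; exact: chart_at_dom.
have [C C0 hC] := nrm_le_norm (gram_at g (F z)).
have [D D0 hD] := norm_le_nrm (gram_posdef g z).
have e0 : 0 < eta / (C * D) by rewrite divr_gt0// mulr_gt0.
have [r r0 hr] := strictly_differentiable oU Up (C1 i j) e0.
exists ([set y | chart_dom (A i) y /\ `|A i y - A i z| < r] `&` F @^-1` chart_dom (A j)).
  apply: filterI; last exact: open_nbhs_nbhs.
  apply: (chart_near (P := [set u | `|u - A i z| < r])); first exact: chart_at_dom.
  by have := near_ball (A i z) r r0; apply: filterS => u; rewrite -ball_normE /= distrC.
move=> x y [[xi xr] xj] [[yi yr] yj]; split => //.
rewrite tangent_normE; apply: le_trans (hC _) _.
have := hr _ _ yr xr; rewrite /= !chart_mapK// => h.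
apply: (@le_trans _ _ (C * (eta / (C * D) * `|A i y - A i x|))).
  by rewrite ler_pM2l.
apply: (@le_trans _ _ (C * (eta / (C * D) * (D * chart_dist g z x y)))).
  by rewrite ler_pM2l// ler_pM2l//; exact: hD.
by rewrite le_eqVlt; apply/orP; left; apply/eqP; field; rewrite !gt_eqF.
Qed.

Lemma strict_diff_tangent_map F z T : strict_diff F z T -> tangent_map A F z = T.
Proof.
move=> FT; apply: jacobian_unique => eta eta0.
have [C C0 hC] := norm_le_nrm (gram_posdef g (F z)).
have [D D0 hD] := nrm_le_norm (gram_at g z).
have e0 : 0 < eta / (C * D) by rewrite divr_gt0// mulr_gt0.
have [U nU hU] := FT _ e0; pose ch := chart_of A z.
have zd : chart_dom ch z by exact: chart_of_dom.
have zi : (ch @` chart_dom ch) (ch z) by exists z.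
have h1 : nbhs (ch z) (ch @` chart_dom ch).
  by apply: open_nbhs_nbhs; split; [exact: chart_cod_open|].
have h2 : nbhs (ch z) (chart_inv ch @^-1` U).
  by apply: (chart_inv_continuous zi); rewrite chart_mapK.
apply: filterS2 h1 h2 => _ [y yd <-] /=; rewrite chart_mapK// => Uy.
have [_ _ h] := hU _ _ (nbhs_singleton nU) Uy.
rewrite -/(chart_of A z) -/ch !chart_mapK//.
apply: le_trans (hC _) _.
apply: (@le_trans _ _ (C * (eta / (C * D) * chart_dist g z z y))).
  by rewrite ler_pM2l.
apply: (@le_trans _ _ (C * (eta / (C * D) * (D * `|ch y - ch z|)))).
  by rewrite ler_pM2l// ler_pM2l//; exact: hD.
by rewrite le_eqVlt; apply/orP; left; apply/eqP; field; rewrite !gt_eqF.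
Qed.

Variables (psi : M -> M) (psi_C1 : is_C1_map A psi).

Lemma iter_continuous n : continuous (iter n psi).
Proof.
elim: n => [|n IH] z; first exact: cvg_id.
by apply: (@continuous_comp _ _ _ (iter n psi) psi); [exact: IH|exact: (proj1 psi_C1)].
Qed.

(** A strict derivative is unique and equals [tangent_map], so the chain rule for tangent maps
    follows from the composition of strict derivatives. *)
Lemma strict_diff_iter n z :
  strict_diff (iter n psi) z (tangent_map A (iter n psi) z) /\
  tangent_map A (iter n.+1 psi) z =
    tangent_map A (iter n psi) z *m tangent_map A psi (iter n psi z).
Proof.
have step m : strict_diff (iter m psi) z (tangent_map A (iter m psi) z) ->
    strict_diff (iter m.+1 psi) z
      (tangent_map A (iter m psi) z *m tangent_map A psi (iter m psi z)).
  move=> h; have -> : iter m.+1 psi = psi \o iter m psi by apply/funext.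
  have c : {for z, continuous (iter m psi)} by exact: iter_continuous.
  exact (strict_diff_comp c h (strict_diff_C1 (iter m psi z) psi_C1)).
have sd m : strict_diff (iter m psi) z (tangent_map A (iter m psi) z).
  elim: m => [|m IH]; last first.
    by have h := step m IH; rewrite (strict_diff_tangent_map h).
  by rewrite (strict_diff_tangent_map (strict_diff_id z)); exact: strict_diff_id.
by split => //; apply: strict_diff_tangent_map; exact: step.
Qed.

End TangentMaps.

(** * Expanding dynamics *)

Lemma exists_choice (T U : Type) (P : T -> U -> Prop) :
  (forall x, exists y, P x y) -> exists f, forall x, P x (f x).
Proof. by move=> h; have [f hf] := choice h; exists f. Qed.

Lemma exprn_unbounded (R : realType) (lam K : R) : 1 < lam ->
  exists N0, forall N, (N0 <= N)%N -> K <= lam ^+ N.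
Proof.
move=> lam1; have l0 : 0 < lam - 1 by rewrite subr_gt0.
have bern n : n%:R * (lam - 1) <= lam ^+ n.
  elim: n => [|n IH]; first by rewrite mul0r expr0 ler01.
  have e1 : 1 <= lam ^+ n by rewrite exprn_ege1// ltW.
  have : (lam - 1) * 1 <= (lam - 1) * lam ^+ n by rewrite ler_pM2l.
  rewrite exprS -natr1; lra.
exists (Num.truncn (K / (lam - 1))).+1 => N hN; apply: le_trans (bern N).
rewrite -ler_pdivrMr//; apply: ltW; apply: lt_le_trans (truncnS_gt _) _.
by rewrite ler_nat.
Qed.

Section ExpandingDynamics.
Context {R : realType} {d : nat} {M : topologicalType}.

(** Compactness in its near-covering form, applied to the filter of finite lists of points of [K]
    directed by inclusion. *)
Lemma compact_finite_subcover (K : set M) (U : M -> set M) : compact K ->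
  (forall z, K z -> nbhs z (U z)) ->
  exists s : seq M, (forall z, z \in s -> K z) /\
    forall x, K x -> exists2 z, z \in s & U z x.
Proof.
move=> Kc nU.
pose F : set_system (seq M) := [set Q | exists s0 : seq M,
  (forall z, z \in s0 -> K z) /\
  forall s : seq M, {subset s0 <= s} -> (forall z, z \in s -> K z) -> Q s].
have FF : Filter F.
  split.
  - by exists [::].
  - move=> P Q [s1 [K1 h1]] [s2 [K2 h2]]; exists (s1 ++ s2); split.
      by move=> z; rewrite mem_cat => /orP[/K1|/K2].
    move=> s ss Ks; split; [apply: h1|apply: h2] => // z zs; apply: ss;
      by rewrite mem_cat zs ?orbT.
  - by move=> P Q PQ [s1 [K1 h1]]; exists s1; split => // s ss Ks; apply: PQ; exact: h1.
have := (compact_near_coveringP K).1 Kc _ F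
  (fun s x => exists2 z, z \in s & U z x) FF.
case=> [x Kx|s [Ks h]]; last first.
  by exists s; split => // x Kx; exact: h.
exists (U x, [set s : seq M | x \in s]) => /=.
  split; first exact: nU.
  exists [:: x]; split=> [z|s ss _]; first by rewrite inE => /eqP ->.
  by apply: ss; rewrite inE.
by move=> [y s] /= [Uy xs]; exists x.
Qed.

Lemma finite_lower_bound (T : eqType) (e : T -> R) (s : seq T) :
  (forall z, z \in s -> 0 < e z) ->
  exists2 e0, 0 < e0 & forall z, z \in s -> e0 <= e z.
Proof.
elim: s => [|a s IH] es; first by exists 1.
have [|e0 e00 he] := IH; first by move=> z zs; apply: es; rewrite in_cons zs orbT.
exists (Num.min e0 (e a)) => [|z].
  by rewrite lt_min e00 es// mem_head.
rewrite in_cons => /orP[/eqP ->|zs]; first by rewrite ge_min lexx orbT.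
by rewrite ge_min he.
Qed.

Lemma finite_upper_bound (T : eqType) (e : T -> R) (s : seq T) :
  exists2 e0, 1 <= e0 & forall z, z \in s -> e z <= e0.
Proof.
elim: s => [|a s [e0 e00 he]]; first by exists 1.
exists (Num.max e0 (e a)) => [|z]; first by rewrite le_max e00.
rewrite in_cons => /orP[/eqP ->|zs]; first by rewrite le_max lexx orbT.
by rewrite le_max he.
Qed.

Hypothesis M_hausdorff : hausdorff_space M.
Variables (A : smooth_atlas R d M) (g : riemannian_metric A).

Local Notation rho := (riemannian_dist g).

Lemma riemannian_dist_refl x : (rho x x <= 0%:E)%E.
Proof.
have [r gr] := good_radius_exists g x.
have bx := chart_ball_center g x (proj1 gr).
apply: le_trans (line_dist_le gr bx bx) _.
by rewrite /chart_dist subrr tangent_normE nrm0 mulr0.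
Qed.

(** With D the chart distance, D < 2r/9. If s <= 2D, then r/9 + 2s < r/9 + 8r/9 = r and the
    comparison of distances applies; if s > 2D, nothing is to be shown. *)
Lemma chart_dist_le_small z r x y s : good_radius g z r ->
  chart_ball g z (r / 9) x -> chart_ball g z (r / 9) y ->
  (rho x y <= s%:E)%E -> chart_dist g z x y <= 2 * s.
Proof.
move=> gr [dx xr] [dy yr] xys; have r0 := proj1 gr.
have := chart_dist_triangle g z x z y; rewrite (chart_distC g z x z) => h.
have D0 := chart_dist_ge0 g z x y.
have [sD|sD] := leP s (2 * chart_dist g z x y); last by lra.
have [|//] := chart_dist_le_dist M_hausdorff gr dx _ xys; lra.
Qed.

Variables (psi : M -> M) (psi_C1 : is_C1_map A psi).

Lemma strict_diff_lipschitz (z : M) : exists2 C, 0 < C & exists2 U : set M, nbhs z U &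
  forall x y s, U x -> U y -> (rho x y <= s%:E)%E ->
  (rho (psi x) (psi y) <= (C * s)%:E)%E.
Proof.
have [C C0 [U nU hU]] := strict_diff_bound (strict_diff_C1 g z psi_C1).
have [r gr] := good_radius_exists g z.
have [r' gr'] := good_radius_exists g (psi z).
have r0 := proj1 gr; have r0' := proj1 gr'.
exists (4 * C); first by rewrite mulr_gt0.
exists ((U `&` chart_ball g z (r / 9)) `&` psi @^-1` chart_ball g (psi z) r').
  apply: filterI; last by apply: (proj1 psi_C1); exact: chart_ball_nbhs.
  by apply: filterI => //; apply: chart_ball_nbhs; rewrite divr_gt0.
move=> x y s [[Ux xr] xr'] [[Uy yr] yr'] xys.
apply: le_trans (line_dist_le gr' xr' yr') _; rewrite lee_fin.
have := chart_dist_le_small gr xr yr xys; have := hU _ _ Ux Uy.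
move=> h1 h2; have h3 : C * chart_dist g z x y <= C * (2 * s) by rewrite ler_pM2l.
lra.
Qed.

(** Lipschitz constants for the distance hold on whole neighbourhoods and do not refer to charts, so
    they bound the derivative at all points nearby. In [4 * C + 1], the 4 pays for two conversions
    between distance and chart, and the 1 for the error in differentiability. *)
Lemma derivative_le (z : M) C (U : set M) : 0 < C -> nbhs z U ->
  (forall y s, U y -> (rho z y <= s%:E)%E -> (rho (psi z) (psi y) <= (C * s)%:E)%E) ->
  forall v, tangent_norm g (psi z) (v *m tangent_map A psi z) <=
    (4 * C + 1) * tangent_norm g z v.
Proof.
move=> C0 nU hU v; have Gp := gram_posdef g z.
have [->|v0] := eqVneq v 0; first by rewrite mul0mx !tangent_normE !nrm0 mulr0.
have nv := nrm_gt0 Gp v0.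
have [V nV hV] := strict_diff_C1 g z psi_C1 ltr01.
have [r gr] := good_radius_exists g z.
have [r' gr'] := good_radius_exists g (psi z).
have r0 := proj1 gr; have r0' := proj1 gr'.
have r90 : 0 < r' / 9 by rewrite divr_gt0.
pose W := (U `&` V) `&` (chart_ball g z r `&` psi @^-1` chart_ball g (psi z) (r' / 9)).
have nW : nbhs z W.
  apply: filterI; first exact: filterI.
  apply: filterI; first exact: chart_ball_nbhs.
  by apply: (proj1 psi_C1); exact: chart_ball_nbhs.
pose ch := chart_of A z; have zd : chart_dom ch z by exact: chart_of_dom.
have zi : (ch @` chart_dom ch) (ch z) by exists z.
have h1 : nbhs (ch z) (ch @` chart_dom ch).
  by apply: open_nbhs_nbhs; split; [exact: chart_cod_open|].
have h2 : nbhs (ch z) (chart_inv ch @^-1` W).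
  by apply: (chart_inv_continuous zi); rewrite chart_mapK.
have [e /= e0 he] := (nbhs_ballP _ _).1 (filterI h1 h2).
have nv1 : 0 < `|v| by rewrite normr_gt0.
pose t := e / (2 * `|v|); have t0 : 0 < t by rewrite divr_gt0// mulr_gt0.
have [[y yd yE] Wy] : (ch @` chart_dom ch `&` chart_inv ch @^-1` W) (ch z + t *: v).
  apply: he; rewrite -ball_normE /= opprD addrA subrr sub0r normrN normrZ gtr0_norm//.
  rewrite /t invfM mulrA mulfVK ?gt_eqF//; lra.
rewrite -yE /= chart_mapK// in Wy.
have [[Uy Vy] [yr yr']] := Wy; have [_ [zr zr']] := nbhs_singleton nW.
have De : chart_diff A z z y = t *: v.
  by rewrite /chart_diff -/ch yE addrC addKr.
have dzy : chart_dist g z z y = t * tangent_norm g z v.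
  by rewrite chart_distE De nrmZ gtr0_norm.
have [_ _] := hV _ _ (nbhs_singleton nV) Vy.
rewrite De dzy mul1r -scalemxAl.
set w := v *m _; set b := chart_diff _ _ _ _ => hb.
have k1 := hU _ _ Uy (line_dist_le gr zr yr).
have k2 := chart_dist_le_small gr' zr' yr' k1; rewrite chart_distE -/b dzy in k2.
have k3 : t * tangent_norm g (psi z) w <= nrm (gram_at g (psi z)) b + t * tangent_norm g z v.
  rewrite -{1}(gtr0_norm t0) -nrmZ -[t *: w](subKr b).
  apply: le_trans (nrmD _ _ (gram_posdef g _)) _; rewrite nrmN lerD2l //.
rewrite -(ler_pM2l t0); lra.
Qed.

Variables (Lam : set M).
Hypotheses (Lam_compact : compact Lam) (Lam_inv : forall z, Lam z -> Lam (psi z)).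

Lemma iter_inv n z : Lam z -> Lam (iter n psi z).
Proof. by elim: n => //= n IH /IH; exact: Lam_inv. Qed.

Lemma tangent_map_bounded : exists2 L, 1 <= L & forall z v, Lam z ->
  tangent_norm g (psi z) (v *m tangent_map A psi z) <= L * tangent_norm g z v.
Proof.
have /exists_choice[C] : forall z : M, exists C : R, exists U : set M, [/\ 0 < C, open_nbhs z U &
   forall x y s, U x -> U y -> (rho x y <= s%:E)%E ->
  (rho (psi x) (psi y) <= (C * s)%:E)%E].
  move=> z; have [C C0 [U nU hU]] := strict_diff_lipschitz z.
  exists C, U°; split => //.
    by split; [exact: open_interior|exact: nU].
  by move=> x y s /interior_subset ? /interior_subset ?; exact: hU.
move=> /exists_choice[U hCU].
have [|s [Ks hs]] := compact_finite_subcover (U := U) Lam_compact.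
  by move=> z _; have [_ ? _] := hCU z; exact: open_nbhs_nbhs.
have [L L1 hL] := finite_upper_bound (fun z => 4 * C z + 1) s.
exists L => // x v Lx; have [z zs Ux] := hs _ Lx.
have [C0 [oU _] h] := hCU z.
apply: (@le_trans _ _ ((4 * C z + 1) * tangent_norm g x v)).
  apply: (@derivative_le _ _ (U z)) => //; first exact: open_nbhs_nbhs.
  by move=> y t; exact: h.
by rewrite ler_wpM2r ?nrm_ge0// hL.
Qed.

(** Expansion is assumed for some metric, while distances are taken for [g]. Near a centre both
    norms are pulled back to one chart by the same Jacobian, compared there with the metrics at the
    centre, and compactness gives a single constant. *)
Lemma metrics_comparable (k k' : riemannian_metric A) : exists2 C, 1 <= C &
  forall z v, Lam z -> tangent_norm k z v <= C * tangent_norm k' z v.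
Proof.
have /exists_choice[C] : forall z : M, exists C : R, exists U : set M, [/\ 0 < C, nbhs z U &
   forall x v, U x -> tangent_norm k x v <= C * tangent_norm k' x v].
  move=> z; have [r gr] := good_radius_exists k' z.
  have [r' kr] := good_radius_exists k z.
  have [C1 C10 h1] := nrm_le_norm (gram_at k z).
  have [C2 C20 h2] := norm_le_nrm (gram_posdef k' z).
  exists (4 * (C1 * C2)), (chart_ball k' z r `&` chart_ball k z r'); split.
  - by rewrite !mulr_gt0.
  - by apply: filterI; apply: chart_ball_nbhs; [case: gr|case: kr].
  - move=> x v [[dx xr] [_ xr']]; pose i := chart_at A z; pose j := chart_at A x.
    have xj : chart_dom (A j) x by exact: chart_at_dom.
    have tE (m : riemannian_metric A) : tangent_norm m x v =
        nrm (m i (A i x)) (v *m 'J (A i \o chart_inv (A j)) (A j x)).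
      by rewrite tangent_normE nrm_mulmx -metric_transition.
    rewrite !tE; move: (v *m _) => w.
    have [_ /(_ w)[_ k1]] := (proj2 kr) _ xr'.
    have [_ /(_ w)[k2 _]] := (proj2 gr) _ xr.
    have k3 := h1 w; have k4 := h2 w.
    apply: le_trans k1 _; rewrite !tangent_normE in k2 *.
    have : C1 * `|w| <= C1 * (C2 * nrm (gram_at k' z) w) by rewrite ler_pM2l.
    have : C1 * (C2 * nrm (gram_at k' z) w) <= C1 * (C2 * (2 * nrm (k' i (A i x)) w)).
      by rewrite ler_pM2l// ler_pM2l.
    rewrite -/i; lra.
move=> /exists_choice[U hCU].
have [|s [Ks hs]] := compact_finite_subcover (U := U) Lam_compact.
  by move=> z _; have [_ ? _] := hCU z.
have [L L1 hL] := finite_upper_bound C s.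
exists L => // x v Lx; have [z zs Ux] := hs _ Lx.
have [C0 _ h] := hCU z; apply: le_trans (h _ v Ux) _.
by rewrite ler_wpM2r ?nrm_ge0// hL.
Qed.

Lemma tangent_map_id z : tangent_map A (iter 0 psi) z = 1%:M.
Proof. exact: (strict_diff_tangent_map (strict_diff_id g z)). Qed.

(** The rate is iterated in the metric [k] before passing to [g], so the change of metric costs one
    constant independent of n. *)
Lemma expanding_iterates (k : riemannian_metric A) lam : 1 < lam ->
  (forall z v, Lam z ->
    lam * tangent_norm k z v <= tangent_norm k (psi z) (v *m tangent_map A psi z)) ->
  exists2 C, 1 <= C & forall n z v, Lam z ->
    lam ^+ n * tangent_norm g z v
      <= C * tangent_norm g (iter n psi z) (v *m tangent_map A (iter n psi) z).
Proof.
move=> lam1 hk; have lam0 : 0 < lam by exact: lt_trans lam1.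
have kn n z v : Lam z -> lam ^+ n * tangent_norm k z v
    <= tangent_norm k (iter n psi z) (v *m tangent_map A (iter n psi) z).
  move=> Lz; elim: n => [|n IH]; first by rewrite expr0 mul1r tangent_map_id mulmx1.
  have [_ ->] := strict_diff_iter g psi_C1 n z; rewrite mulmxA.
  apply: le_trans (hk _ _ (iter_inv n Lz)).
  by rewrite exprS -mulrA ler_pM2l.
have [C1 C11 h1] := metrics_comparable k g.
have [C2 C21 h2] := metrics_comparable g k.
exists (C2 * C1); first by rewrite -(mulr1 1) ler_pM.
move=> n z v Lz.
apply: (@le_trans _ _ (lam ^+ n * (C2 * tangent_norm k z v))).
  by rewrite ler_pM2l ?exprn_gt0//; exact: h2.
rewrite mulrCA -mulrA ler_wpM2l ?(le_trans ler01)//.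
apply: le_trans (kn n z v Lz) _; apply: h1; exact: iter_inv.
Qed.

Lemma bounded_iterates L : 1 <= L ->
  (forall z v, Lam z ->
    tangent_norm g (psi z) (v *m tangent_map A psi z) <= L * tangent_norm g z v) ->
  forall n z v, Lam z ->
    tangent_norm g (iter n psi z) (v *m tangent_map A (iter n psi) z)
      <= L ^+ n * tangent_norm g z v.
Proof.
move=> L1 hL n z v Lz; elim: n => [|n IH].
  by rewrite expr0 mul1r tangent_map_id mulmx1.
have [_ ->] := strict_diff_iter g psi_C1 n z; rewrite mulmxA.
apply: le_trans (hL _ _ (iter_inv n Lz)) _.
by rewrite exprS -mulrA ler_pM2l// (lt_le_trans ltr01).
Qed.

Lemma chart_ball_in_nbhs (z : M) (U : set M) : nbhs z U ->
  exists2 q, 0 < q & chart_ball g z q `<=` U.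
Proof.
move=> nU; pose ch := chart_of A z; have zd : chart_dom ch z by exact: chart_of_dom.
have zi : (ch @` chart_dom ch) (ch z) by exists z.
have h2 : nbhs (ch z) (chart_inv ch @^-1` U).
  by apply: (chart_inv_continuous zi); rewrite chart_mapK.
have [e /= e0 he] := (nbhs_ballP _ _).1 h2.
have [C C0 hC] := norm_le_nrm (gram_posdef g z).
exists (e / C) => [|x [dx xr]]; first by rewrite divr_gt0.
rewrite -(chart_mapK dx); apply: he; rewrite -ball_normE /= distrC.
by apply: le_lt_trans (hC _) _; rewrite mulrC -ltr_pdivlMr.
Qed.

(** If D is the chart distance of x and y, then 16 D <= 2 s + D: the images are at chart distance at
    most 2 s, and the error in differentiability is at most D. Hence the distance, at most 2 D, is
    below s / 2. The bound 1/4 on the radius makes distances within the ball at most 1. *)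
Lemma expansion_near N z : Lam z ->
  (forall v, 16 * tangent_norm g z v <=
    tangent_norm g (iter N psi z) (v *m tangent_map A (iter N psi) z)) ->
  exists2 r, good_radius g z r & [/\ r <= 1 / 4,
    forall x y s, chart_ball g z r x -> chart_ball g z r y ->
      (rho (iter N psi x) (iter N psi y) <= s%:E)%E -> (rho x y <= (s / 2)%:E)%E &
    forall x y s, chart_ball g z r x -> chart_ball g z r y ->
      (rho x y <= s%:E)%E -> chart_dist g z x y <= 2 * s].
Proof.
move=> Lz ex; have [sd _] := strict_diff_iter g psi_C1 N z.
have [U nU hU] := sd 1 ltr01.
have [r gr] := good_radius_exists g z.
have [r' gr'] := good_radius_exists g (iter N psi z).
have r0 := proj1 gr; have r0' := proj1 gr'.
have nW : nbhs z (U `&` iter N psi @^-1` chart_ball g (iter N psi z) (r' / 9)).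
  apply: filterI => //; apply: (iter_continuous psi_C1).
  by apply: chart_ball_nbhs; rewrite divr_gt0.
have [q q0 hq] := chart_ball_in_nbhs nW.
pose m := Num.min (Num.min q (r / 9)) (1 / 4).
have m0 : 0 < m by rewrite !lt_min q0 !divr_gt0.
have mq : m <= q by rewrite /m !ge_min lexx.
have mr : m <= r / 9 by rewrite /m !ge_min lexx orbT.
have m1 : m <= 1 / 4 by rewrite /m ge_min lexx orbT.
have sub b x : m <= b -> chart_ball g z m x -> chart_ball g z b x.
  by move=> mb [dx xm]; split => //; exact: lt_le_trans xm mb.
have mr' : m <= r by lra.
exists m; first exact: good_radius_le mr' gr.
split => // x y s xm ym.
- move=> xys; have [Ux Ix] := hq _ (sub _ _ mq xm); have [Uy Iy] := hq _ (sub _ _ mq ym).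
  have k1 := chart_dist_le_small gr' Ix Iy xys.
  have [_ _] := hU _ _ Ux Uy; rewrite mul1r => k2.
  have k3 := ex (chart_diff A z x y); rewrite -/(chart_dist g z x y) in k3.
  apply: le_trans (line_dist_le gr (sub _ _ mr' xm) (sub _ _ mr' ym)) _.
  rewrite lee_fin; move: k1 k2 k3; rewrite chart_distE.
  set w := chart_diff A z x y *m _; set b := chart_diff _ _ _ _ => k1 k2 k3.
  have : nrm (gram_at g (iter N psi z)) w <=
      nrm (gram_at g (iter N psi z)) b + chart_dist g z x y.
    rewrite -[w](subKr b); apply: le_trans (nrmD _ _ (gram_posdef g _)) _.
    by rewrite nrmN lerD2l.
  have := chart_dist_ge0 g z x y.
  rewrite !tangent_normE in k1 k2 k3 *.
  lra.
- by move=> xys; apply: (chart_dist_le_small gr _ _ xys); exact: sub.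
Qed.

(** [e0] is a Lebesgue number for two successive displacements, from x to y and from y to y'. Later
    y is an iterate of a net point and y' one of a point near it. *)
Lemma expanding_cover (k : riemannian_metric A) lam : 1 < lam ->
  (forall z v, Lam z ->
    lam * tangent_norm k z v <= tangent_norm k (psi z) (v *m tangent_map A psi z)) ->
  exists N p (W : 'I_p -> set M) e0, [/\ (0 < N)%N, 0 < e0,
    forall i x y, W i x -> W i y -> (rho x y <= 1%:E)%E,
    (forall i x y s, W i x -> W i y ->
      (rho (iter N psi x) (iter N psi y) <= s%:E)%E -> (rho x y <= (s / 2)%:E)%E) /\
    (forall i x y s, W i x -> W i y -> (rho x y <= s%:E)%E ->
      (rho y x <= (4 * s)%:E)%E) &
    forall x, Lam x -> exists i, W i x /\ forall y y', (rho x y <= e0%:E)%E ->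
      (rho y y' <= e0%:E)%E -> W i y /\ W i y'].
Proof.
move=> lam1 hk; have [C C1 hC] := expanding_iterates lam1 hk.
have C0 : 0 < C by exact: lt_le_trans C1.
have [N N0 hN] : exists2 N, (0 < N)%N & 16 * C <= lam ^+ N.
  have [N0 hN0] := exprn_unbounded (16 * C) lam1.
  by exists N0.+1 => //; apply: hN0.
have /exists_choice[r hr] : forall z : M, exists r : R, Lam z -> good_radius g z r /\
   [/\ r <= 1 / 4,
    forall x y s, chart_ball g z r x -> chart_ball g z r y ->
      (rho (iter N psi x) (iter N psi y) <= s%:E)%E -> (rho x y <= (s / 2)%:E)%E &
    forall x y s, chart_ball g z r x -> chart_ball g z r y ->
      (rho x y <= s%:E)%E -> chart_dist g z x y <= 2 * s].
  move=> z; have [Lz|nLz] := pselect (Lam z); last by exists 0.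
  have [v|r gr hr] := @expansion_near N z Lz; last by exists r.
  rewrite -(ler_pM2l C0) mulrA (mulrC C) .
  apply: le_trans (hC N z v Lz); rewrite ler_wpM2r ?nrm_ge0//.
have [|s [Ks hs]] := compact_finite_subcover (U := fun z => chart_ball g z (r z / 3)) Lam_compact.
  by move=> z /hr[[r0 _] _]; apply: chart_ball_nbhs; rewrite divr_gt0.
(* A point of the ball of radius r/3 is displaced twice by at most r/7, each displacement counting
   twice in the chart: 1/3 + 4/7 < 1. *)
have [|e e0 he] := finite_lower_bound (e := fun z => r z / 7) (s := s).
  by move=> z /Ks/hr[[r0 _] _]; rewrite divr_gt0.
exists N, (size s), (fun i => let z := tnth (in_tuple s) i in chart_ball g z (r z)), e.
have sK i : Lam (tnth (in_tuple s) i) by apply: Ks; exact: mem_tnth.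
split => //.
- move=> i x y xW yW; have [gr [r1 _ _]] := hr _ (sK i).
  apply: le_trans (line_dist_le gr xW yW) _; rewrite lee_fin.
  have := chart_dist_triangle g (tnth (in_tuple s) i) x (tnth (in_tuple s) i) y.
  rewrite (chart_distC g _ x (tnth _ _)); case: xW => _; case: yW => _; lra.
- split => i x y t xW yW xyt; have [gr [r1 h1 h2]] := hr _ (sK i).
    exact: h1 xyt.
  apply: le_trans (line_dist_le gr yW xW) _; rewrite lee_fin chart_distC.
  by have := h2 _ _ _ xW yW xyt; lra.
- move=> x /hs[z zs [dx xz]].
  have zi : (index z s < size s)%N by rewrite index_mem.
  exists (Ordinal zi); rewrite /= (tnth_nth z) /= nth_index//.
  have [gr [r1 _ _]] := hr _ (Ks _ zs); have r0 := proj1 gr.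
  have ez := he _ zs; split; first by split => //; lra.
  move=> y y' xy yy'.
  have [|[dy yz] xyd] := chart_dist_le_dist M_hausdorff gr dx _ xy; first by lra.
  have tr := chart_dist_triangle g z z x y.
  have [|y'W _] := chart_dist_le_dist M_hausdorff gr dy _ yy'; first by lra.
  by [].
Qed.

End ExpandingDynamics.

(** * Coverings *)

Section BoxColoring.
Context {R : realType}.

Lemma truncn_dist_lt1 (x y : R) : 0 <= x -> 0 <= y ->
  Num.truncn x = Num.truncn y -> `|x - y| <= 1.
Proof.
move=> x0 y0 xy; have /andP[x1 x2] := truncn_itv x0; have /andP[y1 y2] := truncn_itv y0.
by rewrite ler_norml; move: x1 x2; rewrite xy -natr1; move: y2; rewrite -natr1; lra.
Qed.

(** The interval [-b, b] is cut into n pieces; its right endpoint takes the extra colour. *)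
Lemma interval_coloring (b : R) (n : nat) : 0 < b -> (0 < n)%N ->
  exists f : R -> 'I_n.+1, forall x y, `|x| <= b -> `|y| <= b -> f x = f y ->
    `|x - y| <= 2 * b / n%:R.
Proof.
move=> b0 n0; pose h x := (x + b) * n%:R / (2 * b).
have nR : 0 < n%:R :> R by rewrite ltr0n.
have hb x : `|x| <= b -> 0 <= h x /\ (Num.truncn (h x) < n.+1)%N.
  rewrite ler_norml => /andP[x1 x2].
  have h0 : 0 <= h x by rewrite divr_ge0 ?mulr_ge0//; lra.
  split => //; rewrite ltnS truncn_le_nat; apply: (@le_lt_trans _ _ n%:R).
    rewrite ler_pdivrMr ?mulr_gt0// mulrC ler_pM2l//; lra.
  by rewrite ltr_nat.
exists (fun x => inord (Num.truncn (h x))) => x y /hb[x0 xn] /hb[y0 yn] /(congr1 val).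
rewrite /= !inordK// => /(truncn_dist_lt1 x0 y0).
have -> : h x - h y = (x - y) * (n%:R / (2 * b)) by rewrite /h; field; rewrite gt_eqF.
rewrite normrM [`|n%:R / _|]gtr0_norm ?divr_gt0 ?mulr_gt0//.
by rewrite -ler_pdivlMr ?divr_gt0 ?mulr_gt0// mul1r invf_div.
Qed.

(** In the singular basis, the i-th coordinate is cut into about K a_i / a_k pieces, so that every
    side has image of length at most 2 r a_k / K. The number of colours per coordinate is at most K
    + 2, times a_i / a_k when i < k. *)
Lemma singular_box_coloring d (G H T : 'M[R]_d) (k : nat) (r K : R)
    (a := singular_values G H T) :
  posdef G -> posdef H -> (k < d)%N -> 0 < a`_k -> 0 < r -> 0 < K ->
  exists (C : finType) (f : 'rV[R]_d -> C),
    #|C|%:R <= (K + 2) ^+ d * \prod_(j < k) (a`_j / a`_k) /\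
    forall w w', nrm G w <= r -> nrm G w' <= r -> f w = f w' ->
      nrm H ((w - w') *m T) <= d%:R * (2 * r * a`_k / K).
Proof.
move=> Gp Hp kd ak0 r0 K0.
have [sa oa /allP pa [e [eo ea ev]]] := singular_valuesP T Gp Hp; rewrite -/a in sa oa pa ea.
have a0 j : 0 <= a`_j.
  have [jd|dj] := ltnP j d; last by rewrite nth_default// sa.
  by apply: pa; rewrite mem_nth// sa.
have amon i j : (i <= j)%N -> (j < d)%N -> a`_j <= a`_i.
  by move=> ij jd; have := sorted_leq_nth ge_trans ge_refl 0 oa; apply;
    rewrite ?inE ?sa// (leq_ltn_trans ij).
pose n (i : 'I_d) := (Num.truncn (K * a`_i / a`_k)).+1.
have nr (i : 'I_d) : K * a`_i / a`_k <= (n i)%:R by exact: ltW (truncnS_gt _).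
have /fin_all_exists[f hf] : forall i : 'I_d, exists f : R -> 'I_(n i).+1, forall x y,
    `|x| <= r -> `|y| <= r -> f x = f y -> `|x - y| <= 2 * r / (n i)%:R.
  by move=> i; exact: interval_coloring.
exists {dffun forall i : 'I_d, 'I_(n i).+1}.
exists (fun w => [ffun i => f i (bil G w (e i))]); split.
  rewrite card_dep_ffun foldrE big_image /= natr_prod.
  apply: (@le_trans _ _ (\prod_(i < d) ((K + 2) * (if (i < k)%N then a`_i / a`_k else 1)))).
    apply: ler_prod => i _; rewrite ler0n /= card_ord /n -natr1 -natr1.
    have xk : 0 <= K * a`_i / a`_k by rewrite divr_ge0 ?mulr_ge0// ltW.
    have /andP[h1 _] := truncn_itv xk.
    apply: le_trans (_ : K * (a`_i / a`_k) + 2 <= _).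
      by move: h1; rewrite mulrA; lra.
    case: ltnP => ik.
      have : 1 <= a`_i / a`_k by rewrite ler_pdivlMr// mul1r amon// ltnW.
      lra.
    have : a`_i / a`_k <= 1 by rewrite ler_pdivrMr// mul1r amon.
    by rewrite -(ler_pM2l K0); lra.
  rewrite big_split /= prodr_const card_ord ler_pM2l ?exprn_gt0 ?addr_gt0//.
  rewrite -big_mkcond /= le_eqVlt; apply/orP; left; apply/eqP.
  by rewrite (big_ord_widen_cond d xpredT (fun j => a`_j / a`_k) (ltnW kd)).
move=> w w' wr w'r /ffunP ff.
have xb u i : nrm G u <= r -> `|bil G u (e i)| <= r.
  move=> ur; have e1 : nrm G (e i) = 1 by rewrite /nrm eo eqxx sqrtr1.
  rewrite ler_norml; apply/andP; split; last first.
    by apply: le_trans (bil_CS _ _ Gp) _; rewrite e1 mulr1.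
  rewrite lerNl -bilNl; apply: le_trans (bil_CS _ _ Gp) _.
  by rewrite e1 mulr1 nrmN.
have xd i : `|bil G (w - w') (e i)| <= 2 * r / (n i)%:R.
  rewrite bilDl bilNl; apply: hf; [exact: xb|exact: xb|].
  by have := ff i; rewrite !ffunE.
rewrite (ev (w - w')) mulmx_suml.
apply: le_trans (nrm_sum _ Hp) _; apply: sum_le_const => i.
rewrite -scalemxAl nrmZ ea.
apply: (@le_trans _ _ (2 * r / (n i)%:R * a`_i)); first by rewrite ler_wpM2r.
have h : a`_i <= a`_k / K * (n i)%:R.
  have := nr i; rewrite ler_pdivrMr// => h; rewrite -(ler_pM2l K0).
  apply: le_trans h _; rewrite le_eqVlt; apply/orP; left; apply/eqP; field.
  by rewrite gt_eqF.
have n0 : 0 < (n i)%:R :> R by rewrite ltr0n.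
rewrite mulrAC ler_pdivrMr// (_ : _ / K * _ = 2 * r * (a`_k / K * (n i)%:R)).
  by rewrite ler_pM2l// mulr_gt0.
by field; rewrite gt_eqF.
Qed.

End BoxColoring.

(** * Coverings by sets of small diameter *)

Section Coverings.
Context {R : realType} {d : nat} {M : topologicalType}.
Variables (dist : M -> M -> \bar R).

Definition covered (S : set M) (n : nat) (delta : R) := exists U : 'I_n -> set M,
  S `<=` \bigcup_i U i /\ forall i x y, U i x -> U i y -> (dist x y <= delta%:E)%E.

Lemma covered_fin (T : finType) (U : T -> set M) S delta :
  S `<=` \bigcup_i U i ->
  (forall i x y, U i x -> U i y -> (dist x y <= delta%:E)%E) -> covered S #|T| delta.
Proof.
move=> SU hU; exists (fun i => U (enum_val i)); split; last by move=> i; exact: hU.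
by move=> x /SU[i _ Ux]; exists (enum_rank i); rewrite // enum_rankK.
Qed.

Lemma covered_coloring (T : finType) (f : M -> T) (S : set M) delta :
  (forall x y, S x -> S y -> f x = f y -> (dist x y <= delta%:E)%E) ->
  covered S #|T| delta.
Proof.
move=> h; apply: (@covered_fin T (fun i => S `&` f @^-1` [set i])).
  by move=> x Sx; exists (f x).
by move=> i x y [Sx /= fx] [Sy /= fy]; apply: h => //; rewrite fx fy.
Qed.

Lemma covered_le S n delta delta' : delta <= delta' -> covered S n delta ->
  covered S n delta'.
Proof.
move=> dd [U [SU hU]]; exists U; split => // i x y Ux Uy.
by apply: le_trans (hU i x y Ux Uy) _; rewrite lee_fin.
Qed.

Lemma covered_bigcup (I : finType) (S : set M) (V : I -> set M) (n : I -> nat) delta :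
  S `<=` \bigcup_i V i -> (forall i, covered (V i) (n i) delta) ->
  covered S (\sum_i n i) delta.
Proof.
move=> SV /fin_all_exists[U hU].
have -> : (\sum_i n i)%N = #|{: {i : I & 'I_(n i)}}|.
  by rewrite card_tagged sumnE big_map big_enum; apply: eq_bigr => i _; rewrite card_ord.
apply: (@covered_fin {i : I & 'I_(n i)} (fun t => U (tag t) (tagged t))).
  move=> x /SV[i _ Vx]; have [j _ Ux] := (hU i).1 _ Vx.
  by exists (Tagged (fun i => 'I_(n i)) j).
by move=> t x y; apply: (hU _).2.
Qed.

Lemma covered_widen S n n' delta : (n <= n')%N -> covered S n delta -> covered S n' delta.
Proof.
move=> nn [U [SU hU]].
exists (fun i : 'I_n' => [set x | exists j : 'I_n, j = i :> nat /\ U j x]); split.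
  move=> x /SU[j _ Ux]; exists (widen_ord nn j) => //.
  by exists j.
move=> i x y [j [ji Ux]] [j' [ji' Uy]]; apply: (hU j) => //.
by have -> : j = j' by apply: val_inj; rewrite /= ji ji'.
Qed.

Lemma covering_number_le S n delta : covered S n delta ->
  (covering_number dist S delta <= (n%:R)%:E)%E.
Proof. by move=> c; apply: ereal_inf_lbound; exists n. Qed.

End Coverings.

Section LocalCovering.
Context {R : realType} {d : nat} {M : topologicalType}.
Hypothesis M_hausdorff : hausdorff_space M.
Variables (A : smooth_atlas R d M) (g : riemannian_metric A).
Variables (psi : M -> M) (psi_C1 : is_C1_map A psi).

Local Notation rho := (riemannian_dist g).

Definition inverse_branch_singular_values m z := singular_values
  (gram_at g (iter m psi z)) (gram_at g z) (invmx (tangent_map A (iter m psi) z)).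

(* Near [z] the map [psi^m] is close to its derivative [T], so a set whose image
   has diameter [r] is close to the image of a ball of radius [r] under [T^-1],
   an ellipsoid with semi-axes [r a_j]. *)
Lemma local_covering m z (a := inverse_branch_singular_values m z) :
  tangent_map A (iter m psi) z \in unitmx ->
  exists2 r1, 0 < r1 & forall S r k, S `<=` chart_ball g z r1 -> 0 < r ->
    (forall u v, S u -> S v -> (rho (iter m psi u) (iter m psi v) <= r%:E)%E) ->
    (k < d)%N -> 0 < a`_k ->
    exists n, covered rho S n (r * a`_k) /\
      n%:R <= (16 * d%:R + 2) ^+ d * \prod_(j < k) (a`_j / a`_k).
Proof.
set T := tangent_map A (iter m psi) z => Tu.
have [D D0 hD] := mulmx_bounded g (iter m psi z) z (invmx T).
have [sd _] := strict_diff_iter g psi_C1 m z.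
(* After [invmx T], of norm at most [D], the error in differentiability is at most half of the chart
   distance of x and y, and is absorbed on the left. *)
have [|U nU hU] := sd (1 / (2 * D)); first by rewrite divr_gt0// mulr_gt0.
have [r gr] := good_radius_exists g z.
have [r' gr'] := good_radius_exists g (iter m psi z).
have r0 := proj1 gr; have r0' := proj1 gr'.
have nW : nbhs z (U `&` iter m psi @^-1` chart_ball g (iter m psi z) (r' / 9)).
  apply: filterI => //; apply: (iter_continuous psi_C1).
  by apply: chart_ball_nbhs; rewrite divr_gt0.
have [q q0 hq] := chart_ball_in_nbhs g nW.
exists (Num.min q r); first by rewrite lt_min q0.
move=> S s k Ssub s0 hS kd ak0.
have Sq x : S x -> [/\ U x, chart_ball g (iter m psi z) (r' / 9) (iter m psi x) &
    chart_ball g z r x].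
  move=> /Ssub[dx xr]; have [] := hq x.
    by split => //; apply: lt_le_trans xr _; rewrite ge_min lexx.
  split => //; split => //; apply: lt_le_trans xr _; by rewrite ge_min lexx orbT.
have [[x0 Sx0]|S0] := pselect (S !=set0); last first.
  exists 0%N; split; last first.
    rewrite mulr_ge0 ?exprn_ge0 ?addr_ge0 ?mulr_ge0//.
    apply: prodr_ge0 => j _; apply: divr_ge0; last exact: ltW.
    have [sa _ /allP pa _] := singular_valuesP (invmx T)
      (gram_posdef g (iter m psi z)) (gram_posdef g z).
    by apply: pa; apply: mem_nth; rewrite sa (ltn_trans _ kd).
  exists (fun _ => set0); split => // x Sx; exfalso; apply: S0; by exists x.
have d0 : 0 < d%:R :> R by rewrite ltr0n (leq_ltn_trans _ kd).
have s20 : 0 < 2 * s by rewrite mulr_gt0.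
have K0 : 0 < 16 * d%:R :> R by rewrite mulr_gt0.
(* With K = 16 d and radius 2 s, points of one colour have [nrm] of [c] at most s a_k / 4. The
   remaining 4 is spent on absorbing the error and on passing from the chart to the distance. *)
have [C [f [Cn hf]]] := @singular_box_coloring R d _ _ (invmx T) k (2 * s) (16 * d%:R)
  (gram_posdef g (iter m psi z))
  (gram_posdef g z) kd ak0 s20 K0.
exists #|C|; split => //.
pose w x := chart_diff A (iter m psi z) (iter m psi x0) (iter m psi x).
apply: (@covered_coloring _ _ _ C (fun x => f (w x))) => x y Sx Sy fxy.
have [Ux mx xr] := Sq _ Sx; have [Uy my yr] := Sq _ Sy.
have [Ux0 mx0 _] := Sq _ Sx0.
have wb u : S u -> nrm (gram_at g (iter m psi z)) (w u) <= 2 * s.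
  move=> Su; have [_ mu _] := Sq _ Su.
  exact: (chart_dist_le_small M_hausdorff gr' mx0 mu (hS _ _ Sx0 Su)).
have := hf _ _ (wb _ Sx) (wb _ Sy) fxy.
set c := (w x - w y) *m _ => hc.
have [_ _] := hU _ _ Uy Ux; set b := chart_diff A (iter m psi z) _ _.
set e := b - _ *m T => he.
have bw : w x - w y = b by rewrite /w /b /chart_diff opprB addrA subrK.
have cE : chart_diff A z y x = c - e *m invmx T.
  have aux (u v : 'rV[R]_d) : u = v *m invmx T - (v - u *m T) *m invmx T.
    by rewrite mulmxBl mulmxK// opprB addrC subrK.
  by rewrite /c bw; exact: aux.
have h1 : chart_dist g z y x <= nrm (gram_at g z) c + D * (1 / (2 * D) * chart_dist g z y x).
  rewrite {1}chart_distE cE; apply: le_trans (nrmD _ _ (gram_posdef g _)) _.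
  rewrite nrmN lerD2l; apply: le_trans (hD e) _; by rewrite ler_pM2l.
have h2 : chart_dist g z y x <= 2 * nrm (gram_at g z) c.
  move: h1; rewrite (_ : D * _ = chart_dist g z y x / 2); first by lra.
  by field; rewrite gt_eqF.
apply: le_trans (line_dist_le gr xr yr) _; rewrite lee_fin chart_distC.
have : d%:R * (2 * (2 * s) * a`_k / (16 * d%:R)) = s * a`_k / 4.
  by field; rewrite gt_eqF.
by move=> E; rewrite E in hc; lra.
Qed.

End LocalCovering.

(** * The singular value function *)

Section SingularValueFunction.
Context {R : realType}.

(** The exponents c_i with phi^s = prod a_i^(c_i). They are nonnegative for s >= 0, sum to s and
    increase with s, so log phi^s becomes linear in the log a_i and the branches of phi^s are
    treated together. *)
Definition svf_exponent (d : nat) (s : R) (i : nat) : R :=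
  if s <= d%:R then Num.min 1 (Num.max 0 (s - i%:R)) else s / d%:R.

Lemma svf_exponent_le d s t i : (0 < d)%N -> s <= t ->
  svf_exponent d s i <= svf_exponent d t i.
Proof.
move=> d0 st; have dR : 0 < d%:R :> R by rewrite ltr0n.
rewrite /svf_exponent; case: (leP s d%:R) => sd; case: (leP t d%:R) => td.
- have h : s - i%:R <= t - i%:R by rewrite lerD2r.
  move: (s - _) (t - _) h => x y h.
  have hm : Num.max 0 x <= Num.max 0 y.
    by rewrite ge_max !le_max lexx h orbT.
  by rewrite le_min !ge_min lexx hm orbT.
- by rewrite ge_min ler_pdivlMr// mul1r ltW.
- by lra.
- by rewrite ler_pM2r// invr_gt0.
Qed.

Lemma svf_exponent_lt d s i : s <= d%:R -> i%:R + 1 <= s -> svf_exponent d s i = 1.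
Proof.
move=> sd is1; rewrite /svf_exponent sd; have h : 1 <= s - i%:R by lra.
by rewrite max_r ?(le_trans ler01)// min_l.
Qed.

Lemma svf_exponent_gt d s i : s <= d%:R -> s <= i%:R -> svf_exponent d s i = 0.
Proof.
move=> sd is1; rewrite /svf_exponent sd; have h : s - i%:R <= 0 by lra.
by rewrite max_l// min_r.
Qed.

Lemma sum_svf_exponent d s : (0 < d)%N -> 0 <= s -> \sum_(i < d) svf_exponent d s i = s.
Proof.
move=> d0 s0; have dR : 0 < d%:R :> R by rewrite ltr0n.
have [sd|sd] := leP s d%:R; last first.
  rewrite (eq_bigr (fun=> s / d%:R)) => [|i _]; last by rewrite /svf_exponent leNgt sd.
  by rewrite sumr_const card_ord -[LHS]mulr_natr divfK ?gt_eqF.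
rewrite (eq_bigr (fun i : 'I_d => Num.min 1 (Num.max 0 (s - i%:R)))) => [|i _]; last first.
  by rewrite /svf_exponent sd.
have h n : \sum_(i < n) Num.min 1 (Num.max 0 (s - i%:R)) = Num.min s n%:R.
  elim: n => [|n IH]; first by rewrite big_ord0 min_r.
  rewrite big_ord_recr /= IH -natr1; case: (leP s n%:R) => sn.
    have h : s - n%:R <= 0 by lra.
    by rewrite (max_l h) min_r// addr0 min_l//; lra.
  have h : 0 <= s - n%:R by lra.
  rewrite (max_r h); case: (leP 1 (s - n%:R)) => h1; last by rewrite min_l//; lra.
  by rewrite min_r//; lra.
by rewrite h min_l.
Qed.

Lemma ln_prod (I : Type) (r : seq I) (P : pred I) (F : I -> R) :
  (forall i, P i -> 0 < F i) ->
  ln (\prod_(i <- r | P i) F i) = \sum_(i <- r | P i) ln (F i).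
Proof.
move=> F0; suff [] : 0 < \prod_(i <- r | P i) F i /\
  ln (\prod_(i <- r | P i) F i) = \sum_(i <- r | P i) ln (F i) by [].
apply: (big_rec2 (fun x y => 0 < x /\ ln x = y)); first by rewrite ln1.
by move=> i y x Pi [x0 <-]; rewrite mulr_gt0 ?F0// lnM ?posrE ?F0.
Qed.

Section Formula.
Variables (d : nat) (G H T : 'M[R]_d).
Let a := singular_values G H T.
Hypothesis d0 : (0 < d)%N.
Hypothesis a_gt0 : forall i, (i < d)%N -> 0 < a`_i.

Lemma ln_singular_value_function s : 0 <= s ->
  0 < singular_value_function G H s T /\
  ln (singular_value_function G H s T) = \sum_(i < d) svf_exponent d s i * ln a`_i.
Proof.
move=> s0; have dR : 0 < d%:R :> R by rewrite ltr0n.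
have prod_gt0 k : (k <= d)%N -> 0 < \prod_(i < k) a`_i.
  by move=> kd; apply: prodr_gt0 => i _; apply: a_gt0; apply: leq_trans kd.
rewrite /singular_value_function -/a; have [sd|sd] := leP s d%:R; last first.
  split; first by apply: powR_gt0; exact: prod_gt0.
  rewrite ln_powR ln_prod => [|i _]; last exact: a_gt0.
  by rewrite mulr_sumr; apply: eq_bigr => i _; rewrite /svf_exponent leNgt sd.
have /andP[k1 k2] := truncn_itv s0; set k := Num.truncn s in k1 k2 *.
have kd : (k <= d)%N by rewrite -(ler_nat R); lra.
have [kd'|dk] := ltnP k d.
- split; first by rewrite mulr_gt0 ?prod_gt0 ?powR_gt0 ?a_gt0.
  rewrite lnM ?posrE ?prod_gt0 ?powR_gt0 ?a_gt0// ln_powR ln_prod; last first.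
    by move=> i _; apply: a_gt0; apply: leq_trans kd.
  rewrite (bigID (fun i : 'I_d => (i < k.+1)%N)) /=.
  rewrite -(big_ord_widen d (fun i => svf_exponent d s i * ln a`_i) kd') big_ord_recr /=.
  rewrite [X in _ = _ + X]big1 => [|i]; last first.
    rewrite -leqNgt -(ler_nat R) => ki; rewrite svf_exponent_gt ?mul0r//; lra.
  rewrite addr0; congr (_ + _).
    apply: eq_bigr => i _; rewrite svf_exponent_lt ?mul1r//.
    by apply: le_trans k1; rewrite natr1 ler_nat.
  rewrite /svf_exponent sd max_r; last by rewrite subr_ge0.
  by rewrite min_r//; move: k2; rewrite -natr1; lra.
- have ek : k = d by apply/eqP; rewrite eqn_leq kd.
  have es : s = d%:R by apply/eqP; rewrite eq_le sd -ek.
  rewrite ek es subrr powRr0 mulr1; split; first exact: prod_gt0.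
  rewrite ln_prod => [|i _]; last exact: a_gt0.
  apply: eq_bigr => i _; rewrite svf_exponent_lt ?mul1r// natr1 ler_nat.
  exact: ltn_ord.
Qed.

Lemma singular_value_function0 : singular_value_function G H 0 T = 1.
Proof.
by rewrite /singular_value_function ler0n truncn0 big_ord0 subrr powRr0 mulr1.
Qed.

(** The difference is a combination of the log a_i with nonnegative coefficients of sum t. *)
Lemma ln_svf_shift s t l u : 0 <= s -> 0 <= t ->
  (forall i, (i < d)%N -> l <= ln a`_i <= u) ->
  t * l <= ln (singular_value_function G H (s + t) T) - ln (singular_value_function G H s T)
    <= t * u.
Proof.
move=> s0 t0 lu; have st0 := addr_ge0 s0 t0.
rewrite !(ln_singular_value_function _).2// -sumrB.
have tE : t = \sum_(i < d) (svf_exponent d (s + t) i - svf_exponent d s i).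
  by rewrite sumrB !sum_svf_exponent// addrAC subrr add0r.
have c0 (i : 'I_d) : 0 <= svf_exponent d (s + t) i - svf_exponent d s i.
  by rewrite subr_ge0 svf_exponent_le// lerDl.
rewrite {1}tE {4}tE !mulr_suml; apply/andP; split; apply: ler_sum => i _.
  by rewrite -mulrBl ler_wpM2l//; have /andP[] := lu _ (ltn_ord i).
by rewrite -mulrBl ler_wpM2l//; have /andP[] := lu _ (ltn_ord i).
Qed.

(* The left-hand side is the logarithm of the cost of covering an ellipsoid with
   semi-axes [a] by balls of radius [a`_k]. *)
Lemma ln_svf_ge_covering s (k := minn (Num.truncn s) d.-1) : 0 <= s ->
  (forall i j, (i <= j)%N -> (j < d)%N -> a`_j <= a`_i) ->
  \sum_(j < k) (ln a`_j - ln a`_k) + s * ln a`_k <= ln (singular_value_function G H s T).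
Proof.
move=> s0 amon; rewrite (ln_singular_value_function _).2//.
have kd : (k < d)%N by rewrite -(prednK d0) ltnS geq_minr.
have -> : s * ln a`_k = \sum_(i < d) svf_exponent d s i * ln a`_k.
  by rewrite -mulr_suml sum_svf_exponent.
have -> : \sum_(j < k) (ln a`_j - ln a`_k) =
    \sum_(j < d) if (j < k)%N then ln a`_j - ln a`_k else 0.
  by rewrite -big_mkcond /= (big_ord_widen_cond d xpredT (fun j => ln a`_j - ln a`_k) (ltnW kd)).
(* The terms are compared one by one. For i < k the exponent is at least 1 and a_i >= a_k; for i = k
   there is equality; i > k occurs only if k is the integer part of s, and then the exponent is
   0. *)
rewrite -big_split /=; apply: ler_sum => i _.
have lnle x y : (x <= y)%N -> (y < d)%N -> ln a`_y <= ln a`_x.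
  by move=> xy yd; rewrite ler_ln ?posrE ?a_gt0 ?amon// (leq_ltn_trans xy).
case: ltnP => ik.
- have h : 0 <= ln a`_i - ln a`_k by rewrite subr_ge0 lnle// ltnW.
  have c1 : 1 <= svf_exponent d s i.
    have [sd|sd] := leP s d%:R; last by rewrite /svf_exponent [s <= _]leNgt sd ler_pdivlMr ?ltr0n// mul1r ltW.
    rewrite svf_exponent_lt// natr1; have /andP[k1 _] := truncn_itv s0; apply: le_trans k1.
    by rewrite ler_nat; apply: leq_trans ik _; exact: geq_minl.
  set c := svf_exponent d s i in c1 *.
  have : 0 <= (c - 1) * (ln a`_i - ln a`_k) by rewrite mulr_ge0// subr_ge0.
  lra.
- rewrite add0r; have [->//|ki] := eqVneq (i : nat) k.
  have {ki}ik : (k < i)%N by rewrite ltn_neqAle eq_sym ki.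
  have tk : (Num.truncn s <= k)%N.
    have id' : (i <= d.-1)%N by rewrite -ltnS prednK.
    by have := leq_trans ik id'; rewrite /k gtn_min ltnn orbF => /ltnW h; rewrite leq_min leqnn.
  have ss : s <= i%:R.
    have /andP[_ k2] := truncn_itv s0; apply: ltW; apply: lt_le_trans k2 _.
    by rewrite ler_nat; apply: leq_ltn_trans tk ik.
  rewrite svf_exponent_gt ?mul0r//; apply: le_trans ss _; by rewrite ler_nat ltnW.
Qed.

End Formula.

End SingularValueFunction.

(** * The zero of the pressure *)

Section LimSup.
Context {R : realType}.
Implicit Types u : nat -> \bar R.
Local Open Scope ereal_scope.

Lemma limn_esup_le_eventually u (c : \bar R) N :
  (forall n, (N <= n)%N -> u n <= c) -> limn_esup u <= c.
Proof.
move=> h; rewrite /limn_esup limf_esupE.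
apply: (@le_trans _ _ (ereal_sup [set u n | n in [set n | (N <= n)%N]])).
  apply: ereal_inf_lbound; exists [set n | (N <= n)%N] => //.
  by exists N.
by apply: ge_ereal_sup => _ [n /h hn <-].
Qed.

Lemma limn_esup_lt_eventually u (c : \bar R) : limn_esup u < c ->
  exists N, forall n, (N <= n)%N -> u n < c.
Proof.
rewrite /limn_esup limf_esupE => /ereal_inf_lt[_ [V [N _ NV] <-] h].
exists N => n Nn; apply: le_lt_trans h; apply: ereal_sup_ubound.
by exists n => //; exact: NV.
Qed.

End LimSup.

Section PressureZero.
Context {R : realType} {X : topologicalType}.
Variables (K : set X) (dist : X -> X -> \bar R) (f : X -> X).
Variables (g : R -> nat -> X -> R) (q : nat) (l1 l2 C : R).
Hypotheses (K0 : K !=set0) (q0 : (0 < q)%N) (l10 : 0 < l1).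
Hypothesis sep_card : forall eps, 0 < eps -> exists B, forall n E,
  E `<=` K -> Defs.separated dist f n eps E ->
  exists s : seq X, [/\ uniq s, E = [set` s] & (size s <= B * q ^ n)%N].
Hypothesis g0 : forall n x, g 0 n x = 0.
Hypothesis g_le : forall t s n x, 0 <= t -> 0 <= s -> K x ->
  g (t + s) n x - g t n x <= s * (C - n%:R * l1).
Hypothesis g_ge : forall t s n x, 0 <= t -> 0 <= s -> K x ->
  s * (- C - n%:R * l2) <= g (t + s) n x - g t n x.

Let Z t eps n := pressure_sum K dist f (g t) eps n.

Lemma esum_seq (s : seq X) (h : X -> R) : uniq s -> (forall x, 0 <= h x) ->
  \esum_(x in [set` s]) (h x)%:E = (\sum_(x <- s) h x)%:E.
Proof.
move=> us h0; rewrite esum_fset; [|exact: finite_seq|by move=> x _; rewrite lee_fin].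
by rewrite -fsbig_seq// sumEFin.
Qed.

Lemma separated_set1 n eps x : Defs.separated dist f n eps [set x].
Proof. by move=> y z -> ->. Qed.

Lemma pressure_sum_shift_le t t' eps n k : 0 < eps -> 0 <= k ->
  (forall x, K x -> expR (g t' n x) <= k * expR (g t n x)) ->
  (Z t' eps n <= k%:E * Z t eps n)%E.
Proof.
move=> eps0 k0 h; apply: ge_ereal_sup => _ [E [EK Esep] <-].
have [B /(_ n E EK Esep)[s [us Es ss]]] := sep_card eps0.
apply: (@le_trans _ _ (k%:E * \esum_(x in E) (expR (g t n x))%:E)%E).
  rewrite Es !esum_seq//; try by move=> x; exact: expR_ge0.
  rewrite -EFinM lee_fin mulr_sumr big_seq [leRHS]big_seq; apply: ler_sum => x xs.
  by apply: h; apply: EK; rewrite Es.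
rewrite lee_wpmul2l ?lee_fin//; apply: ereal_sup_ubound; by exists E.
Qed.

Lemma pressure_sum0_le eps : 0 < eps -> exists2 B, (0 < B)%N &
  forall n, (Z 0 eps n <= (B%:R * q%:R ^+ n)%:E)%E.
Proof.
move=> eps0; have [B hB] := sep_card eps0.
exists B.+1 => // n; apply: ge_ereal_sup => _ [E [EK Esep] <-].
have [s [us Es ss]] := hB n E EK Esep.
rewrite Es esum_seq//.
rewrite lee_fin (eq_bigr (fun=> 1)) => [|x _]; last by rewrite g0 expR0.
rewrite big_const_seq count_predT iter_addr_0 -natrX -natrM ler_nat.
by apply: leq_trans ss _; rewrite leq_mul2r leqnSn orbT.
Qed.

(** A singleton is separated, so the sum is positive. It is finite by comparison with exponent 0,
    where the potential vanishes and the sum counts points. *)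
Lemma pressure_sum_fin t eps n : 0 < eps -> 0 <= t ->
  exists2 z, 0 < z & Z t eps n = z%:E.
Proof.
move=> eps0 t0; have [B B0 hB] := pressure_sum0_le eps0.
have zpos : (0 < Z t eps n)%E.
  have [x Kx] := K0; apply: (@lt_le_trans _ _ (expR (g t n x))%:E).
    by rewrite lte_fin expR_gt0.
  apply: ereal_sup_ubound; exists [set x]; first split.
  - by move=> y ->.
  - exact: separated_set1.
  - by rewrite esum_set1// lee_fin expR_ge0.
have zfin : (Z t eps n <= (expR (t * (C - n%:R * l1)))%:E * Z 0 eps n)%E.
  apply: (pressure_sum_shift_le eps0 (expR_ge0 _)) => x Kx.
  rewrite -expRD ler_expR.
  by have := g_le n (lexx 0) t0 Kx; rewrite add0r !g0; lra.
have : (Z t eps n <= (expR (t * (C - n%:R * l1)) * (B%:R * q%:R ^+ n))%:E)%E.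
  by apply: le_trans zfin _; rewrite EFinM lee_wpmul2l ?lee_fin ?expR_ge0.
by move: zpos; case: (Z t eps n) => // z z0 _; exists z.
Qed.

Let u t eps n := ((n%:R^-1)%:E * lne (Z t eps n))%E.

Lemma uE t eps n z : 0 < z -> Z t eps n = z%:E -> u t eps n = (n%:R^-1 * ln z)%:E.
Proof. by move=> z0 e; rewrite /u e lne_EFin. Qed.

Lemma ln_pressure_sum_shift t s eps n z z' : 0 < eps -> 0 <= t -> 0 <= s ->
  0 < z -> 0 < z' -> Z t eps n = z%:E -> Z (t + s) eps n = z'%:E ->
  s * (- C - n%:R * l2) <= ln z' - ln z <= s * (C - n%:R * l1).
Proof.
move=> eps0 t0 s0 z0 z'0 ze z'e; apply/andP; split.
- have : (Z t eps n <= (expR (- (s * (- C - n%:R * l2))))%:E * Z (t + s) eps n)%E.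
    apply: (pressure_sum_shift_le eps0 (expR_ge0 _)) => x Kx.
    by rewrite -expRD ler_expR; have := g_ge n t0 s0 Kx; lra.
  rewrite ze z'e -EFinM lee_fin -ler_ln ?posrE ?mulr_gt0 ?expR_gt0//.
  rewrite lnM ?posrE ?expR_gt0// expRK; lra.
- have : (Z (t + s) eps n <= (expR (s * (C - n%:R * l1)))%:E * Z t eps n)%E.
    apply: (pressure_sum_shift_le eps0 (expR_ge0 _)) => x Kx.
    by rewrite -expRD ler_expR; have := g_le n t0 s0 Kx; lra.
  rewrite ze z'e -EFinM lee_fin -ler_ln ?posrE ?mulr_gt0 ?expR_gt0//.
  rewrite lnM ?posrE ?expR_gt0// expRK; lra.
Qed.

Let P t eps := limn_esup (u t eps).

Lemma inv_small (b e : R) : 0 < e -> exists N, forall n, (N <= n)%N ->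
  (0 < n)%N /\ b / n%:R <= e.
Proof.
move=> e0; exists (Num.truncn (b / e)).+1 => n hn.
have n0 : (0 < n)%N by exact: leq_trans hn.
split => //; rewrite ler_pdivrMr ?ltr0n// mulrC -ler_pdivrMr//.
by apply: ltW; apply: lt_le_trans (truncnS_gt _) _; rewrite ler_nat.
Qed.

Lemma le_EFin_all (a : \bar R) (b : R) :
  (forall e, 0 < e -> (a <= (b + e)%:E)%E) -> (a <= b%:E)%E.
Proof.
by move=> h; apply/lee_addgt0Pr => e e0; rewrite -EFinD; exact: h.
Qed.

(** The bound on the logarithms has a constant part s C and a part linear in n; division by n
    removes the former in the limit. The strict bound by a real c spares arithmetic with a possibly
    infinite upper limit. *)
Lemma P_shift_le t s eps (c : R) : 0 < eps -> 0 <= t -> 0 <= s ->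
  (P t eps < c%:E)%E -> (P (t + s) eps <= (c - s * l1)%:E)%E.
Proof.
move=> eps0 t0 s0 /limn_esup_lt_eventually[N hN].
apply: le_EFin_all => e e0.
have [N' hN'] := inv_small (s * C) e0.
apply: (@limn_esup_le_eventually _ _ _ (maxn N N')) => n; rewrite geq_max => /andP[Nn N'n].
have [n0 se] := hN' n N'n.
have [z z0 ze] := pressure_sum_fin n eps0 t0.
have [z' z'0 z'e] := pressure_sum_fin n eps0 (addr_ge0 t0 s0).
have := hN n Nn; rewrite (uE z0 ze) (uE z'0 z'e) lte_fin lee_fin => h.
have /andP[_ h2] := ln_pressure_sum_shift eps0 t0 s0 z0 z'0 ze z'e.
have nR : 0 < n%:R :> R by rewrite ltr0n.
have : n%:R^-1 * (ln z' - ln z) <= n%:R^-1 * (s * (C - n%:R * l1)).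
  by rewrite ler_pM2l// invr_gt0.
have -> : n%:R^-1 * (s * (C - n%:R * l1)) = s * C / n%:R - s * l1.
  by field; rewrite gt_eqF.
lra.
Qed.

Lemma P_shift_ge t s eps (c : R) : 0 < eps -> 0 <= t -> 0 <= s ->
  (P (t + s) eps < c%:E)%E -> (P t eps <= (c + s * l2)%:E)%E.
Proof.
move=> eps0 t0 s0 /limn_esup_lt_eventually[N hN].
apply: le_EFin_all => e e0.
have [N' hN'] := inv_small (s * C) e0.
apply: (@limn_esup_le_eventually _ _ _ (maxn N N')) => n; rewrite geq_max => /andP[Nn N'n].
have [n0 se] := hN' n N'n.
have [z z0 ze] := pressure_sum_fin n eps0 t0.
have [z' z'0 z'e] := pressure_sum_fin n eps0 (addr_ge0 t0 s0).
have := hN n Nn; rewrite (uE z0 ze) (uE z'0 z'e) lte_fin lee_fin => h.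
have /andP[h2 _] := ln_pressure_sum_shift eps0 t0 s0 z0 z'0 ze z'e.
have nR : 0 < n%:R :> R by rewrite ltr0n.
have : n%:R^-1 * (s * (- C - n%:R * l2)) <= n%:R^-1 * (ln z' - ln z).
  by rewrite ler_pM2l// invr_gt0.
have -> : n%:R^-1 * (s * (- C - n%:R * l2)) = - (s * C / n%:R) - s * l2.
  by field; rewrite gt_eqF.
lra.
Qed.

Lemma P0_bounds eps : 0 < eps -> (0 <= P 0 eps <= (ln q%:R)%:E)%E.
Proof.
move=> eps0; apply/andP; split.
- rewrite leNgt; apply/negP => /limn_esup_lt_eventually[N hN].
  have [z z0 ze] := pressure_sum_fin N.+1 eps0 (lexx 0).
  have := hN N.+1 (leqnSn N); rewrite (uE z0 ze) lte_fin ltNge mulr_ge0//.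
  rewrite ln_ge0// -lee_fin -ze; have [x Kx] := K0.
  apply: ereal_sup_ubound; exists [set x]; first split.
  - by move=> y ->.
  - exact: separated_set1.
  - by rewrite esum_set1 ?lee_fin ?expR_ge0// g0 expR0.
- apply: le_EFin_all => e e0; have [B B0 hB] := pressure_sum0_le eps0.
  have [N hN] := inv_small (ln B%:R) e0.
  apply: (@limn_esup_le_eventually _ _ _ N) => n /hN[n0 Bn].
  have [z z0 ze] := pressure_sum_fin n eps0 (lexx 0).
  rewrite (uE z0 ze) lee_fin; have := hB n; rewrite ze lee_fin => zB.
  have nR : 0 < n%:R :> R by rewrite ltr0n.
  have qR : 0 < q%:R :> R by rewrite ltr0n.
  have BR : 0 < B%:R :> R by rewrite ltr0n.
  have : ln z <= ln B%:R + n%:R * ln q%:R.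
    by rewrite mulr_natl -lnXn// -lnM ?posrE ?exprn_gt0// ler_ln ?posrE// mulr_gt0 ?exprn_gt0.
  move=> h; have : n%:R^-1 * ln z <= n%:R^-1 * (ln B%:R + n%:R * ln q%:R).
    by rewrite ler_pM2l// invr_gt0.
  have -> : n%:R^-1 * (ln B%:R + n%:R * ln q%:R) = ln B%:R / n%:R + ln q%:R :> R.
    by field; rewrite gt_eqF.
  lra.
Qed.

Lemma P_anti t eps eps' : 0 <= t -> 0 < eps -> eps <= eps' -> (P t eps' <= P t eps)%E.
Proof.
move=> t0 eps0 ee; have eps'0 : 0 < eps' by exact: lt_le_trans ee.
have ule n : (u t eps' n <= u t eps n)%E.
  have [z z0 ze] := pressure_sum_fin n eps0 t0.
  have [z' z'0 z'e] := pressure_sum_fin n eps'0 t0.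
  rewrite (uE z0 ze) (uE z'0 z'e) lee_fin ler_wpM2l ?invr_ge0// ler_ln ?posrE//.
  rewrite -lee_fin -ze -z'e; apply: ge_ereal_sup => _ [E [EK Esep] <-].
  apply: ereal_sup_ubound; exists E => //; split => // x y Ex Ey xy.
  by apply: le_lt_trans (Esep x y Ex Ey xy); rewrite lee_fin.
rewrite /P /limn_esup !limf_esupE; apply: le_ereal_inf_tmp => _ [V nV <-].
apply: (@le_trans _ _ (ereal_sup [set u t eps' x | x in V])).
  by apply: ereal_inf_lbound; exists V.
apply: ge_ereal_sup => _ [n Vn <-]; apply: le_trans (ule n) _.
by apply: ereal_sup_ubound; exists n.
Qed.

Lemma P_fin t eps : 0 < eps -> 0 <= t ->
  exists2 r, P t eps = r%:E & - (t * l2) <= r <= ln q%:R - t * l1.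
Proof.
move=> eps0 t0; have /andP[h1 h2] := P0_bounds eps0.
have up : (P t eps <= (ln q%:R - t * l1)%:E)%E.
  apply: le_EFin_all => e e0; rewrite addrAC -{1}(add0r t).
  apply: P_shift_le => //; apply: le_lt_trans h2 _; by rewrite lte_fin ltrDl.
have low : ((- (t * l2))%:E <= P t eps)%E.
  rewrite leNgt; apply/negP => h.
  have [c /andP[c1 c2]] : exists c : R, (P t eps < c%:E)%E && (c < - (t * l2)).
    move: h; case: (P t eps) => [r| |]//; last first.
      by move=> _; exists (- (t * l2) - 1); rewrite ltNyr gtrBl ltr01.
    rewrite lte_fin => h; exists ((r - t * l2) / 2).
    by rewrite lte_fin; apply/andP; split; lra.
  have := @P_shift_ge 0 t eps c eps0 (lexx 0) t0; rewrite add0r => /(_ c1).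
  move/(le_trans h1); rewrite lee_fin; lra.
move: low up; case: (P t eps) => // r low up; exists r => //.
by rewrite -!lee_fin low up.
Qed.

(** Lowering eps enlarges the family of separated sets, so the limit at 0 is a supremum. *)
Lemma pressureE t : 0 <= t ->
  pressure K dist f (g t) = ereal_sup [set P t eps | eps in [set eps | 0 < eps]].
Proof.
move=> t0; apply: cvg_lim => //.
have := @nonincreasing_at_right_cvge R (P t) 0 +oo%O isT.
have -> : [set` `]0%R, +oo[%R] = [set eps : R | 0 < eps].
  by apply/seteqP; split => e /=; rewrite in_itv /= andbT.
apply => e e'; rewrite !in_itv /= !andbT => e0 e'0 ee.
exact: P_anti.
Qed.

Lemma pressure_fin t : 0 <= t -> exists2 r, pressure K dist f (g t) = r%:E &
  - (t * l2) <= r <= ln q%:R - t * l1.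
Proof.
move=> t0; rewrite pressureE//.
have h eps : 0 < eps -> ((- (t * l2))%:E <= P t eps <= (ln q%:R - t * l1)%:E)%E.
  by move=> eps0; have [r -> ] := P_fin eps0 t0; rewrite !lee_fin.
set s := ereal_sup _.
have up : (s <= (ln q%:R - t * l1)%:E)%E.
  by apply: ge_ereal_sup => _ [eps /= /h/andP[_ ?] <-].
have low : ((- (t * l2))%:E <= s)%E.
  have /andP[h1 _] := h 1 ltr01; apply: le_trans h1 _.
  by apply: ereal_sup_ubound; exists 1 => //=; exact: ltr01.
by move: low up; case: s => // r low up; exists r; rewrite // -!lee_fin low up.
Qed.

Lemma pressure_shift t s r r' : 0 <= t -> 0 <= s ->
  pressure K dist f (g t) = r%:E -> pressure K dist f (g (t + s)) = r'%:E ->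
  r - s * l2 <= r' <= r - s * l1.
Proof.
move=> t0 s0; have ts0 := addr_ge0 t0 s0; rewrite !pressureE// => re r'e.
have Pr eps : 0 < eps -> (P t eps <= r%:E)%E.
  by move=> eps0; rewrite -re; apply: ereal_sup_ubound; exists eps.
have Pr' eps : 0 < eps -> (P (t + s) eps <= r'%:E)%E.
  by move=> eps0; rewrite -r'e; apply: ereal_sup_ubound; exists eps.
apply/andP; split.
- suff : (r%:E <= (r' + s * l2)%:E)%E by rewrite lee_fin; lra.
  rewrite -re; apply: ge_ereal_sup => _ [eps /= eps0 <-].
  apply: le_EFin_all => e e0; rewrite addrAC; apply: P_shift_ge => //.
  by apply: le_lt_trans (Pr' _ eps0) _; rewrite lte_fin ltrDl.
- suff : (r'%:E <= (r - s * l1)%:E)%E by rewrite lee_fin.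
  rewrite -r'e; apply: ge_ereal_sup => _ [eps /= eps0 <-].
  apply: le_EFin_all => e e0; rewrite addrAC; apply: P_shift_le => //.
  by apply: le_lt_trans (Pr _ eps0) _; rewrite lte_fin ltrDl.
Qed.

(** The pressure decreases with slope between -l2 and -l1, is nonnegative at 0 and negative for
    large t. The bound l2 gives the value 0 at the supremum of the exponents with nonnegative
    pressure; l1 > 0 gives strict signs on both sides. *)
Lemma pressure_zero : exists2 s, 0 <= s /\ pressure K dist f (g s) = 0%E &
  forall t r, 0 <= t -> pressure K dist f (g t) = r%:E ->
    (s < t -> r < 0) /\ (t < s -> 0 < r).
Proof.
pose S := [set t : R | 0 <= t /\ exists2 r, pressure K dist f (g t) = r%:E & 0 <= r].
have S0 : S 0.
  split => //; have [r re rb] := pressure_fin (lexx 0); exists r => //.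
  by move: rb; rewrite !mul0r oppr0 => /andP[].
have Sb t : S t -> t <= ln q%:R / l1.
  move=> [t0 [r re r0]]; have [r' r'e /andP[_ h]] := pressure_fin t0.
  by move: r'e; rewrite re => -[e]; rewrite -e in h; rewrite ler_pdivlMr//; lra.
have Ss : has_sup S by split; [exists 0|exists (ln q%:R / l1) => t /Sb].
pose s := sup S; have s0 : 0 <= s := ub_le_sup (proj2 Ss) S0.
have [r re _] := pressure_fin s0.
(* The slopes between exponents 0 and 1 show l1 <= l2. *)
have l20 : 0 < l2.
  have [r1 r1e _] := @pressure_fin 1 ler01.
  have := @pressure_shift 0 1; rewrite add0r.
  have [r0 r0e _] := @pressure_fin 0 (lexx 0).
  move=> /(_ _ _ (lexx 0) ler01 r0e r1e) /andP[h1 h2]; have h0 := l10; lra.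
have dec t t' rt rt' : 0 <= t -> t <= t' -> pressure K dist f (g t) = rt%:E ->
    pressure K dist f (g t') = rt'%:E -> rt - (t' - t) * l2 <= rt' <= rt - (t' - t) * l1.
  move=> t0 tt h1 h2; have tt0 : 0 <= t' - t by rewrite subr_ge0.
  have e : t + (t' - t) = t' by rewrite addrC subrK.
  by have := @pressure_shift t (t' - t) rt rt' t0 tt0 h1; rewrite e => /(_ h2).
have r_ge0 : 0 <= r.
  rewrite leNgt; apply/negP => r0.
  (* At distance less than -r / (2 l2) to the left of [s] the pressure would still be below r / 2,
     which excludes the points of [S] near its supremum. *)
  have d0 : 0 < - r / (2 * l2) by rewrite divr_gt0 ?mulr_gt0 ?oppr_gt0.
  have [t St st] := sup_adherent d0 Ss.
  have ts : t <= s := ub_le_sup (proj2 Ss) St.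
  have [t0 [rt rte rt0]] := St.
  have /andP[h1 _] := dec t s rt r t0 ts rte re.
  have : (s - t) * l2 < - r / (2 * l2) * l2.
    by rewrite ltr_pM2r// ltrBlDr -ltrBlDl -/s.
  have -> : - r / (2 * l2) * l2 = - r / 2 by field; rewrite gt_eqF.
  lra.
have r_le0 : r <= 0.
  rewrite leNgt; apply/negP => r0.
  have t0 : 0 <= s + r / l2 by rewrite addr_ge0// divr_ge0// ltW.
  have [rt rte _] := pressure_fin t0.
  have ss : s <= s + r / l2 by rewrite lerDl divr_ge0// ltW.
  have /andP[h1 _] := dec s _ r rt s0 ss re rte.
  have : S (s + r / l2).
    split => //; exists rt => //; move: h1; rewrite addrAC subrr add0r.
    by rewrite divfK ?gt_eqF//; lra.
  move=> /(ub_le_sup (proj2 Ss)); rewrite -/s gerDl leNgt divr_gt0//.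
have rE : r = 0 by apply/eqP; rewrite eq_le r_le0.
rewrite rE in re; exists s => // t rt t0 rte; split => st.
- have /andP[_ h] := dec s t _ _ s0 (ltW st) re rte.
  have : 0 < (t - s) * l1 by rewrite mulr_gt0// subr_gt0.
  lra.
- have /andP[_ h] := dec t s _ _ t0 (ltW st) rte re.
  have : 0 < (s - t) * l1 by rewrite mulr_gt0// subr_gt0.
  lra.
Qed.

(** The pressure is a supremum over eps, so its sign controls each fixed eps; passing from r to r /
    2 turns the upper limit into a bound for all large n. *)
Lemma pressure_lt0_sums t r eps : 0 <= t -> 0 < eps ->
  pressure K dist f (g t) = r%:E -> r < 0 ->
  exists N, forall n, (N <= n)%N ->
    (pressure_sum K dist f (g t) eps n <= (expR (n%:R * (r / 2)))%:E)%E.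
Proof.
move=> t0 eps0 re r0.
have : (P t eps < (r / 2)%:E)%E.
  apply: (@le_lt_trans _ _ r%:E); last by rewrite lte_fin; lra.
  by rewrite -re pressureE//; apply: ereal_sup_ubound; exists eps.
move=> /limn_esup_lt_eventually[N hN]; exists N.+1 => n Nn.
have n0 : (0 < n)%N by exact: leq_trans Nn.
have nR : 0 < n%:R :> R by rewrite ltr0n.
have [z z0 ze] := pressure_sum_fin n eps0 t0.
have := hN n (ltnW Nn); rewrite (uE z0 ze) lte_fin -/(Z t eps n) ze lee_fin => h.
rewrite -[z]lnK ?posrE// ler_expR; apply: ltW.
by move: h; rewrite ltr_pdivrMl.
Qed.

End PressureZero.

(** * Bounds along the repeller *)

Section SingularValueBounds.
Context {R : realType} {d : nat}.

Lemma invertible_of_expansion (G H T : 'M[R]_d) (l : R) : posdef H -> 0 < l ->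
  (forall v, l * nrm H v <= nrm G (v *m T)) -> T \in unitmx.
Proof.
move=> Hp l0 hl; rewrite unitmxE unitfE; apply/negP => /det0P[v v0 vT].
by have := hl v; rewrite vT nrm0 leNgt mulr_gt0 ?nrm_gt0.
Qed.

Lemma singular_values_nth (G H T : 'M[R]_d) (a := singular_values G H T) :
  posdef G -> posdef H ->
  size a = d /\ forall i j, (i <= j)%N -> (j < d)%N -> a`_j <= a`_i.
Proof.
move=> Gp Hp; have [sa oa _ _] := singular_valuesP T Gp Hp; split => // i j ij jd.
by have := sorted_leq_nth ge_trans ge_refl 0 oa; apply;
    rewrite ?inE ?sa// (leq_ltn_trans ij).
Qed.

(** The two-sided bound on [T] is evaluated at the preimages of the singular basis, whose images
    under [T] have length 1. *)
Lemma singular_values_invmx_bounds (G H T : 'M[R]_d) (l u : R)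
    (a := singular_values G H (invmx T)) :
  posdef G -> posdef H -> 0 < l -> 0 < u ->
  (forall v, l * nrm H v <= nrm G (v *m T) <= u * nrm H v) ->
  forall i, (i < d)%N -> u^-1 <= a`_i <= l^-1.
Proof.
move=> Gp Hp l0 u0 hlu i id.
have Tu : T \in unitmx.
  by apply: (@invertible_of_expansion G H T l) => // v; have /andP[] := hlu v.
have [sa oa _ [e [eo ea _]]] := singular_valuesP (invmx T) Gp Hp.
have := hlu (e (Ordinal id) *m invmx T); rewrite mulmxKV// ea /=.
have -> : nrm G (e (Ordinal id)) = 1 by rewrite /nrm eo eqxx sqrtr1.
rewrite -/a => /andP[h1 h2].
by rewrite -[l^-1]div1r -[u^-1]div1r ler_pdivlMr// ler_pdivrMr// (mulrC _ u) (mulrC _ l) h1 h2.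
Qed.

End SingularValueBounds.

(** * Coding of orbits and the size of separated sets *)

Section Separation.
Context {R : realType} {X : topologicalType}.
Variables (dist : X -> X -> \bar R) (f : X -> X).

Lemma injective_enum (T : finType) (c : X -> T) (E : set X) :
  (forall x y, E x -> E y -> c x = c y -> x = y) ->
  exists s : seq X, [/\ uniq s, E = [set` s] & (size s <= #|T|)%N].
Proof.
move=> cinj.
have /exists_choice[h hh] : forall w : T, exists o : option X,
    (forall x, o = Some x -> E x /\ c x = w) /\
    (forall x, E x -> c x = w -> o <> None).
  move=> w; have [[x [Ex xw]]|no] := pselect (exists x, E x /\ c x = w).
    by exists (Some x); split => // y [<-].
  by exists None; split => // x Ex xw _; apply: no; exists x.
exists (undup (pmap h (enum T))); split; first exact: undup_uniq.
  apply/seteqP; split => x /=; rewrite mem_undup mem_pmap.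
    move=> Ex; apply/mapP; exists (c x); first by rewrite mem_enum.
    have [h1 /(_ x Ex erefl)] := hh (c x).
    by case E1 : (h (c x)) h1 => [y|//] /(_ y erefl)[Ey yx] _; rewrite (cinj y x).
  by move=> /mapP[w _ /esym wx]; have [/(_ x wx)[]] := hh w.
apply: leq_trans (size_undup _) _; rewrite size_pmap.
by apply: leq_trans (count_size _ _) _; rewrite cardE.
Qed.

Lemma bowen_dist_le n x y (s : \bar R) : (0 <= s)%E ->
  (forall i, (i < n)%N -> (dist (iter i f x) (iter i f y) <= s)%E) ->
  (bowen_dist dist f n x y <= s)%E.
Proof.
move=> s0 h; rewrite /bowen_dist; apply: (big_ind (fun z => z <= s)%E) => //.
  by move=> u v us vs; rewrite ge_max us.
by move=> i _; exact: h.
Qed.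

Lemma bowen_dist_ge n x y i : (i < n)%N ->
  (dist (iter i f x) (iter i f y) <= bowen_dist dist f n x y)%E.
Proof.
by move=> ni; exact: (le_bigmax _ (fun i : 'I_n => dist (iter i f x) (iter i f y)) (Ordinal ni)).
Qed.

Variables (N p : nat) (W : 'I_p -> set X).
Hypothesis Wdiam : forall i x y, W i x -> W i y -> (dist x y <= 1%:E)%E.
Hypothesis Wcontr : forall i x y s, W i x -> W i y ->
  (dist (iter N f x) (iter N f y) <= s%:E)%E -> (dist x y <= (s / 2)%:E)%E.

(** Two orbits that share a piece at each of the times 0, N, ..., (J - 1)N are followed backwards;
    every step halves the distance. *)
Lemma contraction_along_code J x y s :
  (forall j, (j < J)%N -> exists i, W i (iter (j * N) f x) /\ W i (iter (j * N) f y)) ->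
  (dist (iter (J * N) f x) (iter (J * N) f y) <= s%:E)%E ->
  (dist x y <= (s / 2 ^+ J)%:E)%E.
Proof.
elim: J x y => [|J IH] x y h; first by rewrite expr0 divr1.
have sh z j : iter (j.+1 * N) f z = iter (j * N) f (iter N f z).
  by rewrite mulSn addnC iterD.
rewrite !sh => hs; have [i [Wx Wy]] := h 0%N isT.
rewrite exprSr invfM mulrA; apply: (Wcontr Wx Wy); apply: IH => // j jJ.
by have := h j.+1 jJ; rewrite !sh.
Qed.

(** Points are coded by the pieces visited up to time n + JN. Equal codes keep the orbits within
    2^-J <= eps at all times below n, since the pieces have diameter at most 1; so the code is
    injective on a separated set. The extra JN + 1 symbols make up [B]. *)
Lemma separated_card (K : set X) : (forall x, K x -> K (f x)) -> K !=set0 ->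
  (forall x, K x -> exists i, W i x) ->
  forall eps, 0 < eps -> exists B, forall n E,
    E `<=` K -> Defs.separated dist f n eps E ->
    exists s : seq X, [/\ uniq s, E = [set` s] & (size s <= B * p ^ n)%N].
Proof.
move=> Kinv [x0 Kx0] KW eps eps0; have [i0 _] := KW x0 Kx0.
have /exists_choice[c hc] : forall x : X, exists i, K x -> W i x.
  by move=> x; have [/KW[i Wx]|nK] := pselect (K x); [exists i|exists i0].
have [J hJ] : exists J, 2 ^- J <= eps.
  have [J hJ] := @exprn_unbounded R 2 eps^-1 (ltr1n _ 2); exists J.
  have := hJ J (leqnn J); rewrite -[X in _ <= X]invrK lef_pV2// ?posrE ?invr_gt0 ?exprn_gt0//.
have itK n x : K x -> K (iter n f x) by move=> Kx; elim: n => //= n /Kinv.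
exists (p ^ (J * N).+1)%N => n E EK Esep.
have [|s [us Es ss]] := @injective_enum {ffun 'I_(n + (J * N).+1) -> 'I_p}
    (fun x => [ffun i : 'I__ => c (iter i f x)]) E; last first.
  by exists s; split => //; move: ss; rewrite card_ffun !card_ord expnD mulnC.
move=> x y Ex Ey /ffunP cxy; apply: contrapT => xy.
have := Esep x y Ex Ey xy; rewrite ltNge => /negP; apply.
have share i : (i < n + (J * N).+1)%N -> exists j, W j (iter i f x) /\ W j (iter i f y).
  move=> hi; exists (c (iter i f x)); split; first by apply: hc; apply: itK; exact: EK.
  have := cxy (Ordinal hi); rewrite !ffunE /= => ->.
  by apply: hc; apply: itK; exact: EK.
apply: bowen_dist_le => [|i ni]; first by rewrite lee_fin ltW.
apply: (@le_trans _ _ (1 / 2 ^+ J)%:E); last by rewrite lee_fin div1r.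
apply: contraction_along_code => [j jJ|]; rewrite -!iterD.
  apply: share; rewrite addnS ltnS addnC leq_add//; [exact: ltnW|].
  by rewrite leq_mul2r ltnW// orbT.
have [|j [Wx Wy]] := share (J * N + i)%N; last exact: Wdiam Wx Wy.
by rewrite addnS ltnS addnC leq_add2r ltnW.
Qed.

End Separation.

Section PotentialBounds.
Context {R : realType} {d : nat} {M : topologicalType}.
Variables (A : smooth_atlas R d M) (g : riemannian_metric A) (psi : M -> M).
Variables (Lam : set M) (lam L C : R).
Hypotheses (d0 : (0 < d)%N) (lam1 : 1 < lam) (L1 : 1 <= L) (C1 : 1 <= C).
Hypothesis expand : forall n z v, Lam z ->
  lam ^+ n * tangent_norm g z v
    <= C * tangent_norm g (iter n psi z) (v *m tangent_map A (iter n psi) z).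
Hypothesis bound : forall n z v, Lam z ->
  tangent_norm g (iter n psi z) (v *m tangent_map A (iter n psi) z)
    <= L ^+ n * tangent_norm g z v.

Local Notation a := (inverse_branch_singular_values g psi).

Lemma inverse_branch_bounds n z i : Lam z -> (i < d)%N ->
  L ^- n <= (a n z)`_i <= C / lam ^+ n.
Proof.
move=> Lz id; have ln0 : 0 < lam ^+ n by rewrite exprn_gt0// (lt_trans ltr01).
have Ln0 : 0 < L ^+ n by rewrite exprn_gt0// (lt_le_trans ltr01).
have C0 : 0 < C by exact: lt_le_trans C1.
rewrite -[C / _]invf_div.
apply: (singular_values_invmx_bounds (gram_posdef g _) (gram_posdef g _)) => //.
  by rewrite divr_gt0.
move=> v; rewrite -!tangent_normE (bound _ _ Lz) andbT mulrAC ler_pdivrMr// mulrC [X in _ <= X]mulrC.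
by rewrite mulrC expand.
Qed.

Lemma inverse_branch_gt0 n z i : Lam z -> (i < d)%N -> 0 < (a n z)`_i.
Proof.
move=> Lz id; have /andP[h _] := inverse_branch_bounds n Lz id.
by apply: lt_le_trans h; rewrite invr_gt0 exprn_gt0// (lt_le_trans ltr01).
Qed.

Lemma inverse_branch_unit n z : Lam z -> tangent_map A (iter n psi) z \in unitmx.
Proof.
move=> Lz; have ln0 : 0 < lam ^+ n by rewrite exprn_gt0// (lt_trans ltr01).
have C0 : 0 < C by exact: lt_le_trans C1.
apply: (@invertible_of_expansion _ _ (gram_at g (iter n psi z)) (gram_at g z) _ (lam ^+ n / C)).
- exact: gram_posdef.
- by rewrite divr_gt0.
- by move=> v; rewrite mulrAC ler_pdivrMr// [X in _ <= X]mulrC; exact: expand.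
Qed.

Lemma inverse_branch_nth n z : size (a n z) = d /\
  forall i j, (i <= j)%N -> (j < d)%N -> (a n z)`_j <= (a n z)`_i.
Proof. exact: (singular_values_nth _ (gram_posdef g _) (gram_posdef g _)). Qed.

Lemma ln_inverse_branch n z i : Lam z -> (i < d)%N ->
  - (n%:R * ln L) <= ln (a n z)`_i <= ln C - n%:R * ln lam.
Proof.
move=> Lz id; have /andP[h1 h2] := inverse_branch_bounds n Lz id.
have a0 := inverse_branch_gt0 n Lz id.
have lam0 : 0 < lam by exact: lt_trans lam1.
have L0 : 0 < L by exact: lt_le_trans L1.
have C0 : 0 < C by exact: lt_le_trans C1.
rewrite !mulr_natl -!lnXn// -lnV ?posrE ?exprn_gt0// -ln_div ?posrE ?exprn_gt0//.
by rewrite !ler_ln ?posrE ?invr_gt0 ?divr_gt0 ?exprn_gt0// h1.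
Qed.

Lemma singular_potential_shift t s n x : 0 <= t -> 0 <= s -> Lam x ->
  s * (- ln C - n%:R * ln L)
    <= singular_potential g psi (t + s) n x - singular_potential g psi t n x
    <= s * (ln C - n%:R * ln lam).
Proof.
move=> t0 s0 Lx.
have /andP[h1 h2] := @ln_svf_shift R d _ _ _ d0 (fun i => @inverse_branch_gt0 n x i Lx)
  t s (- (n%:R * ln L)) (ln C - n%:R * ln lam) t0 s0
  (fun i => @ln_inverse_branch n x i Lx).
apply/andP; split => //; apply: le_trans h1; rewrite ler_wpM2l//.
by have := ln_ge0 C1; lra.
Qed.

Lemma singular_potential0 n x : singular_potential g psi 0 n x = 0.
Proof. by rewrite /singular_potential singular_value_function0 ln1. Qed.

End PotentialBounds.

(** * The box dimension of the repeller *)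

(** Greedy construction along the list. [far] is not assumed symmetric, so a new point is added when
    it is far in both directions, and otherwise one of two negations holds. *)
Lemma maximal_separated (X : eqType) (far : X -> X -> Prop) (Z : seq X) :
  exists E, [/\ uniq E, {subset E <= Z},
    (forall x y, x \in E -> y \in E -> x <> y -> far x y) &
    forall z, z \in Z -> exists2 x, x \in E & x = z \/ ~ far x z \/ ~ far z x].
Proof.
elim: Z => [|a Z [E [uE EZ Efar hE]]]; first by exists [::].
have [aE|aE] := boolP (a \in E).
  exists E; split => // [x /EZ xZ|z]; first by rewrite in_cons xZ orbT.
  by rewrite in_cons => /orP[/eqP ->|/hE//]; exists a => //; left.
have [hfar|] := pselect (forall x, x \in E -> far x a /\ far a x); last first.
  move=> /existsNP[x /not_implyP[xE /not_andP nfar]].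
  exists E; split => // [y /EZ yZ|z]; first by rewrite in_cons yZ orbT.
  by rewrite in_cons => /orP[/eqP ->|/hE//]; exists x => //; right.
exists (a :: E); split; first by rewrite /= aE.
- by move=> x; rewrite !in_cons => /orP[->//|/EZ ->]; rewrite orbT.
- move=> x y; rewrite !in_cons => /orP[/eqP ->|xE] /orP[/eqP ->|yE] // xy.
  + by have [] := hfar y yE.
  + by have [] := hfar x xE.
  + exact: Efar.
- move=> z; rewrite in_cons => /orP[/eqP ->|/hE[x xE h]].
    by exists a; [rewrite mem_head|left].
  by exists x => //; rewrite in_cons xE orbT.
Qed.

(** * Covering numbers from a recursion over scales *)

Section CoveringRecursion.
Context {R : realType} {M : topologicalType}.
Variables (dist : M -> M -> \bar R) (S : set M) (I : finType) (B : I -> set M).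
Variables (c b : I -> R) (s r0 : R).
Hypotheses (r00 : 0 < r0) (SB : S `<=` \bigcup_i B i).
Hypotheses (c0 : forall i, 0 <= c i) (b0 : forall i, 0 < b i) (b_half : forall i, b i <= 1 / 2).
Hypothesis cb : \sum_i c i * b i `^ s <= 1.
Hypothesis s0 : 0 <= s.
Hypothesis cov : forall delta, 0 < delta -> exists n, covered dist S n delta.
Hypothesis step : forall i delta n, 0 < delta -> delta <= r0 -> covered dist S n delta ->
  exists n', covered dist (B i) n' (delta * b i) /\ n'%:R <= n%:R * c i.

(* By induction on the scale: a covering of [S] at scale [delta / b i] induces one
   of [B i] at scale [delta]. *)
Lemma covering_recursion : exists2 K, 0 < K & forall delta, 0 < delta -> delta <= r0 ->
  exists n, covered dist S n delta /\ n%:R <= K * delta `^ (- s).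
Proof.
(* One covering at scale e r0 serves all scales from e r0 to r0, and its size fixes [K]. Below e r0,
   the scale delta / b_i does not exceed r0. *)
have [|e e0 he] := @finite_lower_bound R I b (enum I); first by move=> i _; exact: b0.
have eb i : e <= b i by apply: he; rewrite mem_enum.
have er0 : 0 < e * r0 by rewrite mulr_gt0.
have [n0 cn0] := cov er0.
pose K := n0.+1%:R * r0 `^ s.
have K0 : 0 < K by rewrite mulr_gt0// powR_gt0.
exists K => // delta delta0 dr0.
have base delta' : 0 < delta' -> delta' <= r0 -> e * r0 <= delta' ->
    exists n, covered dist S n delta' /\ n%:R <= K * delta' `^ (- s).
  move=> d0 dr ed; exists n0.+1; split.
    by apply: (covered_widen (leqnSn n0)); apply: covered_le cn0.
  rewrite /K powRN -mulrA ler_peMr// ler_pdivlMr ?powR_gt0// mul1r.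
  by apply: ge0_ler_powR => //; rewrite nnegrE ltW.
(* The index k counts halvings of the scale: b_i <= 1/2 makes delta / b_i at least twice delta, so
   it falls under the induction hypothesis. *)
suff claim k : forall delta, 0 < delta -> e * r0 / 2 ^+ k <= delta -> delta <= r0 ->
    exists n, covered dist S n delta /\ n%:R <= K * delta `^ (- s).
  have [k hk] := @exprn_unbounded R 2 (e * r0 / delta) (ltr1n _ 2).
  apply: (claim k) => //.
  by rewrite ler_pdivrMr ?exprn_gt0// [leRHS]mulrC -ler_pdivrMr// hk.
elim: k => [|k IH] {delta0 dr0}delta delta0 dk dr0.
  by apply: base => //; move: dk; rewrite expr0 divr1.
have [|de] := leP (e * r0) delta; first exact: base.
have /fin_all_exists[n hn] : forall i, exists n, covered dist (B i) n delta /\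
    n%:R <= K * delta `^ (- s) * (c i * b i `^ s).
  move=> i; have bi := b0 i.
  have db0 : 0 < delta / b i by rewrite divr_gt0.
  have dbr : delta / b i <= r0.
    rewrite ler_pdivrMr//; apply: le_trans (ltW de) _.
    by rewrite mulrC ler_pM2l.
  have dbk : e * r0 / 2 ^+ k <= delta / b i.
    rewrite ler_pdivlMr//; apply: le_trans dk.
    rewrite exprSr invfM mulrA ler_pM2l ?divr_gt0 ?exprn_gt0//.
    by rewrite -div1r.
  have [n [cn nK]] := IH _ db0 dbk dbr.
  have [n' [cn' n'n]] := step i db0 dbr cn.
  exists n'; split; first by move: cn'; rewrite divfK ?gt_eqF.
  apply: le_trans n'n _.
  have -> : K * delta `^ (- s) * (c i * b i `^ s) = K * (delta / b i) `^ (- s) * c i.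
    rewrite powRM ?invr_ge0 ?ltW// -[(b i)^-1]powR_inv1 ?ltW// -powRrM mulN1r opprK.
    by rewrite [c i * _]mulrC !mulrA.
  by rewrite ler_wpM2r.
exists (\sum_i n i)%N; split.
  by apply: covered_bigcup SB _ => i; exact: (hn i).1.
rewrite natr_sum; apply: (@le_trans _ _ (\sum_i K * delta `^ (- s) * (c i * b i `^ s))).
  by apply: ler_sum => i _; exact: (hn i).2.
by rewrite -mulr_sumr ler_piMr// mulr_ge0 ?powR_ge0// ltW.
Qed.

End CoveringRecursion.

Section GoodNeighborhoods.
Context {R : realType} {d : nat} {M : topologicalType}.
Hypothesis M_hausdorff : hausdorff_space M.
Variables (A : smooth_atlas R d M) (g : riemannian_metric A).

Local Notation rho := (riemannian_dist g).

Lemma riemannian_ball_nbhs z e : 0 < e ->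
  nbhs z [set x | (rho z x <= e%:E)%E].
Proof.
move=> e0; have [r gr] := good_radius_exists g z; have r0 := proj1 gr.
have m0 : 0 < Num.min r (e / 2) by rewrite lt_min r0 divr_gt0.
have nB := chart_ball_nbhs g z m0; apply: filterS nB => x [dx].
rewrite lt_min => /andP[xr xe].
have zr := chart_ball_center g z r0.
apply: le_trans (line_dist_le gr zr (conj dx xr)) _; rewrite lee_fin; lra.
Qed.

Lemma compact_covered (K : set M) delta : compact K -> 0 < delta ->
  exists n, covered rho K n delta.
Proof.
move=> Kc delta0.
have /exists_choice[r hr] : forall z : M, exists r, 0 < r /\ forall x y,
    chart_ball g z r x -> chart_ball g z r y -> (rho x y <= delta%:E)%E.
  move=> z; have [r gr] := good_radius_exists g z; have r0 := proj1 gr.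
  exists (Num.min r (delta / 4)); split; first by rewrite lt_min r0 divr_gt0.
  move=> x y [dx]; rewrite lt_min => /andP[xr xe] [dy]; rewrite lt_min => /andP[yr ye].
  apply: le_trans (line_dist_le gr (conj dx xr) (conj dy yr)) _; rewrite lee_fin.
  have := chart_dist_triangle g z x z y; rewrite (chart_distC g z x z); lra.
have [|s [_ hs]] := compact_finite_subcover (U := fun z => chart_ball g z (r z)) Kc.
  by move=> z _; apply: chart_ball_nbhs; case: (hr z).
exists (size s), (fun i => let z := tnth (in_tuple s) i in chart_ball g z (r z)); split.
  move=> x /hs[z zs xz]; have zi : (index z s < size s)%N by rewrite index_mem.
  by exists (Ordinal zi) => //=; rewrite (tnth_nth z) /= nth_index.
by move=> i x y; have [_] := hr (tnth (in_tuple s) i); exact.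
Qed.

Variables (psi : M -> M) (psi_C1 : is_C1_map A psi).
Local Notation a := (inverse_branch_singular_values g psi).

Lemma orbit_close_nbhs z e m : 0 < e ->
  nbhs z [set x | forall i, (i < m)%N -> (rho (iter i psi z) (iter i psi x) <= e%:E)%E].
Proof.
move=> e0; elim: m => [|m IH]; first exact: nearW.
have h := iter_continuous psi_C1 (riemannian_ball_nbhs (iter m psi z) e0).
apply: filterS (filterI IH h) => x [h1 h2] i; rewrite ltnS leq_eqVlt => /orP[/eqP->//|].
exact: h1.
Qed.

(** The set to be covered only has to be small and near some point u of the small ball: r2 / 3 for u
    plus 2 r2 / 3 for the displacement keeps it in the ball of radius r2 where the local covering
    applies. *)
Lemma covering_neighborhood m z e : 0 < e -> tangent_map A (iter m psi) z \in unitmx ->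
  exists q r0, [/\ 0 < q, 0 < r0,
    forall x i, chart_ball g z q x -> (i < m)%N ->
      (rho (iter i psi z) (iter i psi x) <= e%:E)%E &
    forall S u r k, chart_ball g z q u -> (forall v, S v -> (rho u v <= r0%:E)%E) ->
      0 < r -> (forall v w, S v -> S w -> (rho (iter m psi v) (iter m psi w) <= r%:E)%E) ->
      (k < d)%N -> 0 < (a m z)`_k ->
      exists n, covered rho S n (r * (a m z)`_k) /\
        n%:R <= (16 * d%:R + 2) ^+ d * \prod_(j < k) ((a m z)`_j / (a m z)`_k)].
Proof.
move=> e0 Tu; have [r1 r10 h1] := local_covering M_hausdorff g psi_C1 Tu.
have [r gr] := good_radius_exists g z; have gr0 := proj1 gr.
have [q q0 hq] := chart_ball_in_nbhs g (orbit_close_nbhs z m e0).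
pose r2 := Num.min r1 r; have r20 : 0 < r2 by rewrite lt_min r10.
have gr2 : good_radius g z r2 by apply: good_radius_le gr => //; rewrite ge_min lexx orbT.
exists (Num.min q (r2 / 3)), (r2 / 3); split.
- by rewrite lt_min q0 divr_gt0.
- by rewrite divr_gt0.
- move=> x i [dx]; rewrite lt_min => /andP[xq _] im; apply: (hq x) => //.
- move=> S u t k [du]; rewrite lt_min => /andP[_ uq] Su t0 hS kd ak.
  apply: h1 => // v /Su uv.
  have [|[dv vr] _] := chart_dist_le_dist M_hausdorff gr2 du _ uv; first by lra.
  by split => //; apply: lt_le_trans vr _; rewrite /r2 ge_min lexx.
Qed.

End GoodNeighborhoods.

(** * Covering estimate for the repeller *)

Section BoxBound.
Context {R : realType} {d : nat} {M : topologicalType}.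
Hypothesis M_hausdorff : hausdorff_space M.
Variables (A : smooth_atlas R d M) (g : riemannian_metric A).
Variables (psi : M -> M) (psi_C1 : is_C1_map A psi) (Lam : set M).
Hypotheses (Lam_compact : compact Lam) (Lam_inv : forall z, Lam z -> Lam (psi z)).
Variables (lam L C : R).
Hypotheses (d0 : (0 < d)%N) (lam1 : 1 < lam) (L1 : 1 <= L) (C1 : 1 <= C).
Hypothesis expand : forall n z v, Lam z ->
  lam ^+ n * tangent_norm g z v
    <= C * tangent_norm g (iter n psi z) (v *m tangent_map A (iter n psi) z).
Hypothesis bound : forall n z v, Lam z ->
  tangent_norm g (iter n psi z) (v *m tangent_map A (iter n psi) z)
    <= L ^+ n * tangent_norm g z v.

Local Notation rho := (riemannian_dist g).
Local Notation a := (inverse_branch_singular_values g psi).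

Section Weights.
Variable s : R.
Hypothesis s0 : 0 <= s.
Let k := minn (Num.truncn s) d.-1.

Definition covering_radius m z := (a m z)`_k.
Definition covering_weight m z := \prod_(j < k) ((a m z)`_j / (a m z)`_k).

Let kd : (k < d)%N. Proof. by rewrite -(prednK d0) ltnS geq_minr. Qed.

Let a_gt0 m z i : Lam z -> (i < d)%N -> 0 < (a m z)`_i.
Proof. by move=> Lz id; apply: (inverse_branch_gt0 lam1 L1 C1 expand bound). Qed.

Lemma covering_radius_gt0 m z : Lam z -> 0 < covering_radius m z.
Proof. by move=> Lz; exact: a_gt0. Qed.

Lemma covering_weight_gt0 m z : Lam z -> 0 < covering_weight m z.
Proof.
move=> Lz; apply: prodr_gt0 => j _; rewrite divr_gt0 ?a_gt0//.
exact: ltn_trans kd.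
Qed.

Lemma ln_covering_weight m z : Lam z ->
  ln (covering_weight m z) = \sum_(j < k) (ln (a m z)`_j - ln (a m z)`_k).
Proof.
move=> Lz; have jd (j : 'I_k) : (j < d)%N by exact: ltn_trans kd.
rewrite ln_prod => [|j _]; last by rewrite divr_gt0 ?a_gt0.
by apply: eq_bigr => j _; rewrite ln_div ?posrE ?a_gt0.
Qed.

Lemma covering_weight_le m z : Lam z ->
  covering_weight m z * covering_radius m z `^ s <= expR (singular_potential g psi s m z).
Proof.
move=> Lz; have r0 := covering_radius_gt0 m Lz; have w0 := covering_weight_gt0 m Lz.
rewrite -[leLHS]lnK ?posrE ?mulr_gt0 ?powR_gt0// ler_expR lnM ?posrE ?powR_gt0// ln_powR.
rewrite ln_covering_weight//; apply: (@ln_svf_ge_covering R d _ _ _ d0) => //.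
  by move=> i; exact: a_gt0.
exact: (inverse_branch_nth g psi m z).2.
Qed.

(** [T] is chosen before m: both logarithms are at most m B0 in absolute value, so 2 B0 / eta
    intervals of length eta m suffice. [B1] bounds the log a_j divided by m, and the weight is a
    product of at most d ratios, whence the factor 2 d in [B0]. *)
Lemma covering_classes eta : 0 < eta -> exists T : finType, forall m, (0 < m)%N ->
  exists cl : M -> T, forall x y, Lam x -> Lam y -> cl x = cl y ->
    covering_radius m x <= expR (eta * m%:R) * covering_radius m y /\
    covering_weight m x <= expR (eta * m%:R) * covering_weight m y.
Proof.
move=> eta0; pose B1 := ln L + ln C.
have lL := ln_ge0 L1; have lC := ln_ge0 C1; have ll := ln_gt0 lam1.
have B10 : 0 <= B1 by rewrite addr_ge0.
have dR : 1 <= d%:R :> R by rewrite ler1n.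
pose B0 := 2 * d%:R * B1 + 1.
have dB : 0 <= (d%:R - 1) * B1 by rewrite mulr_ge0// subr_ge0.
have B00 : 0 < B0 by rewrite /B0; lra.
have [n n0 hn] : exists2 n, (0 < n)%N & 2 * B0 <= n%:R * eta.
  exists (Num.truncn (2 * B0 / eta)).+1 => //.
  by rewrite -ler_pdivrMr//; exact: ltW (truncnS_gt _).
exists ('I_n.+1 * 'I_n.+1)%type => m m0.
have mR : 1 <= m%:R :> R by rewrite ler1n.
have mR0 : 0 < m%:R :> R by rewrite ltr0n.
have b0 : 0 < m%:R * B0 by rewrite mulr_gt0.
have [f hf] := @interval_coloring R (m%:R * B0) n b0 n0.
have nE : 2 * (m%:R * B0) / n%:R <= eta * m%:R.
  rewrite ler_pdivrMr ?ltr0n//; move: hn; rewrite -(ler_pM2l mR0); lra.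
have lna z i : Lam z -> (i < d)%N -> `|ln (a m z)`_i| <= m%:R * B1.
  move=> Lz id; have /andP[h1 h2] := ln_inverse_branch lam1 L1 C1 expand bound m Lz id.
  have k1 : ln C <= m%:R * ln C by rewrite ler_peMl.
  have k2 : 0 <= m%:R * ln L by rewrite mulr_ge0.
  have k3 : 0 <= m%:R * ln lam by rewrite mulr_ge0// ltW.
  by rewrite ler_norml /B1 mulrDr; apply/andP; split; lra.
have mB : 0 <= m%:R * B1 by rewrite mulr_ge0.
have mdB : 0 <= m%:R * ((d%:R - 1) * B1) by rewrite mulr_ge0.
have lnr z : Lam z -> `|ln (covering_radius m z)| <= m%:R * B0.
  move=> Lz; apply: le_trans (lna z k Lz kd) _; rewrite ler_pM2l// /B0; lra.
have lnw z : Lam z -> `|ln (covering_weight m z)| <= m%:R * B0.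
  move=> Lz; rewrite ln_covering_weight//.
  apply: le_trans (ler_norm_sum _ _ _) _.
  apply: (@le_trans _ _ (\sum_(j < k) 2 * (m%:R * B1))).
    apply: ler_sum => j _; have jd : (j < d)%N by exact: ltn_trans kd.
    apply: le_trans (ler_normB _ _) _.
    by have := lna z j Lz jd; have := lna z k Lz kd; lra.
  rewrite sumr_const card_ord -[leLHS]mulr_natl.
  have : k%:R * (2 * (m%:R * B1)) <= d%:R * (2 * (m%:R * B1)).
    by rewrite ler_wpM2r ?mulr_ge0// ler_nat ltnW.
  rewrite /B0; lra.
exists (fun z => (f (ln (covering_radius m z)), f (ln (covering_weight m z)))).
have conv u v : 0 < u -> 0 < v -> `|ln u - ln v| <= eta * m%:R ->
    u <= expR (eta * m%:R) * v.
  move=> u0 v0; rewrite ler_norml => /andP[_ h].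
  rewrite -[leLHS]lnK ?posrE// -[X in _ * X]lnK ?posrE// -expRD ler_expR; lra.
move=> x y Lx Ly fxy.
have fr : f (ln (covering_radius m x)) = f (ln (covering_radius m y)) := congr1 fst fxy.
have fw : f (ln (covering_weight m x)) = f (ln (covering_weight m y)) := congr1 snd fxy.
split; apply: conv.
- exact: covering_radius_gt0.
- exact: covering_radius_gt0.
- exact: le_trans (hf _ _ (lnr x Lx) (lnr y Ly) fr) nE.
- exact: covering_weight_gt0.
- exact: covering_weight_gt0.
- exact: le_trans (hf _ _ (lnw x Lx) (lnw y Ly) fw) nE.
Qed.

End Weights.

(** Separation is known only within a class, so each class contributes at most one pressure sum. *)
Lemma class_sum_le (T : finType) (cl : M -> T) (h : M -> R) (E : seq M) eps n P :
  (forall x, 0 <= h x) -> 0 <= P -> uniq E ->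
  (forall x, x \in E -> Lam x) ->
  (forall x y, x \in E -> y \in E -> x <> y -> cl x = cl y ->
    (eps%:E < bowen_dist rho psi n x y)%E) ->
  (ereal_sup [set \esum_(x in F) (h x)%:E |
    F in [set F | F `<=` Lam /\ Defs.separated rho psi n eps F]] <= P%:E)%E ->
  \sum_(x <- E) h x <= #|T|%:R * P.
Proof.
move=> h0 P0 uE EL Esep hP.
rewrite (partition_big cl xpredT)//= -sum1_card natr_sum mulr_suml.
apply: ler_sum => t _; rewrite mul1r -big_filter -lee_fin -esum_seq ?filter_uniq//.
apply: le_trans hP; apply: ereal_sup_ubound.
exists [set` [seq x <- E | cl x == t]] => //; split => [x|x y] /=.
  by rewrite mem_filter => /andP[_ /EL].
rewrite !mem_filter => /andP[/eqP xt xE] /andP[/eqP yt yE] xy.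
by apply: Esep => //; rewrite xt yt.
Qed.

Variables (N p : nat) (W : 'I_p -> set M) (e0 : R).
Hypotheses (N0 : (0 < N)%N) (e00 : 0 < e0).
Hypothesis Wcontr : forall i x y s, W i x -> W i y ->
  (rho (iter N psi x) (iter N psi y) <= s%:E)%E -> (rho x y <= (s / 2)%:E)%E.
Hypothesis Wsym : forall i x y s, W i x -> W i y -> (rho x y <= s%:E)%E ->
  (rho y x <= (4 * s)%:E)%E.
Hypothesis Wleb : forall x, Lam x -> exists i, W i x /\ forall y y',
  (rho x y <= e0%:E)%E -> (rho y y' <= e0%:E)%E -> W i y /\ W i y'.

(* The symmetry of [rho] is not proved; closeness up to a constant suffices. *)
Lemma rho_swap x y : Lam x -> (rho x y <= (e0 / 4)%:E)%E -> (rho y x <= e0%:E)%E.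
Proof.
move=> Lx xy; have [i [Wx h]] := Wleb Lx.
have xy' : (rho x y <= e0%:E)%E by apply: le_trans xy _; rewrite lee_fin; move: e00; lra.
have yy : (rho y y <= e0%:E)%E.
  by apply: le_trans (riemannian_dist_refl g y) _; rewrite lee_fin ltW.
have [Wy _] := h _ _ xy' yy; apply: le_trans (Wsym Wx Wy xy) _.
by rewrite lee_fin; lra.
Qed.

(* [x] is the centre of the cell and [z] (resp. [z']) the point of the net near [u]
   (resp. [v]). *)
Lemma shadowing_contracts J x z z' u v s : Lam x ->
  (forall i, (i < J * N)%N -> (rho (iter i psi x) (iter i psi z) <= e0%:E)%E /\
     (rho (iter i psi z) (iter i psi u) <= e0%:E)%E) ->
  (forall i, (i < J * N)%N -> (rho (iter i psi x) (iter i psi z') <= e0%:E)%E /\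
     (rho (iter i psi z') (iter i psi v) <= e0%:E)%E) ->
  (rho (iter (J * N) psi u) (iter (J * N) psi v) <= s%:E)%E ->
  (rho u v <= (s / 2 ^+ J)%:E)%E.
Proof.
move=> Lx hu hv; apply: (contraction_along_code Wcontr) => j jJ.
have jN : (j * N < J * N)%N by rewrite ltn_pmul2r.
(* The piece depends on the iterate of x alone, so the iterates of u and v, reached through z and
   z', lie in the same one. *)
have [i [_ hi]] := Wleb (iter_inv Lam_inv (j * N) Lx).
have [u1 u2] := hu _ jN; have [v1 v2] := hv _ jN.
by exists i; split; [exact: (hi _ _ u1 u2).2|exact: (hi _ _ v1 v2).2].
Qed.

Lemma box_bound s r : 0 <= s -> r < 0 ->
  (exists N', forall n, (N' <= n)%N ->
    (pressure_sum Lam rho psi (singular_potential g psi s) (e0 / 4) n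
       <= (expR (n%:R * (r / 2)))%:E)%E) ->
  exists K r0, [/\ 0 < K, 0 < r0 & forall delta, 0 < delta -> delta <= r0 ->
    exists n, covered rho Lam n delta /\ n%:R <= K * delta `^ (- s)].
Proof.
move=> s0 r0 [N' hN'].
have s1 : 0 < 1 + s by lra.
have lnl : 0 < ln lam by exact: ln_gt0.
(* The first bound leaves half of the expansion rate to make b_i <= 1/2. The second keeps the
   accumulated error eta (1 + s) m below -r m / 4, half of the decay of the pressure sums. *)
pose eta := Num.min (ln lam / 2) (- r / (4 * (1 + s))).
have eta0 : 0 < eta by rewrite lt_min !divr_gt0 ?mulr_gt0 ?oppr_gt0.
have eta1 : eta <= ln lam / 2 by rewrite ge_min lexx.
have eta2 : eta * (1 + s) <= - r / 4.
  have : eta <= - r / (4 * (1 + s)) by rewrite ge_min lexx orbT.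
  have -> : - r / 4 = - r / (4 * (1 + s)) * (1 + s) by field; rewrite gt_eqF.
  by rewrite ler_pM2r.
have [T hT] := covering_classes s eta0.
pose D := (16 * d%:R + 2) ^+ d : R.
have D0 : 0 < D by rewrite exprn_gt0// ltr_wpDl// mulr_ge0.
(* [J0] lets the remaining decay beat the covering constant times the number of classes; [J1] lets
   half of the expansion beat 2 C. *)
have [J0 hJ0] := @exprn_unbounded R (expR (- r / 4)) (D * #|T|%:R) ltac:(by rewrite expR_gt1; lra).
have [J1 hJ1] := @exprn_unbounded R (expR (ln lam / 2)) (2 * C) ltac:(by rewrite expR_gt1; lra).
(* m is a multiple of N because contraction is known for N steps at a time. *)
pose J := (maxn J0 (maxn J1 N')).+1; pose m := (J * N)%N.
have Jm : (J <= m)%N by rewrite leq_pmulr.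
have m0 : (0 < m)%N by exact: leq_trans Jm.
have mJ0 : (J0 <= m)%N by apply: leq_trans Jm; rewrite ltnW// ltnS leq_maxl.
have mJ1 : (J1 <= m)%N by apply: leq_trans Jm; rewrite ltnW// ltnS !leq_max leqnn orbT.
have mN' : (N' <= m)%N by apply: leq_trans Jm; rewrite ltnW// ltnS !leq_max leqnn !orbT.
move: (hJ0 _ mJ0) (hJ1 _ mJ1) (hN' _ mN') => {hJ0 hJ1 hN'}.
rewrite -!expRM_natl => hD hC hP.
have [cl hcl] := hT m m0.
pose alpha := covering_radius s m; pose nu := covering_weight s m.
have /exists_choice[q /exists_choice[rr hq]] : forall z, exists q, exists rr : R, Lam z ->
    [/\ 0 < q, 0 < rr,
    forall x i, chart_ball g z q x -> (i < m)%N ->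
      (rho (iter i psi z) (iter i psi x) <= e0%:E)%E &
    forall S u r k, chart_ball g z q u -> (forall v, S v -> (rho u v <= rr%:E)%E) ->
      0 < r -> (forall v w, S v -> S w -> (rho (iter m psi v) (iter m psi w) <= r%:E)%E) ->
      (k < d)%N -> 0 < (a m z)`_k ->
      exists n, covered rho S n (r * (a m z)`_k) /\
        n%:R <= D * \prod_(j < k) ((a m z)`_j / (a m z)`_k)].
  move=> z; have [Lz|nLz] := pselect (Lam z); last by exists 0, 0.
  have Tu := inverse_branch_unit lam1 C1 expand m Lz.
  have [q [rr h]] := covering_neighborhood M_hausdorff g psi_C1 e00 Tu.
  by exists q, rr.
have [|Z [ZL hZ]] := compact_finite_subcover (U := fun z => chart_ball g z (q z)) Lam_compact.
  by move=> z /hq[? _ _ _]; exact: chart_ball_nbhs.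
have [|rho0 rho00 hrho0] := finite_lower_bound (e := rr) (s := Z).
  by move=> z /ZL/hq[].
have /exists_choice[zeta hzeta] : forall y, exists z, Lam y ->
    z \in Z /\ chart_ball g z (q z) y.
  move=> y; have [/hZ[z zZ yz]|nLy] := pselect (Lam y); last by exists y.
  by exists z.
(* [E] is maximal (m, e0 / 4)-separated within each class simultaneously. *)
have [E [uE EZ Efar hE]] := @maximal_separated M (fun x y => cl x = cl y ->
  ((e0 / 4)%:E < bowen_dist rho psi m x y)%E) Z.
have EL x : x \in E -> Lam x by move=> /EZ/ZL.
pose x_ (i : 'I_(size E)) := tnth (in_tuple E) i.
have x_L i : Lam (x_ i) by apply: EL; exact: mem_tnth.
(* Cells are defined through the net point [zeta y], since [E] is maximal among net points only. *)
pose B i := [set y | [/\ Lam y, cl (zeta y) = cl (x_ i) &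
  forall j, (j < m)%N -> (rho (iter j psi (x_ i)) (iter j psi (zeta y)) <= e0%:E)%E]].
(* Coverings are built from the singular values at net points; e^(eta m) is the cost of reading them
   at the centre of the cell instead. *)
pose c i := D * (expR (eta * m%:R) * nu (x_ i)).
pose b i := expR (eta * m%:R) * alpha (x_ i).
have nu0 z : Lam z -> 0 < nu z by move=> Lz; exact: covering_weight_gt0.
have alpha0 z : Lam z -> 0 < alpha z by move=> Lz; exact: covering_radius_gt0.
have SB : Lam `<=` \bigcup_i B i.
  move=> y Ly; have [zZ _] := hzeta y Ly; have Lz := ZL _ zZ.
  have [x xE hx] := hE _ zZ.
  have xi : (index x E < size E)%N by rewrite index_mem.
  have xiE : x_ (Ordinal xi) = x by rewrite /x_ (tnth_nth x) /= nth_index.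
  exists (Ordinal xi) => //; rewrite /B /= xiE.
  have e4 : e0 / 4 <= e0 by move: e00; lra.
  have Lx := EL _ xE.
  case: hx => [<-|[|]].
  - split => // j _; apply: le_trans (riemannian_dist_refl g _) _.
    by rewrite lee_fin ltW.
  - move=> /not_implyP[cxz /negP]; rewrite -leNgt => xz; split => // j jm.
    apply: le_trans (bowen_dist_ge rho psi x (zeta y) jm) _.
    by apply: le_trans xz _; rewrite lee_fin.
  (* Closeness is known from [zeta y] to [x], and reversing it loses a factor 4: hence separation at
     scale e0 / 4. *)
  - move=> /not_implyP[cxz /negP]; rewrite -leNgt => xz; split => // j jm.
    apply: rho_swap; first exact: (iter_inv Lam_inv).
    exact: le_trans (bowen_dist_ge rho psi (zeta y) x jm) xz.
have em0 : 0 < expR (eta * m%:R) by exact: expR_gt0.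
have c0 i : 0 <= c i by rewrite mulr_ge0 ?mulr_ge0 ?ltW// nu0.
have b0 i : 0 < b i by rewrite mulr_gt0// alpha0.
have b_half i : b i <= 1 / 2.
  have kd : (minn (Num.truncn s) d.-1 < d)%N by rewrite -(prednK d0) ltnS geq_minr.
  have /andP[_] := inverse_branch_bounds lam1 L1 C1 expand bound m (x_L i) kd.
  rewrite -/(covering_radius s m (x_ i)) -/alpha => h.
  (* One half of the expansion pays for e^(eta m), the other for 2 C. *)
  have lamE : lam ^+ m = expR (m%:R * (ln lam / 2)) * expR (m%:R * (ln lam / 2)).
    rewrite -expRD -[lam in LHS]lnK ?posrE ?(lt_trans ltr01)// -expRM_natl.
    by congr expR; lra.
  have X0 := expR_gt0 (m%:R * (ln lam / 2)).
  have eX : expR (eta * m%:R) <= expR (m%:R * (ln lam / 2)).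
    by rewrite ler_expR mulrC ler_wpM2l.
  move: lamE X0 eX hC; set X := expR _ => lamE X0 eX hC.
  apply: (@le_trans _ _ (X * (C / (X * X)))).
    by rewrite -lamE; apply: ler_pM eX h; [exact: ltW|exact: ltW (alpha0 _ (x_L i))].
  have -> : X * (C / (X * X)) = C / X by field; rewrite gt_eqF.
  by rewrite ler_pdivrMr//; lra.
have cb : \sum_i c i * b i `^ s <= 1.
  have eP : 0 <= expR (m%:R * (r / 2)) by exact: expR_ge0.
  have := @class_sum_le T cl (fun x => expR (singular_potential g psi s m x)) E
    (e0 / 4) m (expR (m%:R * (r / 2))) (fun x => expR_ge0 _) eP uE EL.
  move=> /(_ _ hP) h.
  have {}h : \sum_(x <- E) expR (singular_potential g psi s m x)
      <= #|T|%:R * expR (m%:R * (r / 2)).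
    by apply: h => x y xE yE xy; exact: Efar.
  (* The errors in [c i] and in the s-th power of [b i] make up e^(eta (1 + s) m) <= e^(-r m / 4).
     Multiplied by the pressure bound e^(r m / 2) this leaves D #|T| e^(r m / 4), at most 1 by the
     choice of [J0]. *)
  apply: (@le_trans _ _ (D * expR (eta * (1 + s) * m%:R) *
      \sum_(x <- E) expR (singular_potential g psi s m x))).
    rewrite (big_tnth _ _ E) mulr_sumr; apply: ler_sum => i _.
    rewrite -/(x_ i) /c /b powRM ?(ltW em0) ?(ltW (alpha0 _ (x_L i)))//.
    have -> : expR (eta * m%:R) `^ s = expR (s * (eta * m%:R)).
      by rewrite /powR gt_eqF// expRK.
    have -> : eta * (1 + s) * m%:R = eta * m%:R + s * (eta * m%:R) by lra.
    rewrite expRD; have := covering_weight_le s0 m (x_L i).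
    rewrite -/nu -/alpha -/(nu _) -/(alpha _).
    set u := expR (eta * _); set v := expR (s * _); set w := alpha _ `^ s.
    have uv : 0 <= D * (u * v) by rewrite mulr_ge0 ?mulr_ge0 ?expR_ge0// ltW.
    move=> /(ler_wpM2l uv) h'; apply: le_trans h'; rewrite le_eqVlt; apply/orP; left; apply/eqP.
    by ring.
  apply: (@le_trans _ _ (D * expR (- r / 4 * m%:R) * (#|T|%:R * expR (m%:R * (r / 2))))).
    apply: ler_pM => //.
    - by rewrite mulr_ge0 ?expR_ge0// ltW.
    - by apply: sumr_ge0 => x _; exact: expR_ge0.
    - by rewrite ler_pM2l// ler_expR ler_wpM2r.
  have -> : D * expR (- r / 4 * m%:R) * (#|T|%:R * expR (m%:R * (r / 2))) =
      D * #|T|%:R * expR (m%:R * (r / 4)).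
    have -> : m%:R * (r / 4) = - r / 4 * m%:R + m%:R * (r / 2) by lra.
    by rewrite expRD; ring.
  have -> : expR (m%:R * (r / 4)) = (expR (m%:R * (- r / 4)))^-1.
    by rewrite -expRN; congr expR; lra.
  by rewrite ler_pdivrMr ?expR_gt0// mul1r.
have step i delta n : 0 < delta -> delta <= rho0 -> covered rho Lam n delta ->
    exists n', covered rho (B i) n' (delta * b i) /\ n'%:R <= n%:R * c i.
  move=> delta0 drho [V [LV hV]].
  (* The covering of [Lam] at scale delta is pulled back by psi^m inside the cell. *)
  pose S (l : 'I_n) := B i `&` [set y | V l (iter m psi y)].
  have /fin_all_exists[n' hn'] : forall l, exists n', covered rho (S l) n' (delta * b i) /\
      n'%:R <= c i.
    move=> l; have [[u [Bu Vu]]|S0] := pselect (S l !=set0); last first.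
      exists 0%N; split => //; exists (fun _ => set0).
      by split => // x Sx; exfalso; apply: S0; exists x.
    have [Lu cu hu] := Bu; have [zZ uz] := hzeta u Lu; have Lz := ZL _ zZ.
    have [q0 rr0 shadow cover] := hq _ Lz.
    have diam v w : S l v -> S l w -> (rho (iter m psi v) (iter m psi w) <= delta%:E)%E.
      by move=> [_ Vv] [_ Vw]; exact: hV Vv Vw.
    have kd : (minn (Num.truncn s) d.-1 < d)%N by rewrite -(prednK d0) ltnS geq_minr.
    (* Injectivity of psi^m on the cell in quantitative form: two points of [S l] follow the same
       orbit of pieces, so they are at distance at most delta / 2^J and one local covering serves
       all of [S l]. *)
    have close v : S l v -> (rho u v <= (rr (zeta u))%:E)%E.
      move=> Sv; have [[Lv cv hv] Vv] := Sv; have [zZ' vz] := hzeta v Lv.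
      have [_ _ shadow' _] := hq _ (ZL _ zZ').
      apply: (@le_trans _ _ (delta / 2 ^+ J)%:E).
        apply: (@shadowing_contracts J (x_ i) (zeta u) (zeta v)) => //.
        - by move=> j jm; split; [exact: hu|exact: shadow].
        - by move=> j jm; split; [exact: hv|exact: shadow'].
        - by apply: diam.
      rewrite lee_fin; apply: le_trans (hrho0 _ zZ); apply: le_trans drho.
      by rewrite ler_pdivrMr ?exprn_gt0// ler_peMr ?(ltW delta0) ?exprn_ege1 ?ler1n.
    have [n' [cn' nn']] := cover _ _ _ _ uz close delta0 diam kd (alpha0 _ Lz).
    have [ca cw] := hcl _ _ Lz (x_L i) cu.
    exists n'; split.
      by apply: covered_le cn'; rewrite ler_pM2l.
    by apply: le_trans nn' _; rewrite ler_pM2l.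
  exists (\sum_l n' l)%N; split.
    apply: (@covered_bigcup _ _ rho _ (B i) S) => [y By|l]; last exact: (hn' l).1.
    have [Ly _ _] := By; have [l _ Vl] := LV _ (iter_inv Lam_inv m Ly).
    by exists l.
  rewrite natr_sum; apply: (@le_trans _ _ (\sum_(l < n) c i)).
    by apply: ler_sum => l _; exact: (hn' l).2.
  by rewrite sumr_const card_ord -[leLHS]mulr_natl.
have [K K0 hK] := covering_recursion rho00 SB c0 b0 b_half cb s0
  (fun delta => compact_covered g Lam_compact) step.
by exists K, rho0.
Qed.

End BoxBound.

Lemma upper_box_dim_le (R : realType) (X : topologicalType) (dist : X -> X -> \bar R)
    (S : set X) (s K r0 : R) : 0 < K -> 0 < r0 ->
  (forall delta, 0 < delta -> delta <= r0 ->
    exists n, covered dist S n delta /\ n%:R <= K * delta `^ (- s)) ->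
  (upper_box_dim dist S <= s%:E)%E.
Proof.
move=> K0 r00 h; apply/lee_addgt0Pr => e e0; rewrite -EFinD /upper_box_dim limf_esupE.
(* The exponential makes log K at most e times -log delta, so [K] costs only e in the dimension; 1/2
   keeps -log delta positive. *)
pose r1 := Num.min (Num.min r0 (1 / 2)) (expR (- (ln K / e))).
have r10 : 0 < r1 by rewrite !lt_min r00 divr_gt0//= expR_gt0.
apply: (@le_trans _ _ (ereal_sup [set (lne (covering_number dist S delta) *
    ((- ln delta)^-1)%:E)%E | delta in [set delta : R | 0 < delta < r1]])).
  apply: ereal_inf_lbound; exists [set delta : R | 0 < delta < r1] => //.
  near=> delta => /=; apply/andP; split; near: delta.
    exact: nbhs_right_gt.
  exact: nbhs_right_lt.
apply: ge_ereal_sup => _ [delta /= /andP[d0 dr] <-].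
move: dr; rewrite !lt_min => /andP[/andP[dr d1] dK].
have lnd : 0 < - ln delta.
  by rewrite oppr_gt0 ln_lt0// d0; lra.
have lnK' : ln K <= e * (- ln delta).
  move: dK; rewrite -{1}[delta]lnK ?posrE// ltr_expR ltrNr ltr_pdivrMr// mulrC => /ltW.
  by rewrite mulrC.
have [n [cn nK]] := h _ d0 (ltW dr).
have pos : 0 < K * delta `^ (- s) by rewrite mulr_gt0// powR_gt0.
have : (covering_number dist S delta <= (K * delta `^ (- s))%:E)%E.
  by apply: le_trans (covering_number_le cn) _; rewrite lee_fin.
rewrite -lee_lne; last 2 first.
- rewrite in_itv /= leey andbT; apply: le_ereal_inf_tmp => _ [k _ <-].
  by rewrite lee_fin.
- by rewrite in_itv /= leey andbT lee_fin ltW.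
rewrite lne_EFin// lnM ?posrE ?powR_gt0// ln_powR => h1.
apply: (@le_trans _ _ ((ln K + - s * ln delta)%:E * ((- ln delta)^-1)%:E)%E).
  by apply: lee_wpmul2r => //; rewrite lee_fin invr_ge0 ltW.
rewrite -EFinM lee_fin ler_pdivrMr//; lra.
Unshelve. all: by end_near.
Qed.

(** Charts take values in a one-point space, so each domain is a single point and a compact set is
    finite. *)
Lemma zero_dimensional_box_dim (R : realType) (M : topologicalType)
    (A : smooth_atlas R 0 M) (g : riemannian_metric A) (S : set M) : compact S ->
  (upper_box_dim (riemannian_dist g) S <= 0)%E.
Proof.
move=> Sc; have [|s [_ hs]] := compact_finite_subcover (U := fun z => chart_ball g z 1) Sc.
  by move=> z _; apply: chart_ball_nbhs.
apply: (@upper_box_dim_le _ _ _ _ 0 (size s).+1%:R 1) => // delta delta0 _.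
exists (size s); split; last by rewrite oppr0 powRr0 mulr1 ler_nat.
exists (fun i => chart_ball g (tnth (in_tuple s) i) 1); split.
  move=> x /hs[z zs xz]; have zi : (index z s < size s)%N by rewrite index_mem.
  by exists (Ordinal zi) => //=; rewrite (tnth_nth z) /= nth_index.
move=> i x y [dx _] [dy _].
have -> : x = y.
  rewrite -(chart_mapK dx) -(chart_mapK dy); congr chart_inv.
  by apply/rowP; case.
by apply: le_trans (riemannian_dist_refl g y) _; rewrite lee_fin ltW.
Qed.

Lemma singularity_dim_ge0 (R : realType) (d : nat) (M : topologicalType)
    (A : smooth_atlas R d M) (g : riemannian_metric A) (psi : M -> M) (Lam : set M) :
  0 <= singularity_dim g psi Lam.
Proof.
rewrite /singularity_dim; set P := [set s : R | _].
have [[s Ps]|nP] := pselect (exists s, P s).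
  by have [[]] := xgetPex 0 (ex_intro _ s Ps).
by rewrite xgetPN// => s Ps; apply: nP; exists s.
Qed.

Theorem theorem1p3 (R : realType) (d : nat) (M : topologicalType)
    (M_hausdorff : hausdorff_space M) (M_second_countable : @second_countable M)
    (A : smooth_atlas R d M) (g : riemannian_metric A)
    (psi : M -> M) (psi_C1 : is_C1_map A psi)
    (Lam : set M) (Lam_repeller : is_repeller A psi Lam) :
  (upper_box_dim (riemannian_dist g) Lam
    <= (singularity_dim g psi Lam)%:E)%E.
Proof.
have [Lam_compact Lam0 LamE [k [lam [lam1 hk]]] _] := Lam_repeller.
(* For d = 0 every exponent is a zero of the pressure and the dimension takes its default value, so
   this case is separate. *)
have [d0|d0] := posnP d.
  subst d; apply: le_trans (zero_dimensional_box_dim g Lam_compact) _.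
  by rewrite lee_fin singularity_dim_ge0.
have Lam_inv z : Lam z -> Lam (psi z) by move=> Lz; rewrite -LamE; exists z.
have [C C1 expand] := expanding_iterates g psi_C1 Lam_compact Lam_inv lam1 hk.
have [L L1 hL] := tangent_map_bounded M_hausdorff g psi_C1 Lam_compact.
have bound := bounded_iterates psi_C1 Lam_inv L1 hL.
have [N [p [W [e0 [N0 e00 Wdiam [Wcontr Wsym] Wleb]]]]] :=
  expanding_cover M_hausdorff g psi_C1 Lam_compact Lam_inv lam1 hk.
have LamW x : Lam x -> exists i, W i x by move=> /Wleb[i [Wi _]]; exists i.
have p0 : (0 < p)%N.
  by have [x /LamW[i _]] := Lam0; exact: leq_ltn_trans (ltn_ord i).
have sep := separated_card Wdiam Wcontr Lam_inv Lam0 LamW.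
have lnlam : 0 < ln lam by exact: ln_gt0.
have pot0 n x : singular_potential g psi 0 n x = 0 by exact: singular_potential0.
have pot_le t s n x : 0 <= t -> 0 <= s -> Lam x ->
    singular_potential g psi (t + s) n x - singular_potential g psi t n x
      <= s * (ln C - n%:R * ln lam).
  move=> t0 s0 Lx.
  by have /andP[] := singular_potential_shift d0 lam1 L1 C1 expand bound n t0 s0 Lx.
have pot_ge t s n x : 0 <= t -> 0 <= s -> Lam x -> s * (- ln C - n%:R * ln L)
    <= singular_potential g psi (t + s) n x - singular_potential g psi t n x.
  move=> t0 s0 Lx.
  by have /andP[] := singular_potential_shift d0 lam1 L1 C1 expand bound n t0 s0 Lx.
have [s [s0 Ps] sP] := pressure_zero Lam0 p0 lnlam sep pot0 pot_le pot_ge.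
have -> : singularity_dim g psi Lam = s.
  apply: xget_unique.
    split=> // t [t0 Pt]; have [h1 h2] := sP _ _ t0 Pt.
    apply/eqP; rewrite eq_le !leNgt; apply/andP; split; apply/negP.
      by move=> /h2; rewrite ltxx.
    by move=> /h1; rewrite ltxx.
  by move=> t [_ ut]; apply: ut.
(* At [s] the pressure is 0 and gives no decay; at [s + e] it is negative, and e is arbitrary. *)
apply/lee_addgt0Pr => e e1; rewrite -EFinD.
have t0 : 0 <= s + e by rewrite addr_ge0// ltW.
have [r Pr _] := pressure_fin Lam0 p0 sep pot0 pot_le pot_ge t0.
have r0 : r < 0 by apply: (sP _ _ t0 Pr).1; rewrite ltrDl.
have e40 : 0 < e0 / 4 by rewrite divr_gt0.
have hN := pressure_lt0_sums Lam0 sep pot0 pot_le t0 e40 Pr r0.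
have [K [r1 [K0 r10 hK]]] := box_bound M_hausdorff psi_C1 Lam_compact Lam_inv d0 lam1 L1 C1
  expand bound N0 e00 Wcontr Wsym Wleb t0 r0 hN.
exact: upper_box_dim_le K0 r10 hK.
Qed.
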